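(* For every $d\ge 2$, the set $\mathcal{P}_{2d}(\mathbb{C})$ of Pellian polynomials is dense in $\mathcal{B}_{2d}(\mathbb{C})$ with respect to the complex topology.
   Context: $\mathcal{B}_{2d}\subset\mathbb{A}^{2d}_{\mathbb{C}}$ is the Zariski-open set of $\overline{s}=(s_1,\dots,s_{2d})$ such that $D_{\overline{s}}(t)=t^{2d}+s_1t^{2d-1}+\dots+s_{2d}$ has non-zero discriminant. A polynomial $D\in\mathbb{C}[t]$ is Pellian if the Pell–Abel equation $A^2-DB^2=1$ has a solution with $A,B\in\mathbb{C}[t]$, $B\neq0$. The Pellian locus is $\mathcal{P}_{2d}=\{\overline{s}\in\mathcal{B}_{2d}: D_{\overline{s}}\text{ is Pellian}\}$. *)

(* Defs.v *)
From HB Require Import structures.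
From mathcomp Require Import all_boot all_order all_algebra.
From mathcomp Require Import all_reals.
From mathcomp Require Import complex.
Set Implicit Arguments. Unset Strict Implicit. Unset Printing Implicit Defensive.
Import Order.TTheory GRing.Theory Num.Theory.
Local Open Scope ring_scope.

(* The monic polynomial D_s(t) = t^n + s_1 t^(n-1) + ... + s_n attached to
   s = (s_1, ..., s_n), stored as a row vector s : 'rV_n with s_k = s 0 (k-1). *)
Definition Dpoly (C : nzRingType) (n : nat) (s : 'rV[C]_n) : {poly C} :=
  'X^n + \sum_(i < n) s ord0 i *: 'X^(n - i.+1).

Definition disc (C : fieldType) (p : {poly C}) : C :=
  let m := (size p).-1 in
  (-1) ^+ 'C(m, 2) * (lead_coef p)^-1 * resultant p p^`().

Definition Pellian (C : nzRingType) (D : {poly C}) : Prop :=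
  exists A B : {poly C}, B != 0 /\ A ^+ 2 - D * B ^+ 2 = 1.

Definition Bset (C : fieldType) (n : nat) (s : 'rV[C]_n) : Prop :=
  disc (Dpoly s) != 0.
Definition Pset (C : fieldType) (n : nat) (s : 'rV[C]_n) : Prop :=
  Bset s /\ Pellian (Dpoly s).

(* Density of X in Y inside C^n = (R[i])^n for the complex (Euclidean/product)
   topology: every point of Y is approximated arbitrarily well, coordinatewise
   in modulus `|z| (the norm of the numClosedField R[i]), by points of X.
   (In R[i], 0 < eps forces eps to be a positive real.) *)
Definition dense_in (R : rcfType) (n : nat) (X Y : 'rV[R[i]]_n -> Prop) : Prop :=
  forall s, Y s -> forall eps : R[i], 0 < eps ->
    exists s', X s' /\ forall j : 'I_n, `|s' ord0 j - s ord0 j| < eps.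

(* Main.v *)
(** Let [D = \prod_k (1 - a_k X)] have degree [2 d] and distinct roots, seen from [0]
    in pairwise distinct directions, and let [w^2 = D].  For [size P <= d] the ray
    primitive [F] of [P dt / w] takes a value [II_j] at each branch point [1 / a_j].
    If all [II_j] agree with some [kappa] modulo [pi 'i Z / n], then
    [sinh (n (F - kappa)) * w] extends to an entire function of polynomial growth,
    so by Liouville [sinh (n (F - kappa)) = B w] and [cosh (n (F - kappa)) = A] with
    polynomials [A], [B], and [A^2 - D B^2 = 1].

    Counting real dimensions gives [P0 <> 0] for which all [II_j - II_0] are imaginary.
    Let [P] and [d - 1] branch points at which [P0] does not vanish vary.  The
    derivative of the map [(P, a) |-> (II_j - II_0)_j] is injective there, because a
    kernel element gives an exact differential [d (S / w)] with [deg S <= d] and [S]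
    vanishing at the [d + 1] fixed branch points.  Hence the map is locally onto, and
    all its values can be moved to rational multiples of [pi 'i]. *)
Require Import Defs.
From HB Require Import structures.
From mathcomp Require Import all_boot all_order all_algebra.
From mathcomp Require Import all_classical all_reals all_analysis.
From mathcomp Require Import complex separable.
From mathcomp Require Import ring lra zify.
Set Implicit Arguments. Unset Strict Implicit. Unset Printing Implicit Defensive.
Import Order.TTheory GRing.Theory Num.Theory.
Import numFieldNormedType.Exports.
Local Open Scope classical_set_scope.
Local Open Scope ring_scope.

(* The concrete field R[i] unfolds under unification, which makes proof search
   on its topology intractable; an abstract copy of its interface does not. *)
Record complexPlane (R : realType) := ComplexPlane {
  cpoint :> numClosedFieldType;
  ofR : {rmorphism R -> cpoint};
  re : {additive cpoint -> R};
  im : {additive cpoint -> R};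
  csqrt : cpoint -> cpoint;
  cE : forall z, z = ofR (re z) + 'i * ofR (im z);
  re_ofR : forall x, re (ofR x) = x;
  im_ofR : forall x, im (ofR x) = 0;
  re_i : re 'i = 0;
  im_i : im 'i = 1;
  reM : forall z w, re (z * w) = re z * re w - im z * im w;
  imM : forall z w, im (z * w) = re z * im w + im z * re w;
  leCE : forall z w : cpoint, (z <= w) = (im w == im z) && (re z <= re w);
  csqrt_sqr : forall z, csqrt z ^+ 2 = z;
  re_csqrt_ge0 : forall z, 0 <= re (csqrt z) }.

Arguments ofR {R c}.
Arguments re {R c}.
Arguments im {R c}.
Arguments csqrt {R c}.

Section ComplexPlane.
Variables (R : realType) (C : complexPlane R).
Implicit Types (x y : R) (z w : C).

Definition nrm (z : C) : R := re `|z|.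

Lemma reD z w : re (z + w) = re z + re w. Proof. exact: raddfD. Qed.
Lemma imD z w : im (z + w) = im z + im w. Proof. exact: raddfD. Qed.
Lemma reN z : re (- z) = - re z. Proof. exact: raddfN. Qed.
Lemma reB z w : re (z - w) = re z - re w. Proof. exact: raddfB. Qed.
Lemma imB z w : im (z - w) = im z - im w. Proof. exact: raddfB. Qed.
Lemma re0 : re (0 : C) = 0. Proof. exact: raddf0. Qed.
Lemma im0 : im (0 : C) = 0. Proof. exact: raddf0. Qed.
Lemma re1 : re (1 : C) = 1. Proof. by rewrite -(rmorph1 (@ofR R C)) re_ofR. Qed.
Lemma im1 : im (1 : C) = 0. Proof. by rewrite -(rmorph1 (@ofR R C)) im_ofR. Qed.

Lemma c_ext z w : re z = re w -> im z = im w -> z = w.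
Proof. by move=> h1 h2; rewrite [z]cE [w]cE h1 h2. Qed.

Lemma ofR_inj : injective (@ofR R C). Proof. exact: fmorph_inj. Qed.
Lemma ofR_le x y : (ofR x <= ofR y :> C) = (x <= y).
Proof. by rewrite leCE !im_ofR !re_ofR eqxx. Qed.
Lemma ofR_lt x y : (ofR x < ofR y :> C) = (x < y).
Proof. by rewrite !lt_neqAle ofR_le (inj_eq ofR_inj). Qed.

Lemma nrmE z : `|z| = ofR (nrm z).
Proof.
apply: c_ext; rewrite ?re_ofR // im_ofR.
by have := normr_ge0 z; rewrite leCE im0 => /andP[/eqP].
Qed.

Lemma nrm_ge0 z : 0 <= nrm z.
Proof. by rewrite -ofR_le -nrmE rmorph0. Qed.
Lemma nrmM z w : nrm (z * w) = nrm z * nrm w.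
Proof. by apply: ofR_inj; rewrite rmorphM -!nrmE normrM. Qed.
Lemma nrmD z w : nrm (z + w) <= nrm z + nrm w.
Proof. by rewrite -ofR_le rmorphD -!nrmE ler_normD. Qed.
Lemma nrmN z : nrm (- z) = nrm z.
Proof. by apply: ofR_inj; rewrite -!nrmE normrN. Qed.
Lemma nrmB z w : nrm (z - w) = nrm (w - z).
Proof. by rewrite -nrmN opprB. Qed.
Lemma nrm_eq0 z : (nrm z == 0) = (z == 0).
Proof. by rewrite -(inj_eq ofR_inj) -nrmE rmorph0 normr_eq0. Qed.
Lemma nrm_gt0 z : (0 < nrm z) = (z != 0).
Proof. by rewrite lt_neqAle nrm_ge0 andbT eq_sym nrm_eq0. Qed.
Lemma nrm0 : nrm 0 = 0. Proof. by apply/eqP; rewrite nrm_eq0. Qed.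
Lemma nrm1 : nrm 1 = 1.
Proof. by apply: ofR_inj; rewrite -nrmE normr1 rmorph1. Qed.
Lemma nrmV z : nrm z^-1 = (nrm z)^-1.
Proof. by apply: ofR_inj; rewrite -nrmE normfV nrmE fmorphV. Qed.
Lemma nrmX z n : nrm (z ^+ n) = nrm z ^+ n.
Proof. by apply: ofR_inj; rewrite -nrmE normrX nrmE rmorphXn. Qed.
Lemma nrm_ofR x : nrm (ofR x) = `|x|.
Proof.
have pos y : 0 <= y -> nrm (ofR y) = y.
  by move=> hy; rewrite /nrm ger0_norm ?re_ofR // leCE im0 im_ofR eqxx re0 re_ofR.
case: (leP 0 x) => hx; first by rewrite pos // ger0_norm.
by rewrite -nrmN -rmorphN pos ?ltr0_norm // oppr_ge0 ltW.
Qed.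
Lemma nrm_i : nrm ('i : C) = 1.
Proof. by apply: ofR_inj; rewrite -nrmE normCi rmorph1. Qed.

Lemma nrm_sq z : nrm z ^+ 2 = re z ^+ 2 + im z ^+ 2.
Proof.
have rR x : (ofR x : C) \is Num.real.
  have : (0 <= ofR x :> C) || (ofR x <= 0 :> C).
    by rewrite !leCE !im0 !im_ofR !re0 !re_ofR eqxx le_total.
  by [].
apply: ofR_inj; rewrite rmorphXn /= -nrmE rmorphD !rmorphXn {1}[z]cE.
by rewrite normC2_rect.
Qed.
Lemma re_le_nrm z : `|re z| <= nrm z.
Proof.
rewrite -(ler_pXn2r (n := 2)) ?nnegrE ?nrm_ge0 // nrm_sq real_normK ?num_real //.
by rewrite lerDl sqr_ge0.
Qed.
Lemma im_le_nrm z : `|im z| <= nrm z.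
Proof.
rewrite -(ler_pXn2r (n := 2)) ?nnegrE ?nrm_ge0 // nrm_sq real_normK ?num_real //.
by rewrite lerDr sqr_ge0.
Qed.
Lemma nrm_le z : nrm z <= `|re z| + `|im z|.
Proof.
rewrite {1}[z]cE; apply: le_trans (nrmD _ _) _.
by rewrite nrmM nrm_i mul1r !nrm_ofR.
Qed.

Lemma re_csqrt_gt0 z : (0 < re (csqrt z)) = ~~ (z <= 0).
Proof.
rewrite leCE lt_neqAle re_csqrt_ge0 andbT im0 re0; congr (~~ _).
rewrite -[in RHS](csqrt_sqr z) expr2 reM imM; set a := re _; set b := im _.
apply/idP/idP => [/eqP <-|/andP[/eqP h1 h2]].
  by rewrite !mul0r !mulr0 addr0 eqxx /= sub0r oppr_le0 -expr2 sqr_ge0.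
have /eqP : a * b = 0 by lra.
rewrite mulf_eq0 eq_sym => /orP[//|/eqP b0]; rewrite b0 mulr0 subr0 in h2.
by rewrite eq_sym -sqrf_eq0 expr2; apply/eqP/le_anti; rewrite h2 -expr2 sqr_ge0.
Qed.

Lemma re_sqr_pos z : 0 < re z -> ~~ (z ^+ 2 <= 0).
Proof.
move=> hz; apply/negP; rewrite leCE im0 re0 expr2 reM imM => /andP[/eqP h].
have : im z = 0 by nra.
by move=> ->; nra.
Qed.

Lemma csqrt_sq_pos z : 0 < re z -> csqrt (z ^+ 2) = z.
Proof.
move=> hz; have := csqrt_sqr (z ^+ 2).
move/eqP; rewrite eqf_sqr => /orP[/eqP//|/eqP h].
by have := re_csqrt_ge0 (z ^+ 2); rewrite h reN oppr_ge0 leNgt hz.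
Qed.

Lemma csqrt_neq0 z : z != 0 -> csqrt z != 0.
Proof. by apply: contra_neq => h; rewrite -(csqrt_sqr z) h expr0n. Qed.

Lemma nposC_conv (x : R) z : 0 <= x -> x <= 1 -> ~~ (z <= 0) ->
  ~~ (ofR (1 - x) + ofR x * z <= 0 :> C).
Proof.
move=> x0 x1; apply: contra; rewrite !leCE !(reD, imD, re0, im0) !reM !imM !im_ofR !re_ofR.
move=> /andP[/eqP h1 h2]; have xp : 0 < x.
  by rewrite lt_neqAle x0 andbT; apply/eqP => x00; nra.
by apply/andP; split; [apply/eqP|]; nra.
Qed.

End ComplexPlane.

Section ComplexTopology.
Variables (R : realType) (C : complexPlane R).

Lemma cvgC_P (T : Type) (F : set_system T) {FF : Filter F} (f : T -> C) (l : C) :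
  f x @[x --> F] --> l <->
  forall e : R, 0 < e -> \forall x \near F, nrm (l - f x) < e.
Proof.
split=> [/cvgrPdist_lt h e e0|h].
  have e0' : 0 < (ofR e : C) by rewrite -(rmorph0 (@ofR R C)) ofR_lt.
  by move: (h _ e0'); apply: filterS => x; rewrite nrmE ofR_lt.
apply/cvgrPdist_lt => e e0; have ee : e = ofR (nrm e) by rewrite -nrmE gtr0_norm.
have := h (nrm e); rewrite nrm_gt0 gt_eqF // => /(_ isT).
by apply: filterS => x hx; rewrite ee nrmE ofR_lt.
Qed.

Lemma cvg_re (T : Type) (F : set_system T) {FF : Filter F} (f : T -> C) (l : C) :
  f x @[x --> F] --> l -> re (f x) @[x --> F] --> re l.
Proof.
move=> /cvgC_P h; apply/cvgrPdist_lt => e /h; apply: filterS => x.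
by apply: le_lt_trans; rewrite -raddfB re_le_nrm.
Qed.

Lemma cvg_im (T : Type) (F : set_system T) {FF : Filter F} (f : T -> C) (l : C) :
  f x @[x --> F] --> l -> im (f x) @[x --> F] --> im l.
Proof.
move=> /cvgC_P h; apply/cvgrPdist_lt => e /h; apply: filterS => x.
by apply: le_lt_trans; rewrite -raddfB im_le_nrm.
Qed.

Lemma cvg_nrm (T : Type) (F : set_system T) {FF : Filter F} (f : T -> C) (l : C) :
  f x @[x --> F] --> l -> nrm (f x) @[x --> F] --> nrm l.
Proof.
by move=> h; exact: cvg_re (cvg_norm h).
Qed.

Lemma cvg_ofR (T : Type) (F : set_system T) {FF : Filter F} (f : T -> R) (l : R) :
  f x @[x --> F] --> l -> (ofR (f x) : C) @[x --> F] --> (ofR l : C).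
Proof.
move=> /cvgrPdist_lt h; apply/cvgC_P => e /h; apply: filterS => x.
by rewrite -rmorphB nrm_ofR.
Qed.

Lemma nbhs_nrm (z : C) (P : set C) :
  nbhs z P <-> exists2 e : R, 0 < e & forall w, nrm (z - w) < e -> P w.
Proof.
split=> [h|[e e0 h]].
  have [e e0 he] := (nbhs_ballP z P).1 h.
  have ee : e = ofR (nrm e) by rewrite -nrmE gtr0_norm.
  exists (nrm e); first by rewrite nrm_gt0 gt_eqF.
  by move=> w hw; apply: he; rewrite -ball_normE /= ee nrmE ofR_lt.
apply/(nbhs_ballP z P); exists (ofR e) => /=.
  by rewrite -(rmorph0 (@ofR R C)) ofR_lt.
by move=> w; rewrite -ball_normE /= nrmE ofR_lt; exact: h.
Qed.

Definition rint (f : R -> R) : R := (\int[lebesgue_measure]_(x in `[0%R, 1%R]) f x)%R.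

Definition cint (h : R -> C) : C :=
  ofR (rint (fun x => re (h x))) + 'i * ofR (rint (fun x => im (h x))).

Definition rcont01 (f : R -> R) :=
  forall x, 0 <= x <= 1 -> {for x, continuous f}.

Definition cont01 (h : R -> C) :=
  forall x, 0 <= x <= 1 -> {for x, continuous h}.

Lemma re_cint h : re (cint h) = rint (fun x => re (h x)).
Proof. by rewrite reD reM !re_ofR im_ofR re_i mul0r mulr0 subr0 addr0. Qed.
Lemma im_cint h : im (cint h) = rint (fun x => im (h x)).
Proof. by rewrite imD imM !re_ofR !im_ofR re_i im_i mul0r mul1r !add0r. Qed.

Lemma rcont01_integrable (f : R -> R) : rcont01 f ->
  lebesgue_measure.-integrable `[0, 1] (EFin \o f).
Proof.
move=> h; apply: continuous_compact_integrable; first exact: segment_compact.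
apply: continuous_in_subspaceT => x; rewrite inE /= in_itv /=; exact: h.
Qed.

Lemma cont01_re h : cont01 h -> rcont01 (fun x => re (h x)).
Proof. by move=> hc x /hc; exact: cvg_re. Qed.
Lemma cont01_im h : cont01 h -> rcont01 (fun x => im (h x)).
Proof. by move=> hc x /hc; exact: cvg_im. Qed.

Lemma eq_rint (f g : R -> R) : (forall x : R, 0 <= x <= 1 -> f x = g x) -> rint f = rint g.
Proof.
by move=> fg; apply: eq_Rintegral => x; rewrite inE /= in_itv /= => /fg.
Qed.

Lemma eq_cint (h k : R -> C) : (forall x : R, 0 <= x <= 1 -> h x = k x) -> cint h = cint k.
Proof.
by move=> hk; apply: c_ext; rewrite !(re_cint, im_cint); apply: eq_rint => x /hk ->.
Qed.

Lemma rint_lin (f g : R -> R) (a b : R) : rcont01 f -> rcont01 g ->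
  rint (fun x => a * f x + b * g x) = a * rint f + b * rint g.
Proof.
move=> cf cg; rewrite /rint -[X in X + _]RintegralZl //; last exact: rcont01_integrable.
rewrite -[X in _ + X]RintegralZl //; last exact: rcont01_integrable.
apply: RintegralD => //; apply: rcont01_integrable => x hx.
  by apply: cvgM; [exact: cvg_cst | exact: cf].
by apply: cvgM; [exact: cvg_cst | exact: cg].
Qed.

Lemma rint_cst (c : R) : rint (fun=> c) = c.
Proof.
by rewrite /rint Rintegral_cst //= lebesgue_measure_itv /= lte_fin ltr01 /= oppr0 addr0 mulr1.
Qed.

Lemma rint_le (f : R -> R) (M : R) : rcont01 f -> (forall x : R, 0 <= x <= 1 -> `|f x| <= M) ->
  `|rint f| <= M.
Proof.
move=> cf fM; have If := rcont01_integrable cf.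
apply: le_trans (le_normr_Rintegral _ If) _ => //; rewrite -[leRHS]rint_cst.
apply: le_Rintegral => //.
- by apply: rcont01_integrable => x hx; apply: cvg_norm; exact: cf.
- by apply: rcont01_integrable => x hx; exact: cvg_cst.
Qed.

Lemma cintD h k : cont01 h -> cont01 k -> cint (fun x => h x + k x) = cint h + cint k.
Proof.
move=> ch ck; apply: c_ext; rewrite ?[RHS]reD ?[RHS]imD !(re_cint, im_cint).
  have := rint_lin 1 1 (cont01_re ch) (cont01_re ck); rewrite !mul1r => <-.
  by apply: eq_rint => x _; rewrite reD !mul1r.
have := rint_lin 1 1 (cont01_im ch) (cont01_im ck); rewrite !mul1r => <-.
by apply: eq_rint => x _; rewrite imD !mul1r.
Qed.

Lemma cintZ (c : C) h : cont01 h -> cint (fun x => c * h x) = c * cint h.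
Proof.
move=> ch; apply: c_ext; rewrite ?[RHS]reM ?[RHS]imM !(re_cint, im_cint).
  rewrite -mulNr -rint_lin; [|exact: cont01_re|exact: cont01_im].
  by apply: eq_rint => x _; rewrite reM mulNr.
rewrite -rint_lin; [|exact: cont01_im|exact: cont01_re].
by apply: eq_rint => x _; rewrite imM.
Qed.

Lemma cint_cst (c : C) : cint (fun=> c) = c.
Proof. by apply: c_ext; rewrite (re_cint, im_cint) rint_cst. Qed.

Lemma cint_le h (M : R) : cont01 h -> (forall x : R, 0 <= x <= 1 -> nrm (h x) <= M) ->
  nrm (cint h) <= 2 * M.
Proof.
move=> ch hM.
apply: le_trans (nrm_le _) _; rewrite re_cint im_cint mulr_natl mulr2n.
apply: lerD; apply: rint_le.
- exact: cont01_re.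
- by move=> x /hM; apply: le_trans; exact: re_le_nrm.
- exact: cont01_im.
- by move=> x /hM; apply: le_trans; exact: im_le_nrm.
Qed.

Lemma near01 (T : topologicalType) (P : T -> R -> Prop) (p0 : T) :
  (forall x : R, 0 <= x <= 1 -> \forall y \near (p0, x), P y.1 y.2) ->
  \forall p \near p0, forall x : R, 0 <= x <= 1 -> P p x.
Proof.
move=> h.
have /compact_near_coveringP H := @segment_compact R 0 1.
have : \forall p \near p0, `[0, 1] `<=` P p.
  apply: (H T (nbhs p0) P) => x; rewrite /= in_itv /= => /h [[A B] [/= hA hB] AB].
  by exists (B, A) => // -[x' p'] [/= hx hp]; apply: (AB (p', x')).
by apply: filterS => p hp x hx; apply: hp; rewrite /= in_itv.
Qed.

Lemma cont_slice (T : topologicalType) (f : T * R -> C) (p : T) (x : R) :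
  {for (p, x), continuous f} -> {for x, continuous (fun x' => f (p, x'))}.
Proof.
move=> h; apply: (@cvg_comp _ _ _ (fun x' => (p, x')) f _ (nbhs (p, x))); last exact: h.
exact: (cvg_pair (cvg_cst _) cvg_id).
Qed.

Lemma cint_cont (T : topologicalType) (f : T * R -> C) (p0 : T) :
  (forall x : R, 0 <= x <= 1 -> \forall y \near (p0, x), {for y, continuous f}) ->
  [/\ \forall p \near p0, cont01 (fun x => f (p, x)),
      cont01 (fun x => f (p0, x)) &
      cint (fun x => f (p, x)) @[p --> p0] --> cint (fun x => f (p0, x))].
Proof.
move=> hf.
have c0 : \forall p \near p0, cont01 (fun x => f (p, x)).
  suff : \forall p \near p0, forall x : R, 0 <= x <= 1 -> {for (p, x), continuous f}.
    by apply: filterS => p hp x hx; exact: (cont_slice (hp _ hx)).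
  apply: (@near01 T (fun p x => {for (p, x), continuous f})) => x hx.
  by move: (hf x hx); apply: filterS => -[].
have c1 : cont01 (fun x => f (p0, x)) := nbhs_singleton c0.
split => //; apply/cvgC_P => e e0.
have e4 : 0 < e / 4 by rewrite divr_gt0.
have : \forall p \near p0, forall x : R, 0 <= x <= 1 -> nrm (f (p0, x) - f (p, x)) < e / 2 / 2.
  apply: (@near01 T (fun p x => nrm (f (p0, x) - f (p, x)) < e / 2 / 2)) => x hx.
  have h1 : {for (p0, x), continuous f} := nbhs_singleton (hf _ hx).
  have h2 : f (p0, y.2) @[y --> (p0, x)] --> f (p0, x).
    have h3 := cont_slice h1.
    apply: (@cvg_comp _ _ _ (fun y : T * R => y.2) (fun x' => f (p0, x')) _ (nbhs x)).
      exact: cvg_snd.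
    exact: h3.
  have : f (p0, y.2) - f y @[y --> (p0, x)] --> f (p0, x) - f (p0, x) by apply: cvgB.
  rewrite subrr => /cvgC_P /(_ (e / 2 / 2)) h3.
  have : 0 < e / 2 / 2 by rewrite !divr_gt0.
  move=> /h3; apply: filterS => -[p y] /=.
  by rewrite sub0r nrmN.
apply: filterS2 c0 => p cp hp.
have cN : cont01 (fun x => -1 * f (p, x)).
  by move=> x hx; apply: cvgM; [exact: cvg_cst|exact: cp].
have E : cint (fun x => f (p0, x)) - cint (fun x => f (p, x)) =
  cint (fun x => f (p0, x) + -1 * f (p, x)).
  by rewrite (cintD c1 cN) (cintZ _ cp) mulN1r.
rewrite E; apply: (@le_lt_trans _ _ (2 * (e / 2 / 2))).
  apply: cint_le => x hx.
    by apply: cvgD; [exact: c1|exact: cN].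
  by rewrite mulN1r ltW // hp.
lra.
Qed.

End ComplexTopology.

Section Continuity.
Variables (T U V : topologicalType).

Lemma nbhsE_all (x : T) (P : T -> Prop) : (forall z, P z) -> \forall z \near x, P z.
Proof. by move=> h; apply: nearW. Qed.
Lemma nbhsS (x : T) (P Q : T -> Prop) : (forall z, P z -> Q z) ->
  (\forall z \near x, P z) -> \forall z \near x, Q z.
Proof. by move=> h; apply: filterS. Qed.
Lemma nbhsS2 (x : T) (P Q S : T -> Prop) : (forall z, P z -> Q z -> S z) ->
  (\forall z \near x, P z) -> (\forall z \near x, Q z) -> \forall z \near x, S z.
Proof. by move=> h; apply: filterS2. Qed.

Lemma cont_refl (x : T) : {for x, continuous (fun z : T => z)}.
Proof. exact: cvg_id. Qed.
Lemma cont_const (v : V) (x : T) : {for x, continuous (fun _ : T => v)}.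
Proof. exact: cvg_cst. Qed.

Lemma cont_comp (f : T -> U) (g : U -> V) (x : T) :
  {for x, continuous f} -> {for f x, continuous g} ->
  {for x, continuous (fun z => g (f z))}.
Proof. by move=> hf hg; exact: (cvg_comp _ _ hf hg). Qed.

Lemma cont_fst (x : T * U) : {for x, continuous (fun z : T * U => z.1)}.
Proof. exact: cvg_fst. Qed.
Lemma cont_snd (x : T * U) : {for x, continuous (fun z : T * U => z.2)}.
Proof. exact: cvg_snd. Qed.

Lemma cont_pair (f : T -> U) (g : T -> V) (x : T) :
  {for x, continuous f} -> {for x, continuous g} ->
  {for x, continuous (fun z => (f z, g z))}.
Proof. by move=> hf hg; exact: cvg_pair hf hg. Qed.

Lemma cont_ofst (f : T -> V) (x : T * U) : {for x.1, continuous f} ->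
  {for x, continuous (fun z : T * U => f z.1)}.
Proof. by move=> hf; apply: (@cvg_comp _ _ _ fst f _ (nbhs x.1)) hf; exact: cvg_fst. Qed.
Lemma cont_osnd (f : U -> V) (x : T * U) : {for x.2, continuous f} ->
  {for x, continuous (fun z : T * U => f z.2)}.
Proof. by move=> hf; apply: (@cvg_comp _ _ _ snd f _ (nbhs x.2)) hf; exact: cvg_snd. Qed.

Lemma cont_near (f g : T -> U) (x : T) : (\forall z \near x, f z = g z) ->
  {for x, continuous f} -> {for x, continuous g}.
Proof.
move=> fg; rewrite /prop_for /continuous_at (nbhs_singleton fg) => hf.
exact: cvg_trans (near_eq_cvg fg) hf.
Qed.

End Continuity.

Section ComplexContinuity.
Variables (R : realType) (C : complexPlane R) (T : topologicalType).
Implicit Types (f g : T -> C) (x : T).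

Lemma contC_P f x : {for x, continuous f} <->
  forall e : R, 0 < e -> \forall z \near x, nrm (f x - f z) < e.
Proof. exact: cvgC_P. Qed.

Lemma contD f g x : {for x, continuous f} -> {for x, continuous g} ->
  {for x, continuous (fun z => f z + g z)}.
Proof. exact: cvgD. Qed.
Lemma contN f x : {for x, continuous f} -> {for x, continuous (fun z => - f z)}.
Proof. exact: cvgN. Qed.
Lemma contM f g x : {for x, continuous f} -> {for x, continuous g} ->
  {for x, continuous (fun z => f z * g z)}.
Proof. exact: cvgM. Qed.
Lemma contV f x : f x != 0 -> {for x, continuous f} ->
  {for x, continuous (fun z => (f z)^-1)}.
Proof. exact: cvgV. Qed.
Lemma cont_cst (c : C) x : {for x, continuous (fun=> c)}.
Proof. exact: cvg_cst. Qed.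

Lemma near_neq0 f x : {for x, continuous f} -> f x != 0 -> \forall z \near x, f z != 0.
Proof. exact: cvgr_neq0. Qed.

Lemma near_re_gt0 f x : {for x, continuous f} -> 0 < re (f x) ->
  \forall z \near x, 0 < re (f z).
Proof. by move=> /cvg_re /cvgr_gt; apply. Qed.

End ComplexContinuity.

(** * Strict differentiability *)

(* [sd io f x0 l]: [f] is strictly differentiable at [x0] with derivative [l]
   with respect to [io], in Hadamard's form: the difference quotient extends
   continuously to the diagonal point.  [io] is the identity of the complex
   plane or the embedding of the real line into it. *)
Section StrictDerivative.
Variables (R : realType) (C : complexPlane R) (T : topologicalType) (io : T -> C).
Implicit Types (f g : T -> C) (x : T) (l : C).

Definition sd f x0 l := exists q : T * T -> C,
  [/\ q (x0, x0) = l, {for (x0, x0), continuous q} &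
      \forall z \near (x0, x0), f z.1 - f z.2 = q z * (io z.1 - io z.2)].

Lemma near_diag (P : T -> Prop) (x y : T) :
  (\forall a \near x, P a) -> (\forall a \near y, P a) ->
  \forall z \near (x, y), P z.1 /\ P z.2.
Proof. by move=> hP hQ; exists (P, P) => //= -[a b] []. Qed.

Lemma near_slice (P : T * T -> Prop) (x y : T) :
  (\forall z \near (x, y), P z) -> \forall a \near x, P (a, y).
Proof.
case=> -[A B] [/= hA hB] AB; move: hA; apply: nbhsS => a Aa.
by apply: AB; split => //=; exact: nbhs_singleton hB.
Qed.

Lemma sd_near f g x l : (\forall z \near x, f z = g z) -> sd f x l -> sd g x l.
Proof.
move=> fg [q [q0 qc qE]]; exists q; split => //.
by apply: nbhsS2 qE (near_diag fg fg) => z h1 [h2 h3]; rewrite -h2 -h3.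
Qed.

Lemma sd_cst c x : sd (fun=> c) x 0.
Proof.
exists (fun=> 0); split => //; first exact: cvg_cst.
by apply: nbhsE_all => z; rewrite subrr mul0r.
Qed.

Lemma sd_io x : sd io x 1.
Proof.
exists (fun=> 1); split => //; first exact: cvg_cst.
by apply: nbhsE_all => z; rewrite mul1r.
Qed.

Lemma sdD f g x l k : sd f x l -> sd g x k -> sd (fun z => f z + g z) x (l + k).
Proof.
move=> [q [<- qc qE]] [p [<- pc pE]]; exists (fun z => q z + p z); split => //.
  exact: cvgD.
by apply: nbhsS2 qE pE => z hq hp; rewrite mulrDl -hq -hp; ring.
Qed.

Hypothesis io_cont : forall x, {for x, continuous io}.

Lemma sd_cont f x l : sd f x l -> {for x, continuous f}.
Proof.
move=> [q [q0 qc qE]].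
have hE : \forall z \near x, f x + q (z, x) * (io z - io x) = f z.
  apply: nbhsS (near_slice qE) => a /= <-.
  by rewrite addrC subrK.
apply: cont_near hE _.
apply: cvgD; first exact: cvg_cst.
apply: cvgM; last by apply: cvgB; [exact: io_cont|exact: cvg_cst].
by apply: (cont_comp (f := fun z => (z, x))) qc; apply: cont_pair; [exact: cvg_id|exact: cvg_cst].
Qed.

Lemma sdM f g x l k : sd f x l -> sd g x k ->
  sd (fun z => f z * g z) x (l * g x + f x * k).
Proof.
move=> hf hg; have cf := sd_cont hf; have cg := sd_cont hg.
move: hf hg => [q [<- qc qE]] [p [<- pc pE]].
exists (fun z => q z * g z.2 + f z.1 * p z); split => //.
  apply: cvgD; apply: cvgM => //.
    exact: cont_osnd.
  exact: cont_ofst.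
apply: nbhsS2 qE pE => z hq hp.
by rewrite mulrDl [q z * _]mulrC -!mulrA -hq -hp; ring.
Qed.

Lemma sdZ c f x l : sd f x l -> sd (fun z => c * f z) x (c * l).
Proof.
by move=> hf; have := sdM (sd_cst c x) hf; rewrite mul0r add0r.
Qed.

Lemma sdN f x l : sd f x l -> sd (fun z => - f z) x (- l).
Proof.
by move=> /(sdZ (-1)); rewrite mulN1r; apply: sd_near; apply: nbhsE_all => z; rewrite mulN1r.
Qed.

Lemma sdB f g x l k : sd f x l -> sd g x k -> sd (fun z => f z - g z) x (l - k).
Proof. by move=> hf /sdN hg; exact: sdD. Qed.

Lemma sdX f x l n : sd f x l -> sd (fun z => f z ^+ n) x (f x ^+ n.-1 *+ n * l).
Proof.
move=> hf; elim: n => [|n ih].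
  by rewrite mulr0n mul0r; apply: sd_near (sd_cst 1 x); apply: nbhsE_all.
have := sdM hf ih; rewrite (_ : l * _ + _ = f x ^+ n.+1.-1 *+ n.+1 * l).
  by apply: sd_near; apply: nbhsE_all => z; rewrite exprS.
by case: n {ih} => [|n] /=; rewrite ?expr0 ?mulr0n ?mul0r ?mulr0 ?addr0 ?mulr1n ?mulr1 ?mul1r //
  [in RHS]mulrS mulrDl mulrC; congr (_ + _); rewrite mulrA mulrnAr -exprS.
Qed.

Lemma sdV f x l : f x != 0 -> sd f x l -> sd (fun z => (f z)^-1) x (- l / f x ^+ 2).
Proof.
move=> fx hf; have cf := sd_cont hf; move: hf => [q [<- qc qE]].
have c1 : {for (x, x), continuous (fun z : T * T => f z.1)}.
  exact: cont_ofst.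
have c2 : {for (x, x), continuous (fun z : T * T => f z.2)}.
  exact: cont_osnd.
exists (fun z => - q z / (f z.1 * f z.2)); split => //.
  apply: cvgM; first exact: cvgN.
  by apply: cvgV; [rewrite mulf_neq0|exact: cvgM].
have n1 : \forall z \near x, f z != 0 := near_neq0 cf fx.
apply: nbhsS2 qE (near_diag n1 n1) => z hq [z1 z2].
by rewrite mulrAC mulNr -hq; field; rewrite z1 z2.
Qed.

Lemma sd_unit f x l : sd f x l -> forall k, l = k -> sd f x k.
Proof. by move=> + k <-. Qed.

End StrictDerivative.

Section StrictChain.
Variables (R : realType) (C : complexPlane R) (T : topologicalType) (io : T -> C).
Hypothesis io_cont : forall x, {for x, continuous io}.

Lemma sd_comp (f : C -> C) (g : T -> C) x l k :
  sd id f (g x) l -> sd io g x k -> sd io (fun z => f (g z)) x (l * k).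
Proof.
move=> [q [<- qc qE]] hg; have cg := sd_cont io_cont hg; move: hg => [p [<- pc pE]].
have cgg : {for (x, x), continuous (fun z : T * T => (g z.1, g z.2))}.
  apply: cont_pair; first exact: cont_ofst.
  exact: cont_osnd.
exists (fun z => q (g z.1, g z.2) * p z); split => //.
  by apply: cvgM => //; exact: (cont_comp cgg qc).
have := cgg _ qE; apply: nbhsS2 pE => z hp hq.
by rewrite [LHS]hq /= hp mulrA.
Qed.

Lemma sd_poly (p : {poly C}) (g : T -> C) x k :
  sd io g x k -> sd io (fun z => p.[g z]) x (p^`().[g x] * k).
Proof.
move=> hg; elim/poly_ind: p => [|p c ih].
  rewrite deriv0 horner0 mul0r; apply: sd_near (sd_cst io 0 x).
  by apply: nbhsE_all => z; rewrite horner0.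
have := sdD (sdM io_cont ih hg) (sd_cst io c x); rewrite addr0.
rewrite (_ : _ + _ = (p * 'X + c%:P)^`().[g x] * k).
  by apply: sd_near; apply: nbhsE_all => z; rewrite !hornerE.
by rewrite derivD derivC addr0 derivM derivX !hornerE; ring.
Qed.

Lemma sd_csqrt (z : C) : ~~ (z <= 0) -> sd id csqrt z (2 * csqrt z)^-1.
Proof.
move=> hz; have cs : {for z, continuous (@csqrt R C)}.
  apply/contC_P => e e0; rewrite -re_csqrt_gt0 in hz.
  have : \forall w \near z, nrm (z - w) < e * re (csqrt z).
    by apply/nbhs_nrm; exists (e * re (csqrt z)) => //; rewrite mulr_gt0.
  apply: nbhsS => w; rewrite -{1}(csqrt_sqr z) -{1}(csqrt_sqr w) subr_sqr nrmM.
  move=> h; rewrite -(ltr_pM2r hz); apply: le_lt_trans h.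
  apply: ler_wpM2l; first exact: nrm_ge0.
  apply: le_trans (le_trans (ler_norm _) (re_le_nrm _)).
  by rewrite reD lerDl re_csqrt_ge0.
exists (fun w => (csqrt w.1 + csqrt w.2)^-1).
have s0 : csqrt z + csqrt z != 0.
  by rewrite -mulr2n mulrn_eq0 /=; apply: csqrt_neq0; apply: contraNneq hz => ->.
split; first by rewrite mulr_natl mulr2n.
  apply: cvgV => //; apply: cvgD.
    exact: cont_ofst.
  exact: cont_osnd.
have n1 : \forall w \near z, 0 < re (csqrt w).
  by apply: near_re_gt0 => //; rewrite re_csqrt_gt0.
apply: nbhsS (near_diag n1 n1) => -[a b] [/= ha hb].
have E : a - b = (csqrt a - csqrt b) * (csqrt a + csqrt b).
  by rewrite -subr_sqr !csqrt_sqr.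
rewrite /= E mulrC mulfK //; apply/negP => /eqP h.
have : re (csqrt a + csqrt b) = 0 by rewrite h re0.
by rewrite reD => h2; move: ha hb h2; clear; lra.
Qed.

End StrictChain.

Section DifferenceQuotient.
Variables (R : realType) (C : complexPlane R) (T : topologicalType) (io : T -> C).
Hypothesis io_cont : forall x, {for x, continuous io}.
Hypothesis io_inj : injective io.
Hypothesis no_isolated : forall (x : T) (P : T -> Prop),
  (\forall a \near x, P a) -> exists2 a, P a & a != x.
Implicit Types (f : T -> C).

Definition dq f f' (z : T * T) : C :=
  if z.1 == z.2 then f' z.1 else (f z.1 - f z.2) / (io z.1 - io z.2).

Lemma dqE f f' z : f z.1 - f z.2 = dq f f' z * (io z.1 - io z.2).
Proof.
rewrite /dq; case: eqVneq => [->|h]; first by rewrite !subrr mulr0.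
by rewrite divfK // subr_eq0 (inj_eq io_inj).
Qed.

Lemma dq_diag f f' x : dq f f' (x, x) = f' x.
Proof. by rewrite /dq eqxx. Qed.

Lemma dq_cont f f' x y : (\forall a \near x, sd io f a (f' a)) ->
  (\forall a \near y, sd io f a (f' a)) -> {for (x, y), continuous (dq f f')}.
Proof.
case: (eqVneq x y) => [<- hx _|xy hx hy]; last first.
  have cfx := sd_cont io_cont (nbhs_singleton hx).
  have cfy := sd_cont io_cont (nbhs_singleton hy).
  have c0 : {for (x, y), continuous (fun z : T * T => io z.1 - io z.2)}.
    by apply: contD; [exact: cont_ofst|apply: contN; exact: cont_osnd].
  have n0 : io x - io y != 0 by rewrite subr_eq0 (inj_eq io_inj).
  apply: (@cont_near _ _ (fun z : T * T => (f z.1 - f z.2) / (io z.1 - io z.2))).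
    apply: nbhsS (near_neq0 c0 n0) => -[a b] /=; rewrite subr_eq0 (inj_eq io_inj) /dq /=.
    by move=> /negbTE ->.
  apply: contM; last exact: contV.
  by apply: contD; [exact: cont_ofst|apply: contN; exact: cont_osnd].
apply/contC_P => e e0; rewrite dq_diag.
have [q [q0 qc qE]] := nbhs_singleton hx.
have e2 : 0 < e / 2 by rewrite divr_gt0.
have := (contC_P _ _).1 qc _ e2; rewrite q0 => hq.
have Q : \forall z \near (x, x), f z.1 - f z.2 = q z * (io z.1 - io z.2) /\
    nrm (f' x - q z) < e / 2 by apply: nbhsS2 qE hq.
case: Q => -[A B] [/= hA hB] AB.
have hAB : \forall a \near x, [/\ A a, B a & sd io f a (f' a)].
  by apply: filterS3 hA hB hx.
have hI : \forall a \near x, \forall b \near a, [/\ A b, B b & sd io f b (f' b)].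
  exact: nbhs_interior.
apply: nbhsS (near_diag hI hI) => -[a b] /= [ha hb].
rewrite /dq /=; case: eqVneq => [_|ab].
  have [Aa Ba [p [p0 pc pE]]] := (nbhs_singleton ha : [/\ A a, B a & sd io f a (f' a)]).
  have := (contC_P _ _).1 pc _ e2; rewrite p0 => hp.
  have P1 := near_slice pE; have P2 := near_slice hp.
  have [c [[Ac _ _] [/= c1 c2]] ca] := no_isolated (nbhsS2 (fun _ h1 h2 => conj h1 h2) ha
    (nbhsS2 (fun _ h1 h2 => conj h1 h2) P1 P2)).
  have [/= d1 d2] := AB (c, a) (conj Ac Ba).
  have E : q (c, a) = p (c, a).
    apply: (@mulIf _ (io c - io a)); first by rewrite subr_eq0 (inj_eq io_inj).
    by rewrite -d1 -c1.
  have -> : f' x - f' a = (f' x - q (c, a)) + - (f' a - p (c, a)) by rewrite E; ring.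
  by apply: le_lt_trans (nrmD _ _) _; rewrite nrmN [ltRHS]splitr ltrD.
have [Aa Ba _] := (nbhs_singleton ha : [/\ A a, B a & sd io f a (f' a)]).
have [Ab Bb _] := (nbhs_singleton hb : [/\ A b, B b & sd io f b (f' b)]).
have [/= d1 d2] := AB (a, b) (conj Aa Bb).
rewrite d1 mulfK; last by rewrite subr_eq0 (inj_eq io_inj).
by apply: lt_le_trans d2 _; lra.
Qed.

Lemma sd_der_cont f f' x : (\forall a \near x, sd io f a (f' a)) ->
  {for x, continuous f'}.
Proof.
move=> h; have c := dq_cont h h.
have := cont_comp (cont_pair (@cont_refl _ x) (@cont_refl _ x)) c.
by apply: cont_near; apply: nbhsE_all => z; rewrite dq_diag.
Qed.

End DifferenceQuotient.

Section Primitives.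
Variables (R : realType) (C : complexPlane R).
Implicit Types (f : C -> C) (h : R -> C).

Lemma cont_ofR (x : R) : {for x, continuous (@ofR R C)}.
Proof. exact: cvg_ofR. Qed.
Lemma cont_id (x : C) : {for x, continuous (@id C)}.
Proof. exact: cvg_id. Qed.

Lemma no_isolatedC (x : C) (P : C -> Prop) :
  (\forall a \near x, P a) -> exists2 a, P a & a != x.
Proof.
move=> /nbhs_nrm [e e0 he]; exists (x + ofR (e / 2)).
  by apply: he; rewrite opprD addNKr nrmN nrm_ofR gtr0_norm ?divr_gt0 //; lra.
by rewrite -subr_eq0 addrC addKr fmorph_eq0 gt_eqF ?divr_gt0.
Qed.

Lemma sd_is_derive (u : C -> R) h (x : R) (l : C) :
  (forall z w, u (z - w) = u z - u w) -> (forall z a, u (z * ofR a) = u z * a) ->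
  (forall (T : topologicalType) (g : T -> C) y, {for y, continuous g} ->
    {for y, continuous (fun t => u (g t))}) ->
  sd ofR h x l -> is_derive x 1 (fun x => u (h x)) (u l).
Proof.
move=> uB uM uc [q [<- qc qE]].
have P1 := near_slice qE.
have H : (fun e : R => e^-1 *: (u (h (e *: 1 + x)) - u (h x))) @ 0^' --> u (q (x, x)).
  have c0 : {for 0, continuous (fun e : R => u (q (e + x, x)))}.
    apply: uc; apply: (cont_comp (f := fun e => (e + x, x))); rewrite /= ?add0r //.
    apply: cont_pair; last exact: cvg_cst.
    apply: cvgD; [exact: cvg_id|exact: cvg_cst].
  have c1 : u (q (e + x, x)) @[e --> 0^'] --> u (q (0 + x, x)).
    exact: cvg_within_filter.
  rewrite add0r in c1.
  have H0 : \forall e \near (0 : R), h (e + x) - h x = q (e + x, x) * (ofR (e + x) - ofR x).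
    have cx : {for 0, continuous (fun e : R => e + x)}.
      by apply: cvgD; [exact: cvg_id|exact: cvg_cst].
    by have := cx (fun y => h y - h x = q (y, x) * (ofR y - ofR x)); rewrite add0r => /(_ P1).
  have H1 : \forall e \near (0 : R)^', h (e + x) - h x = q (e + x, x) * (ofR (e + x) - ofR x).
    exact: cvg_within H0.
  apply: cvg_trans c1; apply: near_eq_cvg; near=> e.
  have e0 : e != 0 by near: e; exact: nbhs_dnbhs_neq.
  have Ee : h (e + x) - h x = q (e + x, x) * (ofR (e + x) - ofR x) by near: e.
  rewrite /= [_ *: 1]mulr1 -uB Ee rmorphD addrK uM.
  by rewrite [RHS]mulrC mulfK.
apply: DeriveDef; first by apply/cvg_ex; eexists; exact: H.
exact: cvg_lim H.
Unshelve. all: by end_near.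
Qed.

Lemma re_mulR (z : C) a : re (z * ofR a) = re z * a.
Proof. by rewrite reM re_ofR im_ofR mulr0 subr0. Qed.
Lemma im_mulR (z : C) a : im (z * ofR a) = im z * a.
Proof. by rewrite imM re_ofR im_ofR mulr0 add0r. Qed.

Lemma rint_FTC (F f : R -> R) : (forall x : R, 0 <= x <= 1 -> is_derive x 1 F (f x)) ->
  (forall x : R, 0 <= x <= 1 -> {for x, continuous F}) -> rcont01 f ->
  rint f = F 1 - F 0.
Proof.
move=> dF cF cf; rewrite /rint /Rintegral (@continuous_FTC2 _ f F) //.
- by apply: continuous_in_subspaceT => x; rewrite inE /= in_itv /=; exact: cf.
- split.
  + move=> x; rewrite in_itv /= => /andP[x0 x1].
    have H : 0 <= x <= 1 by rewrite !ltW.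
    by case: (dF x H).
  + by apply: cvg_at_right_filter; apply: cF; rewrite lexx ler01.
  + by apply: cvg_at_left_filter; apply: cF; rewrite lexx ler01.
- move=> x; rewrite in_itv /= => /andP[x0 x1].
  have H : 0 <= x <= 1 by rewrite !ltW.
  by rewrite derive1E; case: (dF x H).
Qed.

Lemma cint_FTC h h' : (forall x : R, 0 <= x <= 1 -> sd ofR h x (h' x)) -> cont01 h' ->
  cint h' = h 1 - h 0.
Proof.
move=> dh ch; have hc : cont01 h by move=> x /dh /(sd_cont cont_ofR).
have cre : forall (T : topologicalType) (g : T -> C) y, {for y, continuous g} ->
    {for y, continuous (fun t => re (g t))} by move=> T g y; exact: cvg_re.
have cim : forall (T : topologicalType) (g : T -> C) y, {for y, continuous g} ->
    {for y, continuous (fun t => im (g t))} by move=> T g y; exact: cvg_im.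
apply: c_ext; rewrite !(re_cint, im_cint) ?reB ?imB.
  apply: (rint_FTC (F := fun x => re (h x))) => [x /dh hx|x /hc hx|]; last exact: cont01_re.
    exact: sd_is_derive (@reB _ _) re_mulR cre hx.
  exact: cre.
apply: (rint_FTC (F := fun x => im (h x))) => [x /dh hx|x /hc hx|]; last exact: cont01_im.
  exact: sd_is_derive (@imB _ _) im_mulR cim hx.
exact: cim.
Qed.

Lemma sd_ray (z0 z1 : C) (x : R) : sd ofR (fun x => z0 + ofR x * z1) x z1.
Proof.
have := sdD (sd_cst ofR z0 x) (sdM cont_ofR (sd_io ofR x) (sd_cst ofR z1 x)).
by rewrite mul1r mulr0 addr0 add0r.
Qed.

Lemma ray1 (z0 z1 : C) : z0 + ofR 1 * (z1 - z0) = z1.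
Proof. by rewrite rmorph1 mul1r addrC subrK. Qed.
Lemma ray0 (z0 z1 : C) : z0 + ofR 0 * (z1 - z0) = z0.
Proof. by rewrite rmorph0 mul0r addr0. Qed.

Lemma path_const f (z0 z1 : C) :
  (forall x : R, 0 <= x <= 1 -> sd id f (z0 + ofR x * (z1 - z0)) 0) -> f z1 = f z0.
Proof.
move=> hf; apply/eqP; rewrite -subr_eq0.
have := @cint_FTC (fun x => f (z0 + ofR x * (z1 - z0))) (fun=> 0).
rewrite /= ray1 ray0 cint_cst => <- //.
  move=> x hx; have := sd_comp cont_ofR (hf x hx) (sd_ray z0 (z1 - z0) x).
  by rewrite mul0r.
by move=> x _; exact: cvg_cst.
Qed.

Lemma path_le f f' (z0 z1 : C) (M : R) :
  (forall x : R, 0 <= x <= 1 ->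
    \forall z \near z0 + ofR x * (z1 - z0), sd id f z (f' z)) ->
  (forall x : R, 0 <= x <= 1 -> nrm (f' (z0 + ofR x * (z1 - z0))) <= M) ->
  nrm (f z1 - f z0) <= 2 * (M * nrm (z1 - z0)).
Proof.
move=> hf hM.
have := @cint_FTC (fun x => f (z0 + ofR x * (z1 - z0)))
  (fun x => f' (z0 + ofR x * (z1 - z0)) * (z1 - z0)).
rewrite /= ray1 ray0 => E.
have H1 (x : R) : 0 <= x <= 1 -> sd ofR (fun x => f (z0 + ofR x * (z1 - z0))) x
   (f' (z0 + ofR x * (z1 - z0)) * (z1 - z0)).
  move=> hx; have h0 : sd id f (z0 + ofR x * (z1 - z0)) (f' (z0 + ofR x * (z1 - z0))).
    exact: (nbhs_singleton (hf x hx)).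
  exact: (sd_comp cont_ofR h0 (sd_ray z0 (z1 - z0) x)).
have H2 : cont01 (fun x => f' (z0 + ofR x * (z1 - z0)) * (z1 - z0)).
  move=> x hx; apply: contM; last exact: cont_cst.
  apply: (cont_comp (sd_cont cont_ofR (sd_ray z0 (z1 - z0) x))).
  exact: (sd_der_cont cont_id (@inj_id _) no_isolatedC (hf x hx)).
rewrite -(E H1 H2); apply: cint_le => // x hx.
by rewrite nrmM ler_wpM2r ?nrm_ge0 ?hM.
Qed.

Definition prim f (t : C) : C := cint (fun x => t * f (ofR x * t)).

Lemma prim0 f : prim f 0 = 0.
Proof.
by rewrite /prim -[RHS](cint_cst (0 : C)); apply: eq_cint => x _; rewrite mul0r.
Qed.

Lemma sd_prim f f' t :
  (forall x : R, 0 <= x <= 1 -> \forall z \near ofR x * t, sd id f z (f' z)) ->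
  sd id (prim f) t (f t).
Proof.
move=> hf; pose U (z : C) := \forall z \near z, sd id f z (f' z).
have hU (x : R) : 0 <= x <= 1 -> \forall z \near ofR x * t, U z.
  by move=> hx; exact: nbhs_interior (hf x hx).
have cU z : U z -> {for z, continuous f} by move=> /nbhs_singleton /(sd_cont cont_id).
pose dqf := dq id f f'.
have cdq z w : U z -> U w -> {for (z, w), continuous dqf}.
  by move=> hz hw; exact: (dq_cont cont_id (@inj_id _) no_isolatedC hz hw).
pose G (y : (C * C) * R) := f (ofR y.2 * y.1.1) +
  y.1.2 * (ofR y.2 * dqf (ofR y.2 * y.1.1, ofR y.2 * y.1.2)).
pose L (y : (C * C) * R) := ofR y.2 * y.1.1.
pose L' (y : (C * C) * R) := ofR y.2 * y.1.2.
have c2 y : {for y, continuous (fun y : (C * C) * R => ofR y.2 : C)}.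
  by apply: cont_osnd; exact: cont_ofR.
have cL y : {for y, continuous L}.
  by apply: contM; [exact: c2|exact: (@cont_ofst _ _ _ fst y (@cont_fst _ _ y.1))].
have cy12 y : {for y, continuous (fun y : (C * C) * R => y.1.2)}.
  exact: (@cont_ofst _ _ _ snd y (@cont_snd _ _ y.1)).
have cL' y : {for y, continuous L'} by apply: contM; [exact: c2|exact: cy12].
have cG y : U (L y) -> U (L' y) -> {for y, continuous G}.
  move=> h1 h2; apply: contD; first exact: cont_comp (cL y) (cU _ h1).
  apply: contM; first exact: cy12.
  apply: contM; first exact: c2.
  exact: (cont_comp (cont_pair (cL y) (cL' y)) (cdq _ _ h1 h2)).
have nG (x : R) : 0 <= x <= 1 -> \forall y \near ((t, t), x), {for y, continuous G}.
  move=> hx; have h1 := cL ((t, t), x) _ (hU x hx); have h2 := cL' ((t, t), x) _ (hU x hx).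
  by apply: nbhsS2 h1 h2 => y; exact: cG.
have [nc c0 cvg] := cint_cont nG.
have cf (s : C) : (forall x : R, 0 <= x <= 1 -> U (ofR x * s)) ->
    cont01 (fun x => s * f (ofR x * s)).
  move=> hs x hx; apply: contM; first exact: cont_cst.
  apply: (cont_comp (f := fun x : R => ofR x * s)); last exact: cU _ (hs x hx).
  by apply: contM; [exact: cont_ofR|exact: cont_cst].
have nU : \forall s \near t, forall x : R, 0 <= x <= 1 -> U (ofR x * s).
  have Q := @near01 R C (fun s x => U (ofR x * s)) t.
  apply: Q => x hx.
  have c : {for (t, x), continuous (fun y : C * R => ofR y.2 * y.1)}.
    by apply: contM; [apply: cont_osnd; exact: cont_ofR|exact: cont_fst].
  exact: c _ (hU x hx).
exists (fun z => cint (fun x => G (z, x))); split.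
- have h1 : cint (fun x => G ((t, t), x)) =
      cint (fun x => f (ofR x * t) + ofR x * (f' (ofR x * t) * t)).
    by apply: eq_cint => x _; rewrite /G /dqf dq_diag /=; ring.
  rewrite h1; have := @cint_FTC (fun x => ofR x * f (ofR x * t))
     (fun x => f (ofR x * t) + ofR x * (f' (ofR x * t) * t)).
  rewrite rmorph1 rmorph0 !mul1r mul0r subr0; apply.
    move=> x hx; have h0 : sd id f (ofR x * t) (f' (ofR x * t)) := nbhs_singleton (hf x hx).
    have hl : sd ofR (fun x => ofR x * t) x t.
      by have := sdM cont_ofR (sd_io ofR x) (sd_cst ofR t x); rewrite mul1r mulr0 addr0.
    have := sdM cont_ofR (sd_io ofR x) (sd_comp cont_ofR h0 hl).
    by rewrite mul1r.
  move=> x /c0; apply: cont_near; apply: nbhsE_all => y.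
  by rewrite /G /dqf dq_diag /=; ring.
- exact: cvg.
apply: nbhsS2 nc (near_diag nU nU) => -[a b] /= cab [ha hb].
have ca := cf a ha; have cb := cf b hb.
have cNb : cont01 (fun x => -1 * (b * f (ofR x * b))).
  by move=> x hx; apply: contM; [exact: cont_cst|exact: cb].
have -> : prim f a - prim f b = cint (fun x => a * f (ofR x * a) + -1 * (b * f (ofR x * b))).
  by rewrite (cintD ca cNb) (cintZ _ cb) mulN1r.
rewrite mulrC -(cintZ _ cab); apply: eq_cint => x hx.
rewrite /G /=; have := dqE (@inj_id _) f f' (ofR x * a, ofR x * b).
rewrite -/dqf /= => E.
transitivity ((a - b) * f (ofR x * a) + b * (f (ofR x * a) - f (ofR x * b))); first by ring.
by rewrite E; ring.
Qed.

End Primitives.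

Section ComplexExponential.
Variables (R : realType) (C : complexPlane R).
Implicit Types (z w : C) (x y : R).

Lemma derive_quotient (f : R -> R) x l : is_derive x 1 f l ->
  exists q : R -> R, [/\ q x = l, {for x, continuous q} &
    forall y, f y - f x = q y * (y - x)].
Proof.
move=> [df fl]; exists (fun y => if y == x then l else (f y - f x) / (y - x)).
split; first by rewrite eqxx.
- apply/cvgrPdist_lt => e e0; rewrite eqxx.
  have H : (fun h : R => h^-1 *: (f (h *: 1 + x) - f x)) @ 0^' --> l by rewrite -fl; exact: df.
  move/cvgrPdist_lt : H => /(_ e e0) [d /= d0 hd].
  apply/nbhs_ballP; exists d => // y; rewrite /ball /= => xy; case: eqVneq => [_|yx].
    by rewrite subrr normr0.
  have := hd (y - x); rewrite /ball /= sub0r normrN distrC => /(_ xy).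
  rewrite subr_eq0 => /(_ yx); rewrite [_ *: 1]mulr1 subrK.
  by rewrite [_ *: _]mulrC.
- move=> y; case: eqVneq => [->|yx]; first by rewrite !subrr mulr0.
  by rewrite divfK // subr_eq0.
Qed.

Definition cexp z : C := ofR (expR (re z)) * (ofR (cos (im z)) + 'i * ofR (sin (im z))).

Lemma cexp_ofR x : cexp (ofR x) = ofR (expR x).
Proof. by rewrite /cexp re_ofR im_ofR cos0 sin0 rmorph1 rmorph0 mulr0 addr0 mulr1. Qed.

Lemma cexp0 : cexp 0 = 1.
Proof. by rewrite -(rmorph0 (@ofR R C)) cexp_ofR expR0 rmorph1. Qed.

Lemma cexpD z w : cexp (z + w) = cexp z * cexp w.
Proof.
rewrite /cexp reD imD expRD cosD sinD rmorphM /= rmorphB !rmorphD !rmorphM /=.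
set a := ofR (expR _); set b := ofR (expR _).
have i2 : 'i * 'i = -1 :> C by rewrite -expr2 sqrCi.
transitivity (a * b * (ofR (cos (im z)) * ofR (cos (im w)) +
   ('i * 'i) * ofR (sin (im z)) * ofR (sin (im w)) +
   'i * (ofR (sin (im z)) * ofR (cos (im w)) + ofR (cos (im z)) * ofR (sin (im w))))).
  by rewrite i2; ring.
by ring.
Qed.

Lemma re_cis x y : re (ofR x + 'i * ofR y : C) = x.
Proof. by rewrite reD reM !re_ofR re_i im_i im_ofR mul0r mulr0 subr0 addr0. Qed.
Lemma im_cis x y : im (ofR x + 'i * ofR y : C) = y.
Proof. by rewrite imD imM !re_ofR re_i im_i !im_ofR mul0r add0r add0r mul1r. Qed.

Lemma nrm_cexp z : nrm (cexp z) = expR (re z).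
Proof.
rewrite nrmM nrm_ofR ger0_norm ?expR_ge0 // -[RHS]mulr1; congr (_ * _).
apply/eqP; rewrite -(@eqrXn2 _ 2) ?nrm_ge0 // expr1n nrm_sq re_cis im_cis.
by rewrite cos2Dsin2.
Qed.

Lemma cexp_neq0 z : cexp z != 0.
Proof. by rewrite -nrm_gt0 nrm_cexp expR_gt0. Qed.

Lemma cexpN z : cexp (- z) = (cexp z)^-1.
Proof.
by apply: (mulfI (cexp_neq0 z)); rewrite -cexpD subrr cexp0 divff ?cexp_neq0.
Qed.

Lemma cont_re (T : topologicalType) (g : T -> C) (p : T) : {for p, continuous g} ->
  {for p, continuous (fun t => re (g t))}.
Proof. exact: cvg_re. Qed.
Lemma cont_im (T : topologicalType) (g : T -> C) (p : T) : {for p, continuous g} ->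
  {for p, continuous (fun t => im (g t))}.
Proof. exact: cvg_im. Qed.
Lemma cont_ofRf (T : topologicalType) (g : T -> R) (p : T) : {for p, continuous g} ->
  {for p, continuous (fun t => ofR (g t) : C)}.
Proof. exact: cvg_ofR. Qed.

Lemma cont_cexp z : {for z, continuous cexp}.
Proof.
have cr : {for z, continuous (fun z : C => re z)} by apply: cont_re; exact: cont_refl.
have ci : {for z, continuous (fun z : C => im z)} by apply: cont_im; exact: cont_refl.
apply: contM; first by apply: cont_ofRf; apply: (cont_comp cr); exact: continuous_expR.
apply: contD; first by apply: cont_ofRf; apply: (cont_comp ci); exact: continuous_cos.
apply: contM; first exact: cont_cst.
by apply: cont_ofRf; apply: (cont_comp ci); exact: continuous_sin.
Qed.

Definition cexpq z : C := if z == 0 then 1 else (cexp z - 1) / z.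

Lemma cont_cexpq : {for 0, continuous cexpq}.
Proof.
have [A [A0 Ac AE]] := derive_quotient (is_derive_expR (0 : R)).
have [B [B0 Bc BE]] := derive_quotient (is_derive_cos (0 : R)).
have [S [S0 Sc SE]] := derive_quotient (is_derive_sin (0 : R)).
rewrite expR0 in A0 AE; rewrite cos0 in S0 BE; rewrite sin0 in B0 SE; rewrite oppr0 in B0.
have cr : {for (0 : C), continuous (fun z : C => re z)} by apply: cont_re; exact: cont_refl.
have ci : {for (0 : C), continuous (fun z : C => im z)} by apply: cont_im; exact: cont_refl.
pose u (z : C) : C := ofR (A (re z)).
pose v (z : C) : C := ofR (expR (re z)) * (ofR (B (im z)) + 'i * ofR (S (im z))).
have cu : {for 0, continuous u}.
  by apply: cont_ofRf; apply: (cont_comp cr); rewrite re0.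
have cv : {for 0, continuous v}.
  apply: contM; first by apply: cont_ofRf; apply: (cont_comp cr); exact: continuous_expR.
  apply: contD; first by apply: cont_ofRf; apply: (cont_comp ci); rewrite im0.
  apply: contM; first exact: cont_cst.
  by apply: cont_ofRf; apply: (cont_comp ci); rewrite im0.
have u0 : u 0 = 1 by rewrite /u re0 A0 rmorph1.
have v0 : v 0 = 'i by rewrite /v re0 im0 expR0 B0 S0 rmorph1 rmorph0 add0r mulr1 mul1r.
apply/contC_P => e e0; have e4 : 0 < e / 4 by rewrite divr_gt0.
have := (contC_P _ _).1 cu _ e4; have := (contC_P _ _).1 cv _ e4.
apply: nbhsS2 => z hv hu; rewrite {1}/cexpq eqxx /cexpq.
case: eqVneq => [_|z0]; first by rewrite subrr nrm0.
have E : cexp z - 1 = ofR (re z) * u z + ofR (im z) * v z.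
  rewrite /cexp /u /v.
  have -> : expR (re z) = 1 + A (re z) * re z by have := AE (re z); rewrite subr0; lra.
  have -> : cos (im z) = 1 + B (im z) * im z by have := BE (im z); rewrite subr0; lra.
  have -> : sin (im z) = S (im z) * im z by have := SE (im z); rewrite !subr0.
  by rewrite !rmorphD !rmorphM !rmorph1 /=; ring.
rewrite -(ltr_pM2r (x := nrm z)) ?nrm_gt0 // -nrmM mulrBl mul1r divfK // E.
have -> : z - (ofR (re z) * u z + ofR (im z) * v z) =
    ofR (re z) * (u 0 - u z) + ofR (im z) * (v 0 - v z).
  by rewrite u0 v0 {1}[z]cE; ring.
apply: le_lt_trans (nrmD _ _) _; rewrite !nrmM !nrm_ofR.
have h1 : `|re z| * nrm (u 0 - u z) <= nrm z * (e / 4).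
  by apply: ler_pM; rewrite ?nrm_ge0 ?re_le_nrm // ltW.
have h2 : `|im z| * nrm (v 0 - v z) <= nrm z * (e / 4).
  by apply: ler_pM; rewrite ?nrm_ge0 ?im_le_nrm // ltW.
have zp : 0 < nrm z by rewrite nrm_gt0.
apply: le_lt_trans (lerD h1 h2) _; rewrite -mulrDr mulrC ltr_pM2r //.
by clear -e0; lra.
Qed.

Lemma sd_cexp z : sd id cexp z (cexp z).
Proof.
exists (fun p : C * C => cexp p.2 * cexpq (p.1 - p.2)); split.
- by rewrite /cexpq subrr eqxx mulr1.
- apply: contM; first by apply: cont_osnd; exact: cont_cexp.
  apply: (cont_comp (f := fun p : C * C => p.1 - p.2)).
    by apply: contD; [exact: cont_fst|apply: contN; exact: cont_snd].
  by rewrite subrr; exact: cont_cexpq.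
apply: nbhsE_all => -[a b] /=; rewrite /cexpq subr_eq0.
case: eqVneq => [->|ab]; first by rewrite !subrr mulr0.
rewrite -mulrA divfK ?subr_eq0 // mulrBr mulr1 -cexpD; congr (cexp _ - _).
by rewrite addrC subrK.
Qed.

Lemma cexp_pi : cexp ('i * ofR pi) = -1.
Proof.
by rewrite /cexp -[_ * ofR pi]add0r -(rmorph0 (@ofR R C)) re_cis im_cis expR0 cospi sinpi
  rmorph1 rmorph0 mulr0 addr0 mul1r rmorphN rmorph1.
Qed.

Lemma cexp_ipi (k : int) : cexp ('i * ofR (pi * k%:~R)) = (-1) ^ k.
Proof.
have H (n : nat) : cexp ('i * ofR (pi * n%:R)) = (-1) ^+ n.
  elim: n => [|n ih]; first by rewrite mulr0 rmorph0 mulr0 cexp0 expr0.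
  by rewrite -natr1 mulrDr mulr1 rmorphD mulrDr cexpD ih cexp_pi exprSr.
case: k => n; first by rewrite -pmulrn H.
by rewrite NegzE mulrNz mulrN rmorphN mulrN cexpN -pmulrn H exprnN.
Qed.

End ComplexExponential.

(** * Liouville's theorem *)

Section Liouville.
Variables (R : realType) (C : complexPlane R).

Lemma const_off_finite (F : R -> R) (s : seq R) (a b : R) : a <= b ->
  (forall x : R, a <= x <= b -> {for x, continuous F}) ->
  (forall x : R, a < x < b -> x \notin s -> is_derive x 1 F 0) -> F b = F a.
Proof.
elim: s a b => [|c s ih] a b ab cF dF.
  move: ab; rewrite le_eqVlt => /orP[/eqP->//|ab].
  have [] := @MVT R F (fun=> 0) a b ab.
  - by move=> x; rewrite in_itv /= => hx; exact: dF.
  - by apply: continuous_in_subspaceT => x; rewrite inE /= in_itv /=; exact: cF.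
  by move=> x _; rewrite mul0r => /eqP; rewrite subr_eq0 => /eqP.
have [/andP[ac cb]|hc] := boolP (a < c < b).
  transitivity (F c); apply: ih.
  - exact: ltW.
  - by move=> x /andP[cx xb]; apply: cF; rewrite xb (le_trans (ltW ac)).
  - move=> x /andP[cx xb] xs; apply: dF; first by rewrite xb (lt_trans ac).
    by rewrite inE negb_or xs gt_eqF.
  - exact: ltW.
  - by move=> x /andP[ax xc]; apply: cF; rewrite ax (le_trans _ (ltW cb)).
  - move=> x /andP[ax xc] xs; apply: dF; first by rewrite ax (lt_trans _ cb).
    by rewrite inE negb_or xs lt_eqF.
apply: ih => // x hx xs; apply: dF => //; rewrite inE negb_or xs andbT.
by apply: contra hc => /eqP <-.
Qed.

Definition circ (x : R) : C := cexp ('i * ofR (pi * 2 * x)).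

Lemma nrm_circ x : nrm (circ x) = 1.
Proof.
rewrite nrm_cexp -[_ * ofR _]add0r -(rmorph0 (@ofR R C)) re_cis; exact: expR0.
Qed.
Lemma circ0 : circ 0 = 1. Proof. by rewrite /circ mulr0 rmorph0 mulr0 cexp0. Qed.
Lemma circ1 : circ 1 = 1.
Proof.
have -> : circ 1 = cexp ('i * ofR (pi * 2%:~R)) by rewrite /circ mulr1.
by rewrite cexp_ipi -exprnP sqrrN expr1n.
Qed.

Lemma sd_circ x : sd ofR circ x ('i * ofR (pi * 2) * circ x).
Proof.
have h := sdZ (@cont_ofR R C) ('i * ofR (pi * 2)) (sd_io (@ofR R C) x).
have h2 : sd ofR (fun x : R => 'i * ofR (pi * 2 * x) : C) x ('i * ofR (pi * 2) * 1).
  by apply: sd_near h; apply: nbhsE_all => y; rewrite [in RHS]rmorphM mulrA.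
by apply: (sd_unit (sd_comp (@cont_ofR R C) (sd_cexp _) h2)); rewrite mulr1 mulrC.
Qed.

Lemma near_notin (E : seq C) z : z \notin E -> \forall w \near z, w \notin E.
Proof.
elim: E => [|b E ih]; first by move=> _; apply: nbhsE_all.
rewrite inE negb_or => /andP[zb /ih h].
have c : {for z, continuous (fun w : C => w - b)}.
  by apply: contD; [exact: cont_refl|exact: cont_cst].
apply: nbhsS2 h (near_neq0 c _); last by rewrite subr_eq0.
by move=> w h1; rewrite subr_eq0 inE negb_or => ->.
Qed.

Section Mean.
Variables (f f' : C -> C) (E : seq C) (z0 : C).
Hypothesis cf : forall z, {for z, continuous f}.
Hypothesis df : forall z, z \notin E -> sd id f z (f' z).

Let arc (r x : R) : C := z0 + ofR r * circ x.
Definition circle_mean (r : R) : C := cint (fun x => f (z0 + ofR r * circ x)).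

Lemma cont_circ x : {for x, continuous circ}.
Proof. exact: (sd_cont (@cont_ofR R C) (sd_circ x)). Qed.

Lemma cont_arc (T : topologicalType) (g k : T -> R) y :
  {for y, continuous g} -> {for y, continuous k} ->
  {for y, continuous (fun t => arc (g t) (k t))}.
Proof.
move=> hg hk; apply: contD; first exact: cont_cst.
apply: contM; first exact: cont_ofRf.
by apply: (cont_comp (f := k)); last exact: cont_circ.
Qed.

Lemma cont_arc01 r : cont01 (fun x => f (arc r x)).
Proof.
move=> x hx; apply: (cont_comp (f := fun x => arc r x)); last exact: cf.
by apply: cont_arc; [exact: cvg_cst|exact: cvg_id].
Qed.

Lemma cont_circle_mean r : {for r, continuous circle_mean}.
Proof.
have H (x : R) : 0 <= x <= 1 ->
    \forall y \near (r, x), {for y, continuous (fun y : R * R => f (arc y.1 y.2))}.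
  move=> hx; apply: nbhsE_all => y; apply: (cont_comp (f := fun y : R * R => arc y.1 y.2)).
    by apply: cont_arc; [exact: cont_fst|exact: cont_snd].
  exact: cf.
by have [_ _] := cint_cont H; exact.
Qed.

Lemma sd_circle_mean (r : R) : r != 0 -> (forall x, arc r x \notin E) ->
  sd ofR circle_mean r 0.
Proof.
move=> r0 rE; pose dqf := dq id f f'.
have nE z : z \notin E -> \forall w \near z, sd id f w (f' w).
  by move=> /near_notin; apply: nbhsS => w; exact: df.
pose G (y : (R * R) * R) := circ y.2 * dqf (arc y.1.1 y.2, arc y.1.2 y.2).
have c11 y : {for y, continuous (fun y : (R * R) * R => y.1.1)}.
  exact: (@cont_ofst _ _ _ fst y (@cont_fst _ _ y.1)).
have c12 y : {for y, continuous (fun y : (R * R) * R => y.1.2)}.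
  exact: (@cont_ofst _ _ _ snd y (@cont_snd _ _ y.1)).
have c2 y : {for y, continuous (fun y : (R * R) * R => y.2)} by exact: cont_snd.
have ca y : {for y, continuous (fun y : (R * R) * R => arc y.1.1 y.2)}.
  exact: (cont_arc (c11 y) (c2 y)).
have cb y : {for y, continuous (fun y : (R * R) * R => arc y.1.2 y.2)}.
  exact: (cont_arc (c12 y) (c2 y)).
have cG y : arc y.1.1 y.2 \notin E -> arc y.1.2 y.2 \notin E -> {for y, continuous G}.
  move=> h1 h2; apply: contM; first by apply: cont_osnd; exact: cont_circ.
  apply: (cont_comp (cont_pair (ca y) (cb y))).
  exact: (dq_cont (@cont_id R C) (@inj_id _) (@no_isolatedC R C) (nE _ h1) (nE _ h2)).
have nG (x : R) : 0 <= x <= 1 -> \forall y \near ((r, r), x), {for y, continuous G}.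
  move=> hx.
  have h1 := ca ((r, r), x) _ (near_notin (rE x)).
  have h2 := cb ((r, r), x) _ (near_notin (rE x)).
  by apply: nbhsS2 h1 h2 => y; exact: cG.
have [nc c0 cvg] := cint_cont nG.
exists (fun z => cint (fun x => G (z, x))); split.
- have h1 : cint (fun x => G ((r, r), x)) = cint (fun x => circ x * f' (arc r x)).
    by apply: eq_cint => x _; rewrite /G /dqf dq_diag /=.
  have cc : cont01 (fun x => circ x * f' (arc r x)).
    move=> x /c0; apply: cont_near; apply: nbhsE_all => y.
    by rewrite /G /dqf dq_diag.
  rewrite h1; have := @cint_FTC R C (fun x => f (arc r x))
     (fun x => ofR r * ('i * ofR (pi * 2)) * (circ x * f' (arc r x))).
  rewrite (cintZ _ cc) /arc circ0 circ1 subrr => H; apply/eqP.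
  have k0 : ofR r * ('i * ofR (pi * 2)) != 0 :> C.
    by rewrite !mulf_neq0 ?fmorph_eq0 ?neq0Ci // mulf_neq0 // gt_eqF ?pi_gt0.
  have := H _ _; rewrite -/(arc _ _) => E0.
  rewrite -(mulrI_eq0 _ (mulfI k0)); apply/eqP; apply: E0.
    move=> x _; have hl : sd ofR (fun x => arc r x) x (ofR r * ('i * ofR (pi * 2) * circ x)).
      have := sdD (sd_cst ofR z0 x) (sdZ (@cont_ofR R C) (ofR r) (sd_circ x)).
      by rewrite add0r.
    by apply: (sd_unit (sd_comp (@cont_ofR R C) (df (rE x)) hl)); ring.
  by move=> x hx; apply: contM; [exact: cont_cst|exact: cc].
- exact: cvg.
apply: nbhsS nc => -[a b] /= cab.
have ca1 := @cont_arc01 a; have cb1 := @cont_arc01 b.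
have cNb : cont01 (fun x => -1 * f (arc b x)).
  by move=> x hx; apply: contM; [exact: cont_cst|exact: cb1].
have -> : circle_mean a - circle_mean b = cint (fun x => f (arc a x) + -1 * f (arc b x)).
  by rewrite (cintD ca1 cNb) (cintZ _ cb1) mulN1r.
rewrite mulrC -(cintZ _ cab); apply: eq_cint => x hx.
rewrite /G /=; have := dqE (@inj_id _) f f' (arc a x, arc b x).
by rewrite -/dqf /= mulN1r => ->; rewrite /arc; ring.
Qed.

Lemma circle_mean_value (r : R) : 0 <= r -> circle_mean r = f z0.
Proof.
move=> r0; have -> : f z0 = circle_mean 0.
  rewrite /circle_mean -[LHS]cint_cst; apply: eq_cint => x _.
  by rewrite rmorph0 mul0r addr0.
have dm (u : C -> R) x : (forall z w, u (z - w) = u z - u w) ->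
  (forall z a, u (z * ofR a) = u z * a) ->
  (forall (T : topologicalType) (g : T -> C) y, {for y, continuous g} ->
    {for y, continuous (fun t => u (g t))}) -> 0 < x < r ->
  x \notin [seq nrm (b - z0) | b <- E] -> is_derive x 1 (fun x => u (circle_mean x)) 0.
  move=> uB uM uc /andP[x0 xr] xE.
  have u0 : u 0 = 0 by have := uB 0 0; rewrite !subrr.
  rewrite -[X in is_derive _ _ _ X]u0; apply: sd_is_derive => //.
  apply: sd_circle_mean; first by rewrite gt_eqF.
  move=> y; apply: contra xE => hy; apply/mapP; exists (arc x y) => //.
  by rewrite /arc addrC addKr nrmM nrm_circ mulr1 nrm_ofR gtr0_norm.
have cm (u : C -> R) : (forall (T : topologicalType) (g : T -> C) y, {for y, continuous g} ->
    {for y, continuous (fun t => u (g t))}) -> forall x : R, 0 <= x <= r ->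
    {for x, continuous (fun x => u (circle_mean x))}.
  by move=> uc x _; apply: uc; exact: cont_circle_mean.
apply: c_ext.
  apply: (const_off_finite (F := fun x => re (circle_mean x))
    (s := [seq nrm (b - z0) | b <- E])) r0 _ _.
    by apply: cm => T g y; exact: cont_re.
  by move=> x hx hs; apply: dm => //; [exact: reB|exact: re_mulR|move=> T g y; exact: cont_re].
apply: (const_off_finite (F := fun x => im (circle_mean x))
  (s := [seq nrm (b - z0) | b <- E])) r0 _ _.
  by apply: cm => T g y; exact: cont_im.
by move=> x hx hs; apply: dm => //; [exact: imB|exact: im_mulR|move=> T g y; exact: cont_im].
Qed.

End Mean.

End Liouville.

Section LiouvilleTheorem.
Variables (R : realType) (C : complexPlane R).
Implicit Types (f : C -> C) (E : seq C).

Lemma nrm_ge_sub (z w : C) : nrm z - nrm w <= nrm (z - w).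
Proof. by rewrite lerBlDr -{1}(subrK w z) nrmD. Qed.

Lemma liouville0 f f' E (c r0 : R) :
  (forall z, {for z, continuous f}) ->
  (forall z, z \notin E -> sd id f z (f' z)) ->
  (forall z, r0 <= nrm z -> nrm (f z) * nrm z <= c) -> forall z, f z = 0.
Proof.
move=> cf df bf z0; apply/eqP; rewrite -nrm_eq0; apply/negPn/negP => n0.
set e := nrm (f z0) in n0; have e0 : 0 < e by rewrite lt_neqAle eq_sym n0 nrm_ge0.
pose rho := `|r0| + 1 + 4 * `|c| / e; pose r := rho + nrm z0.
have h4 : 0 <= 4 * `|c| / e by rewrite divr_ge0 ?mulr_ge0 // ltW.
have rho0 : 0 < rho by rewrite /rho -addrA ltr_wpDl // ltr_wpDr.
have rr : 0 <= r by rewrite addr_ge0 ?nrm_ge0 // ltW.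
have M := circle_mean_value z0 cf df rr.
have H : nrm (f z0) <= 2 * (`|c| / rho).
  rewrite -M; apply: cint_le; first exact: cont_arc01.
  move=> x hx; set z := z0 + _.
  have hz : rho <= nrm z.
    have := nrm_ge_sub (ofR r * circ C x) (- z0).
    rewrite opprK addrC nrmN nrmM nrm_circ mulr1 nrm_ofR ger0_norm // addrC [_ + z0]addrC.
    by rewrite /r addrK.
  have : r0 <= nrm z.
    by apply: le_trans hz; rewrite /rho -addrA ler_wpDr ?ler_norm // addr_ge0.
  move=> /bf hb; rewrite ler_pdivlMr //; apply: le_trans (le_trans hb (ler_norm _)).
  by apply: ler_wpM2l hz; exact: nrm_ge0.
move: H; rewrite -/e mulrA ler_pdivlMr // => H.
have : e * (4 * `|c| / e) = 4 * `|c| by rewrite mulrC divfK // gt_eqF.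
have : e * rho = e * `|r0| + e + e * (4 * `|c| / e) by rewrite /rho; ring.
have : 0 <= e * `|r0| by rewrite mulr_ge0 // ltW.
have : 0 <= `|c| by [].
move: e0 H; clear; set a := e * `|r0|; set b := e * rho; set k := e * _; set d := `|c|.
lra.
Qed.

Theorem liouville (N : nat) f f' E (c r0 : R) :
  (forall z, {for z, continuous f}) ->
  (forall z, z \notin E -> sd id f z (f' z)) ->
  (forall z, r0 <= nrm z -> nrm (f z) * nrm z <= c * nrm z ^+ N) ->
  exists p : {poly C}, forall z, f z = p.[z].
Proof.
elim: N f f' E c r0 => [|N ih] f f' E c r0 cf df bf.
  exists 0 => z; rewrite horner0; apply: (liouville0 cf df (r0 := r0) (c := c)) => w hw.
  by apply: le_trans (bf w hw) _; rewrite expr0 mulr1.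
pose z0 : C := ofR (1 + \sum_(b <- E) nrm b).
have z0E : z0 \notin E.
  apply/negP => hE.
  have : nrm z0 <= \sum_(b <- E) nrm b.
    by rewrite (big_rem _ hE) /= lerDl sumr_ge0 // => b _; exact: nrm_ge0.
  rewrite nrm_ofR ger0_norm; last by rewrite addr_ge0 // sumr_ge0 // => b _; exact: nrm_ge0.
  by rewrite gerDr ler10.
pose f1 z := dq id f f' (z, z0).
have cf0 z : {for z, continuous (fun z => f z - f z0)}.
  by apply: contD; [exact: cf|exact: cont_cst].
have cz0 (z : C) : {for z, continuous (fun z : C => z - z0)}.
  by apply: contD; [exact: cont_refl|exact: cont_cst].
have nE z : z != z0 -> \forall w \near z, (f w - f z0) / (w - z0) = f1 w.
  move=> hz; have := near_neq0 (cz0 z); rewrite subr_eq0 => /(_ hz).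
  by apply: nbhsS => w; rewrite subr_eq0 /f1 /dq /= => /negbTE ->.
have cf1 z : {for z, continuous f1}.
  case: (eqVneq z z0) => [->|hz]; last first.
    apply: cont_near (nE z hz) _; apply: contM; first exact: cf0.
    by apply: contV; rewrite ?subr_eq0.
  have h : \forall w \near z0, sd id f w (f' w).
    by apply: nbhsS (near_notin z0E) => w; exact: df.
  apply: (cont_comp (f := fun z => (z, z0))).
    by apply: cont_pair; [exact: cont_refl|exact: cont_const].
  exact: (dq_cont (@cont_id R C) (@inj_id _) (@no_isolatedC R C) h h).
pose f1' z := f' z * (z - z0)^-1 + (f z - f z0) * (- 1 / (z - z0) ^+ 2).
have df1 z : z \notin z0 :: E -> sd id f1 z (f1' z).
  rewrite inE negb_or => /andP[hz zE]; apply: sd_near (nE z hz) _.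
  have d1 : sd id (fun w => f w - f z0) z (f' z).
    by have := sdB (@cont_id R C) (df z zE) (sd_cst id (f z0) z); rewrite subr0.
  have d2 : sd id (fun w => w - z0) z 1.
    by have := sdB (@cont_id R C) (sd_io id z) (sd_cst id z0 z); rewrite subr0.
  have d3 := sdV (@cont_id R C) _ d2; rewrite subr_eq0 in d3.
  exact: (sdM (@cont_id R C) d1 (d3 hz)).
have [|p hp] := ih f1 f1' (z0 :: E) (2 * (c + nrm (f z0))) (2 * nrm z0 + 1 + `|r0|) cf1 df1.
  move=> z hz.
  have nz0 := nrm_ge0 z0; have ar0 : 0 <= `|r0| by [].
  have z1 : 1 <= nrm z by apply: le_trans hz; clear -nz0 ar0; lra.
  have zr : r0 <= nrm z.
    by apply: le_trans hz; have := ler_norm r0; clear -nz0; lra.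
  have zz : nrm z <= 2 * nrm (z - z0).
    by have := nrm_ge_sub z z0; clear -nz0 ar0 hz; lra.
  have zp : 0 < nrm z by apply: lt_le_trans z1.
  have zz0 : z != z0.
    by apply/negP => /eqP e0; rewrite e0 in hz; clear -hz nz0 ar0; lra.
  have b1 : nrm (f z) <= c * nrm z ^+ N.
    by have := bf z zr; rewrite exprSr mulrA ler_pM2r.
  have E1 : nrm (f1 z) * nrm (z - z0) = nrm (f z - f z0).
    by rewrite -nrmM /f1 -(dqE (@inj_id _) f f' (z, z0)).
  have b2 : nrm (f z0) <= nrm (f z0) * nrm z ^+ N.
    by rewrite ler_peMr ?nrm_ge0 // exprn_ege1.
  have b3 : nrm (f z - f z0) <= nrm (f z) + nrm (f z0).
    by apply: le_trans (nrmD _ _) _; rewrite nrmN.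
  have b4 : nrm (f1 z) * nrm z <= nrm (f1 z) * (2 * nrm (z - z0)).
    by apply: ler_wpM2l zz; exact: nrm_ge0.
  apply: le_trans b4 _; rewrite mulrCA E1 -mulrA ler_pM2l // mulrDl.
  by apply: le_trans b3 _; exact: lerD.
exists ((f z0)%:P + p * ('X - z0%:P)) => z; rewrite !hornerE -hp /f1.
by rewrite -(dqE (@inj_id _) f f' (z, z0)) /= addrC subrK.
Qed.

End LiouvilleTheorem.

(** * The primitive of [P dt / w] and its values at the branch points *)

Section StrictUnique.
Variables (R : realType) (C : complexPlane R).

Lemma sd_uniq (f : C -> C) x l k : sd id f x l -> sd id f x k -> l = k.
Proof.
move=> [q [<- qc qE]] [p [<- pc pE]]; apply/eqP; rewrite -subr_eq0; apply/negPn/negP => h.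
have c : {for (x, x), continuous (fun z : C * C => q z - p z)}.
  by apply: contD => //; exact: contN.
have [a [/= ha [hb hc]] ax] := no_isolatedC (near_slice (nbhsS2 (fun _ h1 h2 => conj h1 h2)
  (near_neq0 c h) (nbhsS2 (fun _ h1 h2 => conj h1 h2) qE pE))).
case/negP: ha; have := hc; rewrite hb => /eqP; rewrite -subr_eq0 -mulrBl mulf_eq0.
by rewrite [_ - x == 0]subr_eq0 (negbTE ax) orbF.
Qed.

Lemma near_npos (T : topologicalType) (f : T -> C) (x : T) :
  {for x, continuous f} -> ~~ (f x <= 0) -> \forall y \near x, ~~ (f y <= 0).
Proof.
move=> cf h.
have c : {for x, continuous (fun y => csqrt (f y))}.
  exact: (cont_comp cf (sd_cont (@cont_id R C) (sd_csqrt h))).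
have := near_re_gt0 c; rewrite re_csqrt_gt0 => /(_ h).
by apply: nbhsS => y; rewrite re_csqrt_gt0.
Qed.

Lemma near_forall (T : topologicalType) (J : finType) (P : J -> T -> Prop) (x : T) :
  (forall k, \forall y \near x, P k y) -> \forall y \near x, forall k, P k y.
Proof. by move=> h; apply: filter_forall. Qed.

End StrictUnique.

Section Branch.
Variables (R : realType) (C : complexPlane R) (J : finType) (a : J -> C).
Implicit Types (A : pred J) (P : {poly C}) (t v : C) (j k : J).

Definition rootw A t : C := \prod_(k | A k) csqrt (1 - a k * t).
Definition Dp A : {poly C} := \prod_(k | A k) (1 - a k *: 'X).
Definition dom A t := forall k, A k -> ~~ (1 - a k * t <= 0).

Lemma Dp_eval A t : (Dp A).[t] = \prod_(k | A k) (1 - a k * t).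
Proof. by rewrite horner_prod; apply: eq_bigr => k _; rewrite !hornerE. Qed.

Lemma rootw_sqr A t : rootw A t ^+ 2 = (Dp A).[t].
Proof. by rewrite Dp_eval -prodrXl; apply: eq_bigr => k _; rewrite csqrt_sqr. Qed.

Lemma rootw_neq0 A t : dom A t -> rootw A t != 0.
Proof.
move=> h; apply/prodf_neq0 => k /h hk; apply: csqrt_neq0.
by apply: contraNneq hk => ->.
Qed.

Lemma rootw0 A : rootw A 0 = 1.
Proof.
apply: big1 => k _; rewrite mulr0 subr0.
have := @csqrt_sq_pos R C 1; rewrite re1 expr1n; apply; exact: ltr01.
Qed.

Lemma rootwD1 A j t : A j ->
  rootw A t = csqrt (1 - a j * t) * rootw (fun k => A k && (k != j)) t.
Proof. exact: bigD1. Qed.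

Lemma cont_lin (c t : C) : {for t, continuous (fun s : C => 1 - c * s)}.
Proof.
by apply: contD; [exact: cont_cst|apply: contN; apply: contM; [exact: cont_cst|exact: cont_refl]].
Qed.

Lemma dom_near A t : dom A t -> \forall s \near t, dom A s.
Proof.
move=> h; apply: (@near_forall _ _ (fun k s => A k -> ~~ (1 - a k * s <= 0))) => k.
case: (boolP (A k)) => Ak; last by apply: nbhsE_all.
have hk := near_npos (f := fun s => 1 - a k * s) (@cont_lin (a k) t) (h k Ak).
by apply: nbhsS hk => s hs _.
Qed.

Lemma dom_star A t (x : R) : 0 <= x <= 1 -> dom A t -> dom A (ofR x * t).
Proof.
move=> /andP[x0 x1] h k /h hk.
have -> : 1 - a k * (ofR x * t) = ofR (1 - x) + ofR x * (1 - a k * t).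
  by rewrite rmorphB rmorph1; ring.
exact: nposC_conv.
Qed.

Lemma sd_rootw_ex A t : dom A t -> exists l, sd id (rootw A) t l.
Proof.
move=> h; rewrite /rootw.
suff : forall s : seq J, exists l, sd id (fun t => \prod_(k <- s | A k) csqrt (1 - a k * t)) t l.
  by move=> /(_ (index_enum J)).
elim=> [|k s [l ih]].
  by exists 0; apply: sd_near (sd_cst id 1 t); apply: nbhsE_all => z; rewrite big_nil.
case: (boolP (A k)) => Ak; last first.
  by exists l; apply: sd_near ih; apply: nbhsE_all => z; rewrite big_cons (negbTE Ak).
have d1 : sd id (fun t => 1 - a k * t) t (0 - a k * 1).
  by apply: (sdB (@cont_id R C)); [exact: sd_cst|apply: (sdZ (@cont_id R C)); exact: sd_io].
have d2 := sd_comp (g := fun t => 1 - a k * t) (@cont_id R C) (sd_csqrt (h k Ak)) d1.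
eexists; apply: sd_near (sdM (@cont_id R C) d2 ih).
by apply: nbhsE_all => z; rewrite big_cons Ak.
Qed.

Lemma sd_rootw A t : dom A t -> sd id (rootw A) t ((Dp A)^`().[t] / (2 * rootw A t)).
Proof.
move=> h; have [l hl] := sd_rootw_ex h; have w0 := rootw_neq0 h.
apply: (sd_unit hl).
have h1 : sd id (fun s => (Dp A).[s]) t (l * rootw A t + rootw A t * l).
  apply: sd_near (sdM (@cont_id R C) hl hl).
  by apply: nbhsE_all => z; rewrite -expr2 rootw_sqr.
have h2 := sd_poly (@cont_id R C) (Dp A) (sd_io id t); rewrite mulr1 in h2.
rewrite -(sd_uniq h1 h2); field.
by rewrite w0.
Qed.

Definition form P A t : C := P.[t] / rootw A t.
Definition dform P A t : C :=
  P^`().[t] / rootw A t - P.[t] * (Dp A)^`().[t] / (2 * rootw A t ^+ 3).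

Lemma sd_form P A t : dom A t -> sd id (form P A) t (dform P A t).
Proof.
move=> h; have w0 := rootw_neq0 h.
have h2 := sd_poly (@cont_id R C) P (sd_io id t).
apply: (sd_unit (sdM (@cont_id R C) h2 (sdV (@cont_id R C) w0 (sd_rootw h)))).
by rewrite /dform; field; rewrite w0.
Qed.

Lemma near_sd_form P A t : dom A t -> \forall s \near t, sd id (form P A) s (dform P A s).
Proof. by move=> /dom_near; apply: nbhsS => s; exact: sd_form. Qed.

(* A primitive of [P dt / w] on the plane slit along the rays from [1 / a k] away from [0]. *)
Definition FF P : C -> C := prim (form P xpredT).

Lemma sd_FF P t : dom xpredT t -> sd id (FF P) t (form P xpredT t).
Proof.
move=> h; apply: sd_prim => x hx; apply: near_sd_form; exact: dom_star.
Qed.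

(* [v], with [v ^+ 2 = 1 - a j * t] and [t = tau j v], is a coordinate at the branch
   point [1 / a j]; there [OO] is the odd primitive of [P dt / w], on the star-shaped
   set [VV], and [II] is the value of [FF] at [1 / a j]. *)
Definition tau j v : C := (1 - v ^+ 2) / a j.
Definition gg P j v : C := - 2 / a j * form P (predC1 j) (tau j v).
Definition OO P j : C -> C := prim (gg P j).
Definition VV j v := forall x : R, 0 <= x <= 1 -> dom (predC1 j) (tau j (ofR x * v)).
Definition II P j : C := - OO P j 1.

Hypothesis a_neq0 : forall j, a j != 0.
Hypothesis a_gen : forall j k, k != j -> ~~ (0 < a k / a j).

Lemma sd_tau j v : sd id (tau j) v (- 2 * v / a j).
Proof.
have h1 := sdX (@cont_id R C) 2 (sd_io id v).
have h2 := sdB (@cont_id R C) (sd_cst id 1 v) h1.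
apply: (sd_unit (sdM (@cont_id R C) h2 (sd_cst id (a j)^-1 v))).
by rewrite /= mulr0 addr0 sub0r expr1 mulr1 mulr2n; ring.
Qed.

Lemma cont_tau j v : {for v, continuous (tau j)}.
Proof. exact: (sd_cont (@cont_id R C) (sd_tau j v)). Qed.

Lemma tauN j v : tau j (- v) = tau j v.
Proof. by rewrite /tau sqrrN. Qed.

Lemma tauK j v : 1 - a j * tau j v = v ^+ 2.
Proof. by rewrite /tau mulrC divfK ?a_neq0 // opprB addrC subrK. Qed.

Lemma VV_scale j v (x : R) : 0 <= x <= 1 -> VV j v -> VV j (ofR x * v).
Proof.
move=> /andP[x0 x1] h y /andP[y0 y1]; rewrite mulrA -rmorphM; apply: h.
by rewrite mulr_ge0 // mulr_ile1.
Qed.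

Lemma VV_opp j v : VV j v -> VV j (- v).
Proof. by move=> h x hx; rewrite mulrN tauN; exact: h. Qed.

Lemma VV_dom j v : VV j v -> dom (predC1 j) (tau j v).
Proof. by move=> /(_ 1); rewrite rmorph1 mul1r lexx ler01; apply. Qed.

Lemma VV_near j v : VV j v -> \forall u \near v, VV j u.
Proof.
move=> h; apply: (@near01 R C (fun u x => dom (predC1 j) (tau j (ofR x * u))) v) => x hx.
have c : {for (v, x), continuous (fun y : C * R => tau j (ofR y.2 * y.1))}.
  apply: (cont_comp (f := fun y : C * R => ofR y.2 * y.1)); last exact: cont_tau.
  by apply: contM; [apply: cont_osnd; exact: cont_ofR|exact: cont_fst].
exact: (c _ (dom_near (h x hx))).
Qed.

Lemma VV_real j v : v ^+ 2 <= 1 -> VV j v.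
Proof.
move=> hv x /andP[x0 x1] k /= kj; apply/negP => h.
have hx : 0 <= 1 - (ofR x * v) ^+ 2.
  have x2 : 0 <= (ofR x : C) ^+ 2 <= 1.
    rewrite -rmorphXn -(rmorph0 (@ofR R C)) -(rmorph1 (@ofR R C)) !ofR_le.
    by rewrite sqr_ge0 expr_le1.
  case/andP: x2 => x20 x21; rewrite exprMn subr_ge0.
  by apply: le_trans x21; rewrite ler_piMr.
have : 1 <= (1 - (ofR x * v) ^+ 2) * (a k / a j).
  by move: h; rewrite /tau subr_le0 mulrCA.
move=> h1; have hp : 0 < 1 - (ofR x * v) ^+ 2.
  rewrite lt_neqAle hx andbT eq_sym; apply/eqP => e; move: h1.
  by rewrite e mul0r ler10.
have := lt_le_trans ltr01 h1; rewrite pmulr_rgt0 //; apply/negP; exact: a_gen.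
Qed.

Lemma gg_even P j v : gg P j (- v) = gg P j v.
Proof. by rewrite /gg tauN. Qed.

Definition dgg P j v : C := - 2 / a j * (dform P (predC1 j) (tau j v) * (- 2 * v / a j)).

Lemma near_sd_gg P j v : VV j v -> \forall u \near v, sd id (gg P j) u (dgg P j u).
Proof.
move=> /VV_near; apply: nbhsS => u /VV_dom hu.
apply: (sdZ (@cont_id R C)).
exact: (sd_comp (@cont_id R C) (sd_form P hu) (sd_tau j u)).
Qed.

Lemma sd_OO P j v : VV j v -> sd id (OO P j) v (gg P j v).
Proof.
move=> h; apply: sd_prim => x hx; apply: near_sd_gg; exact: VV_scale.
Qed.

Lemma cont_gg_ray P j v : VV j v -> cont01 (fun x => v * gg P j (ofR x * v)).
Proof.
move=> h x hx; apply: contM; first exact: cont_cst.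
apply: (cont_comp (f := fun x : R => ofR x * v)).
  by apply: contM; [exact: cont_ofR|exact: cont_cst].
have := nbhs_singleton (near_sd_gg P (VV_scale hx h)).
by move=> /(sd_cont (@cont_id R C)).
Qed.

Lemma OO_odd P j v : VV j v -> OO P j (- v) = - OO P j v.
Proof.
move=> h; transitivity (cint (fun x => -1 * (v * gg P j (ofR x * v)))); last first.
  by rewrite (cintZ _ (cont_gg_ray (P := P) h)) mulN1r.
by apply: eq_cint => x hx; rewrite mulrN gg_even; ring.
Qed.

Lemma dom_tau j v : 0 < re v -> VV j v -> dom xpredT (tau j v).
Proof.
move=> rv hv k _; have [->|kj] := eqVneq k j; first by rewrite tauK re_sqr_pos.
exact: (VV_dom hv).
Qed.

Lemma rootw_tau j v : 0 < re v -> rootw xpredT (tau j v) = v * rootw (predC1 j) (tau j v).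
Proof. by move=> rv; rewrite (@rootwD1 xpredT j) // tauK csqrt_sq_pos. Qed.

Lemma sd_diff_FO P j v : 0 < re v -> VV j v ->
  sd id (fun v => FF P (tau j v) - OO P j v) v 0.
Proof.
move=> rv hv.
have h1 := sd_comp (@cont_id R C) (sd_FF P (dom_tau rv hv)) (sd_tau j v).
apply: (sd_unit (sdB (@cont_id R C) h1 (sd_OO P hv))).
rewrite /gg /form rootw_tau //; have v0 : v != 0.
  by apply/negP => /eqP e; rewrite e re0 ltxx in rv.
have := rootw_neq0 (VV_dom hv); have := a_neq0 j => h2 h3.
by field; rewrite v0 h2 h3.
Qed.

Lemma FF_tau P j v : 0 < re v -> VV j v -> FF P (tau j v) = II P j + OO P j v.
Proof.
move=> rv hv; pose Del v := FF P (tau j v) - OO P j v.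
suff : Del v = II P j by rewrite /Del => <-; rewrite subrK.
have step z0 z1 : (forall x : R, 0 <= x <= 1 -> 0 < re (z0 + ofR x * (z1 - z0)) /\
    VV j (z0 + ofR x * (z1 - z0))) -> Del z1 = Del z0.
  move=> h; apply: path_const => x /h [h1 h2]; exact: sd_diff_FO.
have V0 : VV j 0 by apply: VV_real; rewrite expr0n ler01.
have [r r0 hr] := (nbhs_nrm _ _).1 (VV_near V0).
pose rho := Num.min 1 (r / (2 * (1 + nrm v))).
have nv := nrm_ge0 v.
have d0 : 0 < 2 * (1 + nrm v) by rewrite mulr_gt0 // ltr_wpDr.
have rho0 : 0 < rho by rewrite lt_min ltr01 divr_gt0.
have rho1 : rho <= 1 by rewrite ge_min lexx.
have rhor : rho * (1 + nrm v) < r.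
  have : rho * (2 * (1 + nrm v)) <= r by rewrite -ler_pdivlMr // ge_min lexx orbT.
  by have := mulr_gt0 rho0 d0; lra.
have -> : II P j = Del 1.
  by rewrite /Del /tau expr1n subrr mul0r /FF prim0 sub0r.
have e1 : Del v = Del (ofR rho * v).
  apply: step => x /andP[x0 x1].
  have -> : ofR rho * v + ofR x * (v - ofR rho * v) = ofR (rho + x * (1 - rho)) * v.
    by rewrite rmorphD rmorphM rmorphB rmorph1 /=; ring.
  have b0 : 0 < rho + x * (1 - rho) by nra.
  have b1 : rho + x * (1 - rho) <= 1 by nra.
  split; first by rewrite mulrC re_mulR mulr_gt0.
  by apply: VV_scale => //; rewrite (ltW b0) b1.
have e2 : Del (ofR rho * v) = Del (ofR rho).
  apply: step => x /andP[x0 x1].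
  have -> : ofR rho + ofR x * (ofR rho * v - ofR rho) = (ofR (1 - x) + v * ofR x) * ofR rho.
    by rewrite rmorphB rmorph1 /=; ring.
  split.
    rewrite re_mulR mulr_gt0 // reD re_ofR re_mulR.
    by move: x0; rewrite le_eqVlt => /orP[/eqP <-|x0]; [lra|have := mulr_gt0 rv x0; lra].
  apply: hr; rewrite sub0r nrmN nrmM nrm_ofR gtr0_norm //.
  apply: le_lt_trans rhor; rewrite mulrC ler_pM2l //.
  apply: le_trans (nrmD _ _) _; rewrite nrmM !nrm_ofR !ger0_norm ?subr_ge0 //.
  by nra.
rewrite e1 e2; symmetry; apply: step => x /andP[x0 x1].
have -> : ofR rho + ofR x * (1 - ofR rho) = ofR (rho + x * (1 - rho)) :> C.
  by rewrite rmorphD rmorphM rmorphB rmorph1.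
have b0 : 0 < rho + x * (1 - rho) by nra.
have b1 : rho + x * (1 - rho) <= 1 by nra.
split; first by rewrite re_ofR.
apply: VV_real; rewrite -rmorphXn -(rmorph1 (@ofR R C)) ofR_le.
by rewrite expr_le1 // ltW.
Qed.

End Branch.

Section EntireExtension.
Variables (R : realType) (C : complexPlane R) (J : finType) (a : J -> C).
Implicit Types (t v z : C) (j k : J).
Hypothesis a_neq0 : forall j, a j != 0.
Hypothesis a_gen : forall j k, k != j -> ~~ (0 < a k / a j).
Variables (P : {poly C}) (kappa : C) (psi psi' : C -> C) (eps : J -> C).
Hypothesis psi_sd : forall z, sd id psi z (psi' z).
Hypothesis psi_odd : forall z, psi (- z) = - psi z.
Hypothesis psi_per : forall j z, psi (z + (II a P j - kappa)) = eps j * psi z.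

Local Notation dom := (dom a).
Local Notation rootw := (rootw a).
Local Notation II := (II a P).
Local Notation OO := (OO a P).
Local Notation FF := (FF a P).
Local Notation VV := (VV a).
Local Notation tau := (tau a).

Lemma a_inj : injective a.
Proof.
move=> j k e; apply/eqP; apply/negPn/negP => jk.
by have := a_gen jk; rewrite e divff ?a_neq0 // ltr01.
Qed.

Definition slit_value j t v : C := eps j * psi (OO j v) * (v * rootw (predC1 j) t).

Definition ff t : C :=
  if [forall k, ~~ (1 - a k * t <= 0)] then psi (FF t - kappa) * rootw xpredT t
  else if [pick k | 1 - a k * t <= 0] is Some j
    then slit_value j t (csqrt (1 - a j * t)) else 0.

Lemma ff_dom t : dom xpredT t -> ff t = psi (FF t - kappa) * rootw xpredT t.
Proof. by move=> h; rewrite /ff ifT //; apply/forallP => k; exact: h. Qed.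

Lemma slit_value_opp j t v : VV j v -> slit_value j t (- v) = slit_value j t v.
Proof.
by move=> h; rewrite /slit_value (OO_odd P h) psi_odd; ring.
Qed.

(* A square root of [1 - a j * t] that is continuous across the slit. *)
Definition vt j t : C := 'i * csqrt (a j * t - 1).

Lemma vt_sqr j t : vt j t ^+ 2 = 1 - a j * t.
Proof. by rewrite exprMn csqrt_sqr sqrCi mulN1r opprB. Qed.

Lemma tau_sqr j t v : v ^+ 2 = 1 - a j * t -> tau j v = t.
Proof. by move=> h; rewrite /tau h opprB addrC subrK mulrC mulKf ?a_neq0. Qed.

Lemma cont_csqrt0 : {for 0, continuous (@csqrt R C)}.
Proof.
have s0 : csqrt 0 = 0 :> C.
  by apply/eqP; rewrite -sqrf_eq0 csqrt_sqr.
apply/contC_P => e e0; apply/nbhs_nrm; exists (e ^+ 2); first by rewrite exprn_gt0.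
move=> w; rewrite !sub0r s0 sub0r !nrmN -{1}(csqrt_sqr w) nrmX.
by rewrite ltr_pXn2r // nnegrE ?nrm_ge0 // ltW.
Qed.

Lemma cont_vt j t : 1 - a j * t <= 0 -> {for t, continuous (vt j)}.
Proof.
rewrite subr_le0 => h; apply: contM; first exact: cont_cst.
have c : {for t, continuous (fun t => a j * t - 1)}.
  by apply: contD; [apply: contM; [exact: cont_cst|exact: cont_refl]|exact: cont_cst].
apply: (cont_comp (f := fun t => a j * t - 1)) => //.
move: h; rewrite le_eqVlt => /orP[/eqP <-|h]; first by rewrite subrr; exact: cont_csqrt0.
apply: (sd_cont (@cont_id R C) (sd_csqrt _)).
by rewrite -subr_gt0 in h; rewrite lt_geF.
Qed.

Lemma VV_slit j t v : 1 - a j * t <= 0 -> v ^+ 2 = 1 - a j * t -> VV j v.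
Proof.
move=> h e; apply: VV_real => //.
by rewrite e; apply: le_trans h _; exact: ler01.
Qed.

Lemma ff_near_slit j t0 : 1 - a j * t0 <= 0 ->
  \forall t \near t0, ff t = slit_value j t (vt j t).
Proof.
move=> h; have v0 := VV_slit h (vt_sqr j t0).
have n1 := cont_vt h (VV_near v0).
have d0 := VV_dom v0; rewrite (tau_sqr (vt_sqr j t0)) in d0.
apply: nbhsS2 n1 (dom_near d0) => t hv hd.
pose v := csqrt (1 - a j * t).
have vpm : v = vt j t \/ v = - vt j t.
  have /eqP := vt_sqr j t; rewrite -(csqrt_sqr (1 - a j * t)) eqf_sqr -/v.
  by move=> /orP[/eqP|/eqP] ->; [left|right; rewrite opprK].
have Vv : VV j v by case: vpm => ->; [|exact: VV_opp].
have Ev : slit_value j t (vt j t) = slit_value j t v.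
  by case: vpm => [<-//|->]; rewrite slit_value_opp.
rewrite Ev; case: (boolP (1 - a j * t <= 0)) => hj.
  rewrite /ff ifF; last by apply/negP => /forallP /(_ j); rewrite hj.
  case: pickP => [k hk|/(_ j)]; last by rewrite hj.
  suff -> : k = j by [].
  by apply/eqP/negPn/negP => kj; have := hd k kj; rewrite hk.
have dt : dom xpredT t by move=> k _; have [->//|kj] := eqVneq k j; exact: hd.
have rv : 0 < re v by rewrite re_csqrt_gt0.
have tv : tau j v = t by apply: tau_sqr; exact: csqrt_sqr.
have := FF_tau a_neq0 a_gen P rv Vv; rewrite ff_dom // tv => ->.
have := rootw_tau a_neq0 j rv; rewrite tv => ->.
by rewrite [II j + _]addrC -addrA psi_per.
Qed.

Lemma not_dom t : ~~ [forall k, ~~ (1 - a k * t <= 0)] -> exists j, 1 - a j * t <= 0.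
Proof. by rewrite negb_forall => /existsP [j]; rewrite negbK => hj; exists j. Qed.

Lemma cont_ff t : {for t, continuous ff}.
Proof.
have cpsi z : {for z, continuous psi} := sd_cont (@cont_id R C) (psi_sd z).
have [/forallP h|/not_dom [j h]] := boolP [forall k, ~~ (1 - a k * t <= 0)].
  have dt : dom xpredT t by move=> k _; exact: h.
  apply: (@cont_near _ _ (fun t => psi (FF t - kappa) * rootw xpredT t)).
    by apply: nbhsS (dom_near dt) => s /ff_dom ->.
  apply: contM; last exact: (sd_cont (@cont_id R C) (sd_rootw dt)).
  apply: (cont_comp (f := fun t => FF t - kappa)); last exact: cpsi.
  apply: contD; last exact: cont_cst.
  exact: (sd_cont (@cont_id R C) (sd_FF P dt)).
have v0 := VV_slit h (vt_sqr j t).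
have d0 := VV_dom v0; rewrite (tau_sqr (vt_sqr j t)) in d0.
apply: (@cont_near _ _ (fun t => slit_value j t (vt j t))).
  by apply: nbhsS (ff_near_slit h) => s ->.
apply: contM.
  apply: contM; first exact: cont_cst.
  apply: (cont_comp (f := fun t => OO j (vt j t))); last exact: cpsi.
  apply: (cont_comp (cont_vt h)).
  exact: (sd_cont (@cont_id R C) (sd_OO P v0)).
apply: contM; first exact: cont_vt.
exact: (sd_cont (@cont_id R C) (sd_rootw d0)).
Qed.

Lemma sd_ff t : t \notin [seq (a j)^-1 | j <- enum J] -> exists l, sd id ff t l.
Proof.
move=> tE; have [/forallP h|/not_dom [j h]] := boolP [forall k, ~~ (1 - a k * t <= 0)].
  have dt : dom xpredT t by move=> k _; exact: h.
  have d1 : sd id (fun t => FF t - kappa) t (form a P xpredT t).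
    by have := sdB (@cont_id R C) (sd_FF P dt) (sd_cst id kappa t); rewrite subr0.
  have d2 := sd_comp (g := fun t => FF t - kappa) (@cont_id R C) (psi_sd _) d1.
  eexists; apply: sd_near (sdM (@cont_id R C) d2 (sd_rootw dt)).
  by apply: nbhsS (dom_near dt) => s /ff_dom ->.
have v0 := VV_slit h (vt_sqr j t).
have d0 := VV_dom v0; rewrite (tau_sqr (vt_sqr j t)) in d0.
have hj : ~~ (a j * t - 1 <= 0).
  move: h; rewrite subr_le0 le_eqVlt => /orP[/eqP e|h]; last first.
    by rewrite -subr_gt0 in h; rewrite lt_geF.
  case/negP: tE; apply/mapP; exists j; first by rewrite mem_enum.
  by apply: (mulfI (a_neq0 j)); rewrite divff ?a_neq0.
have d1 : sd id (fun t => a j * t - 1) t (a j).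
  have := sdB (@cont_id R C) (sdZ (@cont_id R C) (a j) (sd_io id t)) (sd_cst id 1 t).
  by rewrite subr0 mulr1.
have d2 := sd_comp (g := fun t => a j * t - 1) (@cont_id R C) (sd_csqrt hj) d1.
have d3 := sdZ (@cont_id R C) 'i d2.
have d4 := sd_comp (g := vt j) (@cont_id R C) (sd_OO P v0) d3.
have d5 := sd_comp (g := fun t => OO j (vt j t)) (@cont_id R C) (psi_sd _) d4.
have d6 := sdZ (@cont_id R C) (eps j) d5.
have d7 := sdM (@cont_id R C) d3 (sd_rootw d0).
eexists; apply: sd_near (sdM (@cont_id R C) d6 d7).
by apply: nbhsS (ff_near_slit h) => s ->.
Qed.

Lemma no_isolatedR (x : R) (Q : R -> Prop) :
  (\forall y \near x, Q y) -> exists2 y, Q y & y != x.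
Proof.
move=> /nbhs_ballP [e /= e0 he]; exists (x + e / 2).
  apply: he; rewrite /ball /= opprD addNKr normrN gtr0_norm ?divr_gt0 //.
  by rewrite ltr_pdivrMr // ltr_pMr // ltr1n.
by rewrite -subr_eq0 addrC addKr gt_eqF ?divr_gt0.
Qed.

Lemma dom_dense t : \forall s \near (0 : R), s != 0 -> dom xpredT (t * (1 + 'i * ofR s)).
Proof.
suff : \forall s \near (0 : R), forall k, s != 0 -> ~~ (1 - a k * (t * (1 + 'i * ofR s)) <= 0).
  by apply: nbhsS => s hs s0 k _; exact: hs.
apply: near_forall => k; case: (boolP (1 - a k * t <= 0)) => hk.
  apply: nbhsE_all => s s0; apply/negP; move: hk; rewrite !leCE im0 re0.
  rewrite !imB !reB im1 re1 mulrA; set b := a k * t.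
  have -> : im (b * (1 + 'i * ofR s)) = im b + re b * s.
    by rewrite imM imD reD !imM !reM re1 im1 re_ofR im_ofR re_i im_i; ring.
  move=> /andP[/eqP b0 b1] /andP[/eqP b2 _].
  have b4 : im b = 0 by apply/eqP; rewrite -oppr_eq0 -sub0r -b0.
  move/esym/eqP: b2; rewrite b4 sub0r add0r oppr_eq0 mulf_eq0 (negbTE s0) orbF => /eqP b3.
  by move: b1; rewrite b3 subr0 ler10.
have c : {for 0, continuous (fun s : R => 1 - a k * (t * (1 + 'i * ofR s)))}.
  apply: contD; first exact: cont_cst.
  apply: contN; apply: contM; first exact: cont_cst.
  apply: contM; first exact: cont_cst.
  apply: contD; first exact: cont_cst.
  by apply: contM; [exact: cont_cst|exact: cont_ofR].
have := near_npos c; rewrite rmorph0 mulr0 addr0 mulr1 => /(_ hk).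
by apply: nbhsS => s hs _.
Qed.

Lemma entire_extension (N : nat) (c r0 : R) :
  (forall t, dom xpredT t -> r0 <= nrm t -> nrm (ff t) * nrm t <= c * nrm t ^+ N) ->
  exists B : {poly C}, forall t, dom xpredT t -> psi (FF t - kappa) = B.[t] * rootw xpredT t.
Proof.
move=> grow.
have grow' t : r0 <= nrm t -> nrm (ff t) * nrm t <= c * nrm t ^+ N.
  move=> ht; rewrite leNgt; apply/negP => hlt.
  pose g (s : R) := t * (1 + 'i * ofR s).
  have cg : {for 0, continuous g}.
    apply: contM; first exact: cont_cst.
    apply: contD; first exact: cont_cst.
    by apply: contM; [exact: cont_cst|exact: cont_ofR].
  have g0 : g 0 = t by rewrite /g rmorph0 mulr0 addr0 mulr1.
  pose u (s : R) : C := ofR (nrm (ff (g s)) * nrm (g s)) - ofR c * ofR (nrm (g s)) ^+ N.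
  have cn : {for 0, continuous (fun s => ofR (nrm (g s)) : C)}.
    by apply: cont_ofRf; exact: cvg_nrm.
  have cu : {for 0, continuous u}.
    apply: contD.
      apply: cont_ofRf; apply: cvgM; last exact: cvg_nrm.
      by apply: cvg_nrm; apply: (cont_comp cg); exact: cont_ff.
    apply: contN; apply: contM; first exact: cont_cst.
    have : {for 0, continuous (fun s : R => ('X^N : {poly C}).[ofR (nrm (g s))])}.
      apply: (cont_comp cn (g := fun z => ('X^N : {poly C}).[z])).
      exact: (sd_cont (@cont_id R C) (sd_poly (@cont_id R C) _ (sd_io id _))).
    by apply: cont_near; apply: nbhsE_all => s; rewrite hornerXn.
  have u0 : 0 < re (u 0).
    by rewrite /u g0 -rmorphXn -rmorphM -rmorphB re_ofR subr_gt0.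
  have [s [hs hd] s0] := no_isolatedR (nbhsS2 (fun _ h1 h2 => conj h1 h2)
    (near_re_gt0 cu u0) (dom_dense t)).
  have dg := hd s0.
  have ng : nrm t <= nrm (g s).
    rewrite /g nrmM -{1}[nrm t]mulr1 ler_wpM2l ?nrm_ge0 //.
    apply: le_trans (le_trans (ler_norm _) (re_le_nrm _)).
    by rewrite -(rmorph1 (@ofR R C)) re_cis.
  have := grow _ dg (le_trans ht ng); rewrite leNgt; case/negP.
  by move: hs; rewrite /u -rmorphXn -rmorphM -rmorphB re_ofR subr_gt0.
have /choice [f' hf'] : forall t, exists l,
    t \notin [seq (a j)^-1 | j <- enum J] -> sd id ff t l.
  move=> t; have [|tE] := boolP (t \in [seq (a j)^-1 | j <- enum J]); first by exists 0.
  by have [l hl] := sd_ff tE; exists l.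
have [p hp] := liouville (N := N) cont_ff hf' grow'.
have proot j : root p (a j)^-1.
  have h : 1 - a j * (a j)^-1 <= 0 by rewrite divff ?a_neq0 // subrr.
  rewrite /root -hp (nbhs_singleton (ff_near_slit h)) /slit_value.
  have -> : vt j (a j)^-1 = 0.
    by apply/eqP; rewrite -sqrf_eq0 vt_sqr divff ?a_neq0 // subrr.
  by rewrite mul0r mulr0.
have Dp_prod : Dp a xpredT = (\prod_k - a k) *: \prod_(k <- enum J) ('X - (a k)^-1%:P).
  rewrite -mul_polyC rmorph_prod big_enum /= -big_split /=; apply: eq_bigr => k _.
  rewrite mulrBr -rmorphM mulNr divff ?a_neq0 // rmorphN mulNr mul_polyC rmorphN.
  by rewrite opprK rmorph1 addrC.
have /dvdpP [B hB] : Dp a xpredT %| p.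
  rewrite Dp_prod dvdpZl; last by apply/prodf_neq0 => k _; rewrite oppr_eq0.
  rewrite -(big_map (fun k => (a k)^-1) xpredT (fun z => 'X - z%:P)).
  apply: uniq_roots_dvdp; first by apply/allP => z /mapP [k _ ->].
  rewrite uniq_rootsE map_inj_uniq ?enum_uniq // => j k /invr_inj; exact: a_inj.
exists B => t dt; have w0 := rootw_neq0 dt.
apply: (mulIf w0); rewrite -ff_dom // hp hB hornerM -mulrA -expr2 rootw_sqr //.
Qed.

End EntireExtension.

Section Bounds.
Variables (R : realType) (C : complexPlane R).

Lemma disc_bounded (f : C -> C) (r : R) : (forall z, {for z, continuous f}) ->
  exists M : R, forall z, nrm z <= r -> nrm (f z) <= M.
Proof.
move=> cf; pose g (y : R * R) : C := f (ofR y.1 + 'i * ofR y.2).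
have cg y : {for y, continuous g}.
  apply: (cont_comp (f := fun y : R * R => ofR y.1 + 'i * ofR y.2 : C)); last exact: cf.
  apply: contD; first by apply: cont_ofst; exact: cont_ofR.
  by apply: contM; [exact: cont_cst|apply: cont_osnd; exact: cont_ofR].
have /compact_near_coveringP K :=
  compact_setX (@segment_compact R (- r) r) (@segment_compact R (- r) r).
have [M [_ hM]] : \forall M \near +oo, `[- r, r] `*` `[- r, r] `<=` [set y | nrm (g y) <= M].
  apply: (K R +oo (fun M y => nrm (g y) <= M)) => y _.
  exists ([set y' | nrm (g y - g y') < 1], [set M : R | nrm (g y) + 1 < M]) => /=.
    split; first exact: ((contC_P g y).1 (cg y) 1 ltr01).
    exact: nbhs_pinfty_gt (num_real _).
  move=> [y' M] /= [h1 h2]; apply: le_trans (ltW h2).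
  rewrite -[g y'](subrK (g y)) addrC; apply: le_trans (nrmD _ _) _.
  by rewrite lerD2l nrmB ltW.
exists (M + 1) => z hz; have := hM (M + 1); rewrite ltrDl ltr01 => /(_ isT).
move=> H; suff : nrm (g (re z, im z)) <= M + 1 by rewrite /g /= -cE.
apply: (H (re z, im z)).
have := re_le_nrm z; have := im_le_nrm z; rewrite !ler_norml => /andP[i1 i2] /andP[r1 r2].
split; rewrite /= in_itv /=; apply/andP; split.
- by apply: le_trans r1; rewrite lerN2.
- exact: le_trans r2 hz.
- by apply: le_trans i1; rewrite lerN2.
- exact: le_trans i2 hz.
Qed.

Lemma nrm_prod (I : finType) (F : I -> C) : nrm (\prod_i F i) = \prod_i nrm (F i).
Proof. by apply: big_morph; [exact: nrmM|exact: nrm1]. Qed.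

Lemma nrm_sum (I : finType) (F : I -> C) : nrm (\sum_i F i) <= \sum_i nrm (F i).
Proof.
elim/big_rec2: _ => [|i x z _ h]; first by rewrite nrm0.
by apply: le_trans (nrmD _ _) _; rewrite lerD2l.
Qed.

Lemma poly_bound (p : {poly C}) : exists2 c : R, 0 <= c &
  forall z, 1 <= nrm z -> nrm p.[z] <= c * nrm z ^+ (size p).-1.
Proof.
exists (\sum_(i < size p) nrm p`_i); first by apply: sumr_ge0 => i _; exact: nrm_ge0.
move=> z z1; rewrite horner_coef; apply: le_trans (nrm_sum _) _.
rewrite mulr_suml; apply: ler_sum => i _; rewrite nrmM nrmX ler_wpM2l ?nrm_ge0 //.
by rewrite ler_weXn2l // -ltnS prednK ?ltn_ord // (leq_trans _ (ltn_ord i)).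
Qed.

Variables (J : finType) (a : J -> C).
Hypothesis a_neq0 : forall j, a j != 0.

Lemma rootw_large : exists R0 c0 : R, [/\ 1 <= R0, 0 < c0 &
  forall t, R0 <= nrm t -> 1 <= nrm (rootw a xpredT t) /\
     c0 * nrm t ^+ #|J| <= nrm (rootw a xpredT t) ^+ 2].
Proof.
pose S := \sum_k 2 / nrm (a k).
have na k : 0 < nrm (a k) by rewrite nrm_gt0.
have Sk k : 2 / nrm (a k) <= S.
  rewrite /S (bigD1 k) //= lerDl; apply: sumr_ge0 => i _; exact: divr_ge0 (ltW _).
have S0 : 0 <= S by apply: sumr_ge0 => i _; apply: divr_ge0; rewrite // ltW.
exists (1 + S), (\prod_k (nrm (a k) / 2)); split.
- by rewrite lerDl.
- by apply: prodr_gt0 => k _; rewrite divr_gt0.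
move=> t ht.
have b1 k : 2 <= nrm (a k) * nrm t.
  rewrite mulrC -ler_pdivrMr //; apply: le_trans (Sk k) (le_trans _ ht).
  by rewrite lerDr.
have b2 k : nrm (a k) * nrm t - 1 <= nrm (1 - a k * t).
  by rewrite -nrmM nrmB -(nrm1 C) nrm_ge_sub.
have E : nrm (rootw a xpredT t) ^+ 2 = \prod_k nrm (1 - a k * t).
  by rewrite -nrmX rootw_sqr Dp_eval nrm_prod.
split.
  rewrite -(@ler_pXn2r _ 2) ?nnegrE ?nrm_ge0 // E expr1n.
  apply: (big_ind (fun x => 1 <= x)) => // [x y|k _]; first exact: mulr_ege1.
  by apply: le_trans (b2 k); have := b1 k; lra.
rewrite E -prodr_const -big_split /=; apply: ler_prod => k _; apply/andP; split.
  by rewrite mulr_ge0 ?nrm_ge0 // divr_ge0 // ltW.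
by apply: le_trans (b2 k); have := b1 k; lra.
Qed.

End Bounds.

Section Growth.
Variables (R : realType) (C : complexPlane R) (J : finType) (a : J -> C).
Hypothesis a_neq0 : forall j, a j != 0.
Hypothesis a_gen : forall j k, k != j -> ~~ (0 < a k / a j).
Local Notation dom := (dom a xpredT).
Local Notation rootw := (rootw a xpredT).

Lemma FF_segment (P : {poly C}) (t : C) (s B : R) : 0 <= s <= 1 -> dom t ->
  (forall x : R, s <= x <= 1 -> nrm (form a P xpredT (ofR x * t)) <= B) ->
  nrm (FF a P t - FF a P (ofR s * t)) <= 2 * (B * ((1 - s) * nrm t)).
Proof.
move=> /andP[s0 s1] dt hB.
have E (x : R) : ofR s * t + ofR x * (t - ofR s * t) = ofR (s + x * (1 - s)) * t.
  by rewrite rmorphD rmorphM rmorphB rmorph1 /=; ring.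
have s1' : 0 <= 1 - s by rewrite subr_ge0.
have b (x : R) : 0 <= x <= 1 -> s <= s + x * (1 - s) <= 1.
  move=> /andP[x0 x1]; rewrite lerDl mulr_ge0 //= -lerBrDl.
  by rewrite -[leRHS]mul1r ler_wpM2r.
have -> : (1 - s) * nrm t = nrm (t - ofR s * t).
  have -> : t - ofR s * t = ofR (1 - s) * t by rewrite rmorphB rmorph1; ring.
  by rewrite nrmM nrm_ofR ger0_norm.
apply: (path_le (f' := form a P xpredT)) => x /b; rewrite E => hx; last exact: hB.
have dx : dom (ofR (s + x * (1 - s)) * t).
  by apply: dom_star => //; case/andP: hx => h1 ->; rewrite (le_trans s0 h1).
by apply: nbhsS (dom_near dx) => z; exact: sd_FF.
Qed.

(* [(FF - kappa) * rootw] extends to an entire function of polynomial growth. *)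
Theorem period_exact (Q : {poly C}) (kappa : C) : (forall j, II a Q j = kappa) ->
  exists B : {poly C}, forall t, dom t -> FF a Q t - kappa = B.[t] * rootw t.
Proof.
move=> hI; pose psi (z : C) := z.
have hsd z : sd id psi z ((fun=> 1) z) := sd_io id z.
have hodd z : psi (- z) = - psi z by [].
have hper j z : psi (z + (II a Q j - kappa)) = (fun=> 1) j * psi z.
  by rewrite hI subrr addr0 mul1r.
pose f := ff a Q kappa psi (fun=> 1).
have cf z : {for z, continuous f} by exact: (cont_ff a_neq0 a_gen hsd hodd hper).
have [R0 [c0 [R01 c0p hw]]] := rootw_large a_neq0.
have R0p : 0 < R0 := lt_le_trans ltr01 R01.
have [M hM] := disc_bounded R0 cf.
have [cQ cQ0 hQ] := poly_bound Q.
have [cD cD0 hD] := poly_bound (Dp a xpredT).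
set K := (size Q).-1 in hQ; set L := (size (Dp a xpredT)).-1 in hD.
apply: (entire_extension a_neq0 a_gen hsd hodd hper (r0 := R0) (N := (K + L + 2)%N)
  (c := (`|M| + 2 * cQ) * cD)) => t dt ht; rewrite -/f.
have t1 : 1 <= nrm t := le_trans R01 ht.
have tp : 0 < nrm t := lt_le_trans ltr01 t1.
have [w1 _] := hw t ht.
pose s := R0 / nrm t.
have s01 : 0 <= s <= 1.
  by apply/andP; split; [apply: divr_ge0; exact: ltW|rewrite ler_pdivrMr // mul1r].
have ds : dom (ofR s * t) := dom_star s01 dt.
have ns : nrm (ofR s * t) = R0.
  by rewrite nrmM nrm_ofR ger0_norm ?(proj1 (andP s01)) // /s divfK // gt_eqF.
have b1 : nrm (FF a Q (ofR s * t) - kappa) <= `|M|.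
  have := hM (ofR s * t); rewrite ns lexx => /(_ isT); rewrite /f => h0.
  have h : dom (ofR s * t) ->
      nrm (FF a Q (ofR s * t) - kappa) * nrm (rootw (ofR s * t)) <= M.
    by move=> d1; rewrite -nrmM -(ff_dom Q kappa psi (fun=> 1) d1).
  have hs : R0 <= nrm (ofR s * t) by rewrite ns.
  have [w1' _] := hw _ hs.
  by apply: le_trans (le_trans (h ds) (ler_norm _)); rewrite ler_peMr ?nrm_ge0.
have b2 : nrm (FF a Q t - FF a Q (ofR s * t)) <= 2 * (cQ * nrm t ^+ K * ((1 - s) * nrm t)).
  apply: FF_segment => // x /andP[sx x1].
  have x0 : 0 <= x := le_trans (proj1 (andP s01)) sx.
  have nx : nrm (ofR x * t) = x * nrm t by rewrite nrmM nrm_ofR ger0_norm.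
  have xR : R0 <= nrm (ofR x * t) by rewrite nx -ler_pdivrMr.
  have [w1' _] := hw _ xR; rewrite nrmM nrmV.
  apply: (@le_trans _ _ (nrm Q.[ofR x * t])).
    by rewrite ler_pdivrMr ?(lt_le_trans ltr01) // ler_peMr ?nrm_ge0.
  apply: le_trans (hQ _ (le_trans R01 xR)) _; rewrite ler_wpM2l //.
  by rewrite lerXn2r ?nnegrE ?nrm_ge0 // nx ger_pMl.
have b3 : nrm (rootw t) <= cD * nrm t ^+ L.
  apply: le_trans (hD t t1); rewrite -rootw_sqr nrmX expr2 ler_peMr ?nrm_ge0 //.
rewrite /f ff_dom // nrmM /psi.
have b4 : nrm (FF a Q t - kappa) <= (`|M| + 2 * cQ) * nrm t ^+ K.+1.
  have -> : FF a Q t - kappa =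
      (FF a Q (ofR s * t) - kappa) + (FF a Q t - FF a Q (ofR s * t)) by ring.
  apply: le_trans (nrmD _ _) _; rewrite mulrDl; apply: lerD.
    by apply: le_trans b1 _; rewrite ler_peMr // exprn_ege1.
  apply: le_trans b2 _; rewrite -[2 * cQ * _]mulrA ler_pM2l // exprSr [leRHS]mulrA.
  rewrite ler_wpM2l ?mulr_ge0 ?exprn_ge0 ?nrm_ge0 // ger_pMl //.
  by rewrite gerBl (proj1 (andP s01)).
have -> : (K + L + 2 = K.+1 + L + 1)%N by rewrite addSn addn1 addn2.
rewrite !exprD expr1 mulrA ler_pM2r //.
apply: le_trans (ler_pM (nrm_ge0 _) (nrm_ge0 _) b4 b3) _.
by rewrite le_eqVlt; apply/orP; left; apply/eqP; ring.
Qed.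

End Growth.

(** * The Pell equation from rational periods *)

Section PellFromPeriods.
Variables (R : realType) (C : complexPlane R) (J : finType) (a : J -> C).
Hypothesis a_neq0 : forall j, a j != 0.
Hypothesis a_gen : forall j k, k != j -> ~~ (0 < a k / a j).
Local Notation dom := (dom a xpredT).
Local Notation rootw := (rootw a xpredT).
Local Notation D := (Dp a xpredT).

Definition csinh (n : nat) (z : C) : C := (cexp (n%:R * z) - cexp (- (n%:R * z))) / 2.
Definition ccosh (n : nat) (z : C) : C := (cexp (n%:R * z) + cexp (- (n%:R * z))) / 2.

Lemma two_neq0 : (2 : C) != 0. Proof. by rewrite pnatr_eq0. Qed.

Lemma sd_cexpZ (c z : C) : sd id (fun z => cexp (c * z)) z (cexp (c * z) * c).
Proof.
have h := sdZ (@cont_id R C) c (sd_io id z).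
apply: (sd_unit (sd_comp (g := fun z => c * z) (@cont_id R C) (sd_cexp _) h)).
by rewrite mulr1.
Qed.

Lemma sd_cexpNZ (c z : C) : sd id (fun z => cexp (- (c * z))) z (- (cexp (- (c * z)) * c)).
Proof.
apply: sd_near (sd_unit (sd_cexpZ (- c) z) _); last by rewrite mulNr mulrN.
by apply: nbhsE_all => y; rewrite mulNr.
Qed.

Lemma sd_csinh n z : sd id (csinh n) z (n%:R * ccosh n z).
Proof.
have h := sdB (@cont_id R C) (sd_cexpZ n%:R z) (sd_cexpNZ n%:R z).
apply: (sd_unit (sdM (@cont_id R C) h (sd_cst id 2^-1 z))).
by rewrite /ccosh; ring.
Qed.

Lemma sd_ccosh n z : sd id (ccosh n) z (n%:R * csinh n z).
Proof.
have h := sdD (sd_cexpZ n%:R z) (sd_cexpNZ n%:R z).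
apply: (sd_unit (sdM (@cont_id R C) h (sd_cst id 2^-1 z))).
by rewrite /csinh; ring.
Qed.

Lemma ccosh_csinh n z : ccosh n z ^+ 2 - csinh n z ^+ 2 = 1.
Proof.
rewrite /ccosh /csinh cexpN; have := cexp_neq0 (n%:R * z); set e := cexp _ => e0.
have := two_neq0 => h2.
by field; rewrite e0.
Qed.

Lemma csinh_odd n z : csinh n (- z) = - csinh n z.
Proof. by rewrite /csinh mulrN opprK; ring. Qed.

Lemma csinh_period n (z w : C) (k : int) : n%:R * w = 'i * ofR (pi * k%:~R) ->
  csinh n (z + w) = cexp (n%:R * w) * csinh n z.
Proof.
move=> h; rewrite /csinh mulrDr opprD !cexpD.
suff -> : cexp (- (n%:R * w)) = cexp (n%:R * w) by ring.
by rewrite cexpN h cexp_ipi invr_expz -exprz_inv invrN1.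
Qed.

Definition growth_of n (z : C) : R := expR `|re (n%:R * z)|.

Lemma nrm2V : nrm (2^-1 : C) = 2^-1.
Proof. by rewrite nrmV -(rmorph_nat (@ofR R C) 2) nrm_ofR ger0_norm. Qed.

Lemma csinh_le n z : nrm (csinh n z) <= growth_of n z.
Proof.
rewrite /csinh nrmM nrm2V ler_pdivrMr //; apply: le_trans (nrmD _ _) _.
rewrite nrmN !nrm_cexp reN mulr_natr mulr2n; apply: lerD; rewrite ler_expR ?ler_norm //.
by rewrite -normrN ler_norm.
Qed.

Lemma csinh_ge n z : growth_of n z <= 2 * nrm (csinh n z) + 1.
Proof.
rewrite /csinh nrmM nrm2V mulrC divfK ?pnatr_eq0 // /growth_of.
set x := re _; have H (u v : C) : nrm u = expR `|x| -> nrm v <= 1 ->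
    expR `|x| <= nrm (u - v) + 1.
  move=> hu hv; rewrite -hu -{1}(subrK v u); apply: le_trans (nrmD _ _) _.
  by rewrite lerD2l.
case: (leP 0 x) => hx.
  by apply: H; rewrite nrm_cexp -/x ?reN ?ger0_norm // -/x -expR0 ler_expR oppr_le0.
rewrite nrmB; apply: H; rewrite nrm_cexp ?reN -/x; first by rewrite ltr0_norm.
by rewrite -expR0 ler_expR ltW.
Qed.

Lemma poly_eq0_near (p : {poly C}) (z : C) : (\forall t \near z, p.[t] = 0) -> p = 0.
Proof.
move=> h; apply/eqP/negPn/negP => p0.
have [rs hrs] := closed_field_poly_normal p.
have lc : lead_coef p != 0 by rewrite lead_coef_eq0.
have zE : z \notin [seq b <- rs | b != z] by rewrite mem_filter eqxx.
have [t [ht tE] tz] := no_isolatedC (nbhsS2 (fun _ h1 h2 => conj h1 h2) h (near_notin zE)).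
have : root p t by rewrite /root ht.
rewrite hrs rootZ // root_prod_XsubC => trs.
by move: tE; rewrite mem_filter tz trs.
Qed.

Lemma dom0 : dom 0.
Proof. by move=> k _; rewrite mulr0 subr0 lt_geF ?ltr01. Qed.

Lemma poly_eq0_dom (p : {poly C}) : (forall t, dom t -> p.[t] = 0) -> p = 0.
Proof. by move=> h; apply: (@poly_eq0_near p 0); apply: nbhsS (dom_near dom0) => t; exact: h. Qed.

Variables (d : nat) (P : {poly C}) (n : nat) (kappa : C).
Hypothesis cardJ : #|J| = (2 * d)%N.
Hypothesis sizeP : (size P <= d)%N.
Hypothesis P_neq0 : P != 0.
Hypothesis n_gt0 : (0 < n)%N.
Hypothesis periods : forall j, exists k : int,
  n%:R * (II a P j - kappa) = 'i * ofR (pi * k%:~R).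

Let X t := FF a P t - kappa.

Lemma form_bound : exists R0 K : R, [/\ 1 <= R0, 0 <= K,
  forall t, R0 <= nrm t -> 1 <= nrm (rootw t) &
  forall t, R0 <= nrm t -> nrm (form a P xpredT t) * nrm t <= K].
Proof.
have [R0 [c0 [R01 c0p hw]]] := rootw_large a_neq0.
have [cP cP0 hP] := poly_bound P.
pose k := cP ^+ 2 / c0; have k0 : 0 <= k by rewrite divr_ge0 ?sqr_ge0 // ltW.
exists R0, (k + 1); split => //; first by rewrite addr_ge0.
  by move=> t /hw [].
move=> t ht; have [w1 w2] := hw t ht.
have t1 : 1 <= nrm t := le_trans R01 ht.
have wp : 0 < nrm (rootw t) := lt_le_trans ltr01 w1.
have hPd : nrm P.[t] * nrm t <= cP * nrm t ^+ d.
  have sP : (0 < size P)%N by rewrite size_poly_gt0.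
  have d0 : (0 < d)%N by apply: leq_trans sizeP.
  rewrite -(prednK d0) exprSr mulrA ler_wpM2r ?nrm_ge0 //.
  apply: le_trans (hP t t1) _; rewrite ler_wpM2l // ler_weXn2l //.
  by rewrite -ltnS prednK // prednK.
have h2 : (nrm P.[t] * nrm t) ^+ 2 <= k * nrm (rootw t) ^+ 2.
  apply: (@le_trans _ _ ((cP * nrm t ^+ d) ^+ 2)).
    by rewrite ler_pXn2r // nnegrE mulr_ge0 ?nrm_ge0 // exprn_ge0 ?nrm_ge0.
  rewrite exprMn -exprM mulnC -cardJ /k [leRHS]mulrAC ler_pdivlMr // -mulrA.
  by rewrite ler_wpM2l ?sqr_ge0 // mulrC.
rewrite /form nrmM nrmV mulrAC ler_pdivrMr //.
rewrite -(@ler_pXn2r _ 2) ?nnegrE ?mulr_ge0 ?nrm_ge0 ?addr_ge0 //.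
apply: le_trans h2 _; rewrite exprMn ler_wpM2r ?sqr_ge0 //.
by nra.
Qed.

Lemma sinh_polynomial : exists B : {poly C},
  forall t, dom t -> csinh n (X t) = B.[t] * rootw t.
Proof.
pose eps j := cexp (n%:R * (II a P j - kappa)).
have hper j z : csinh n (z + (II a P j - kappa)) = eps j * csinh n z.
  by have [k hk] := periods j; exact: csinh_period hk.
pose f := ff a P kappa (csinh n) eps.
have cf z : {for z, continuous f}.
  exact: (cont_ff a_neq0 a_gen (@sd_csinh n) (@csinh_odd n) hper).
have [R0 [K [R01 K0 hw hK]]] := form_bound.
have R0p : 0 < R0 := lt_le_trans ltr01 R01.
have [M hM] := disc_bounded (2 * R0) cf.
have [cD cD0 hD] := poly_bound D.
set KD := (size D).-1 in hD.
pose Y t := growth_of n (X t).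
have Y_double t : dom t -> 2 * R0 <= nrm t ->
    Y t <= Y (ofR (1 / 2) * t) * expR (n%:R * (2 * K)).
  move=> dt ht; rewrite -expRD ler_expR.
  have tp : 0 < nrm t by apply: lt_le_trans ht; rewrite mulr_gt0.
  pose h2 : R := 1 / 2.
  have h01 : 0 <= h2 <= 1 by rewrite /h2; apply/andP; split; lra.
  have h1 : nrm (X t - X (ofR h2 * t)) <= 2 * K.
    have -> : X t - X (ofR h2 * t) = FF a P t - FF a P (ofR h2 * t).
      by rewrite /X; ring.
    have -> : 2 * K = 2 * (2 * K / nrm t * ((1 - h2) * nrm t)).
      by rewrite /h2; field; rewrite gt_eqF.
    apply: FF_segment => // x /andP[x12 x1].
    have x0 : 0 < x by rewrite /h2 in x12; lra.
    have nx : nrm (ofR x * t) = x * nrm t by rewrite nrmM nrm_ofR gtr0_norm.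
    have hx : R0 <= nrm (ofR x * t) by rewrite nx; rewrite /h2 in x12; nra.
    have := hK _ hx; rewrite nx -ler_pdivlMr ?mulr_gt0 // => h.
    apply: le_trans h _; rewrite invfM mulrA ler_wpM2r ?invr_ge0 ?nrm_ge0 //.
    rewrite mulrC ler_wpM2r // -[leRHS]invrK lef_pV2 ?posrE ?invr_gt0 //; rewrite /h2 in x12; lra.
  have -> : re (n%:R * X t) = re (n%:R * X (ofR h2 * t)) +
      re (n%:R * (X t - X (ofR h2 * t))).
    by rewrite -reD -mulrDr [X (ofR h2 * t) + _]addrC subrK.
  apply: le_trans (ler_normD _ _) _; rewrite lerD2l.
  apply: le_trans (re_le_nrm _) _; rewrite nrmM -(rmorph_nat (@ofR R C)) nrm_ofR.
  by rewrite ger0_norm ?ler_wpM2l.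
have [L hL] : exists L : nat, expR (n%:R * (2 * K)) <= 2 ^+ L.
  exists (Num.bound (expR (n%:R * (2 * K)))); rewrite -natrX.
  apply: le_trans (ltW (archi_boundP (expR_ge0 _))) _.
  by rewrite ler_nat ltnW // ltn_expl.
pose M2 := 2 * `|M| + 1; have M20 : 0 <= M2 by rewrite addr_ge0 // mulr_ge0.
have base t : dom t -> R0 <= nrm t -> nrm t <= 2 * R0 -> Y t <= M2 * nrm t ^+ L.
  move=> dt h1 h2; apply: le_trans (csinh_ge _ _) _.
  have h3 : nrm (csinh n (X t)) <= `|M|.
    have := hM t h2; rewrite /f ff_dom // nrmM => h.
    by apply: le_trans (le_trans h (ler_norm _)); rewrite ler_peMr ?nrm_ge0 ?hw.
  apply: (@le_trans _ _ M2); first by rewrite /M2; lra.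
  by rewrite ler_peMr // exprn_ege1 // (le_trans R01).
have grow k t : dom t -> R0 <= nrm t -> nrm t <= 2 ^+ k * (2 * R0) -> Y t <= M2 * nrm t ^+ L.
  elim: k t => [|k ih] t dt h1 h2; first by apply: base => //; rewrite expr0 mul1r in h2.
  case: (leP (nrm t) (2 * R0)) => h3; first exact: base.
  have ns : nrm (ofR (1 / 2) * t) = nrm t / 2.
    by rewrite nrmM nrm_ofR ger0_norm ?divr_ge0 // mulrC mulrA mulr1.
  apply: le_trans (Y_double t dt (ltW h3)) _.
  apply: (@le_trans _ _ (M2 * (nrm t / 2) ^+ L * 2 ^+ L)).
    apply: ler_pM; rewrite ?expR_ge0 // -ns; apply: ih.
    - by apply: dom_star => //; rewrite divr_ge0 //= ler_pdivrMr // mul1r ler1n.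
    - by rewrite ns ler_pdivlMr // mulrC ltW.
    - by rewrite ns ler_pdivrMr // mulrAC -exprSr.
  by rewrite -mulrA -exprMn divfK.
apply: (entire_extension a_neq0 a_gen (@sd_csinh n) (@csinh_odd n) hper (r0 := R0)
  (N := (L + KD + 1)%N) (c := M2 * cD)) => t dt ht.
have t1 : 1 <= nrm t := le_trans R01 ht.
have tp : 0 < nrm t := lt_le_trans ltr01 t1.
have b3 : nrm (rootw t) <= cD * nrm t ^+ KD.
  apply: le_trans (hD t t1); rewrite -rootw_sqr nrmX expr2 ler_peMr ?nrm_ge0 //.
  exact: hw.
rewrite ff_dom // nrmM !exprD expr1 mulrA ler_pM2r //.
have b4 : nrm (csinh n (X t)) <= M2 * nrm t ^+ L.
  apply: le_trans (csinh_le _ _) _.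
  apply: (grow (Num.bound (nrm t))) => //.
  apply: le_trans (ltW (archi_boundP (nrm_ge0 _))) _.
  apply: (@le_trans _ _ (2 ^+ Num.bound (nrm t))).
    by rewrite -natrX ler_nat ltnW // ltn_expl.
  by rewrite ler_peMr ?exprn_ge0 //; lra.
apply: le_trans (ler_pM (nrm_ge0 _) (nrm_ge0 _) b4 b3) _.
by rewrite le_eqVlt; apply/orP; left; apply/eqP; ring.
Qed.

Theorem pellian_of_periods : Pellian D.
Proof.
have [B hB] := sinh_polynomial.
have dX t : dom t -> sd id X t (form a P xpredT t).
  by move=> dt; have := sdB (@cont_id R C) (sd_FF P dt) (sd_cst id kappa t); rewrite subr0.
have n0 : (n%:R : C) != 0 by rewrite pnatr_eq0 -lt0n.
have hch t : dom t -> ccosh n (X t) ^+ 2 = (1 + B ^+ 2 * D).[t].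
  move=> dt; have := ccosh_csinh n (X t); rewrite hB // [(B.[t] * _) ^+ 2]exprMn rootw_sqr => /eqP.
  by rewrite subr_eq => /eqP ->; rewrite !(hornerD, hornerM, horner_exp, hornerC).
have B0 : B != 0.
  apply/negP => /eqP B0; case/negP: P_neq0; apply/eqP; apply: poly_eq0_dom => t dt.
  have h1 := sd_comp (g := X) (@cont_id R C) (sd_csinh n (X t)) (dX t dt).
  have h2 : sd id (fun z => csinh n (X z)) t 0.
    apply: sd_near (sd_cst id 0 t); apply: nbhsS (dom_near dt) => s ds.
    by rewrite hB // B0 horner0 mul0r.
  have c0 : ccosh n (X t) != 0.
    by rewrite -sqrf_eq0 hch // B0 expr0n mul0r addr0 hornerC oner_eq0.
  have /eqP := sd_uniq h1 h2; rewrite mulf_eq0 [_%:R * _ == 0]mulf_eq0 (negbTE n0) (negbTE c0) /=.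
  rewrite /form mulf_eq0 invr_eq0.
  by rewrite (negbTE (rootw_neq0 dt)) orbF => /eqP.
pose E := 1 + B ^+ 2 * D; pose G := (2 * n%:R) *: (B * P).
have EG : E^`() ^+ 2 = G ^+ 2 * E.
  apply/eqP; rewrite -subr_eq0; apply/eqP; apply: poly_eq0_dom => t dt.
  have h1 := sd_comp (g := X) (@cont_id R C) (sd_ccosh n (X t)) (dX t dt).
  have h2 := sdM (@cont_id R C) h1 h1.
  have h3 : sd id (fun z => E.[z]) t (E^`().[t] * 1) := sd_poly (@cont_id R C) E (sd_io id t).
  have h4 : sd id (fun z => ccosh n (X z) * ccosh n (X z)) t (E^`().[t] * 1).
    by apply: sd_near h3; apply: nbhsS (dom_near dt) => s ds; rewrite -expr2 hch.
  have := sd_uniq h4 h2; rewrite mulr1 => e.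
  rewrite hornerD hornerN horner_exp [(G ^+ 2 * E).[t]]hornerM horner_exp e.
  have -> : G.[t] = 2 * n%:R * (B.[t] * P.[t]) by rewrite hornerZ hornerM.
  have -> : E.[t] = ccosh n (X t) ^+ 2 by rewrite hch.
  rewrite hB // /form.
  have := rootw_neq0 dt; set w := rootw t => w0.
  by field.
have G0 : G != 0.
  by rewrite scaler_eq0 negb_or (mulf_neq0 two_neq0 n0) (mulf_neq0 B0 P_neq0).
have /dvdpP [A hA] : G %| E^`().
  by rewrite -(dvdp_pexp2r G E^`() (k := 2)) // EG dvdp_mulr.
exists A, B; split => //.
have : A ^+ 2 = E.
  apply: (mulfI (expf_neq0 2 G0)); rewrite -EG hA exprMn mulrC //.
by move=> ->; rewrite /E; ring.
Qed.

End PellFromPeriods.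

(** * Dependence of the periods on the polynomial and the branch points *)

(* Hadamard quotients of functions [f (p, x)] of parameters [p], with
   coordinates [co i p], uniformly in the integration variable [x]: on the set
   [G] of good triples [((p, q), x)] the quotients are jointly continuous. *)
Section ParametricQuotients.
Variables (R : realType) (C : complexPlane R) (V : topologicalType) (I : finType).
Variable co : I -> V -> C.
Hypothesis co_cont : forall i p, {for p, continuous (co i)}.
Variable G : (V * V) * R -> Prop.
Implicit Types (f : V * R -> C) (i : I).

Definition lk f := exists c : I -> (V * V) * R -> C,
  (forall p q x, f (p, x) - f (q, x) = \sum_i c i ((p, q), x) * (co i p - co i q)) /\
  forall y, G y -> [/\ forall i, {for y, continuous (c i)},
    {for y, continuous (fun y => f (y.1.1, y.2))} &
    {for y, continuous (fun y => f (y.1.2, y.2))}].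

Lemma cont_11 (y : (V * V) * R) : {for y, continuous (fun y : (V * V) * R => y.1.1)}.
Proof. exact: (@cont_ofst _ _ _ fst y (@cont_fst _ _ y.1)). Qed.
Lemma cont_12 (y : (V * V) * R) : {for y, continuous (fun y : (V * V) * R => y.1.2)}.
Proof. exact: (@cont_ofst _ _ _ snd y (@cont_snd _ _ y.1)). Qed.

Lemma lk_eq f f' : f =1 f' -> lk f -> lk f'.
Proof. by move=> /funext ->. Qed.

Lemma lk_var (h : R -> C) : (forall x, {for x, continuous h}) -> lk (fun z => h z.2).
Proof.
move=> hc; exists (fun _ _ => 0); split=> [p q x|y _].
  by rewrite subrr big1 // => i _; rewrite mul0r.
by split=> [i||]; [exact: cont_cst|exact: cont_osnd|exact: cont_osnd].
Qed.

Lemma lk_cst (c : C) : lk (fun=> c).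
Proof. by apply: (lk_var (h := fun=> c)) => x; exact: cont_cst. Qed.

Lemma lk_co i : lk (fun z => co i z.1).
Proof.
exists (fun k _ => (k == i)%:R); split=> [p q x|y _].
  rewrite (bigD1 i) //= eqxx mul1r big1 ?addr0 // => k /negbTE ->.
  by rewrite mul0r.
split=> [k||]; first exact: cont_cst.
  by apply: (cont_comp (f := fun y : (V * V) * R => y.1.1)); [exact: cont_11|exact: co_cont].
by apply: (cont_comp (f := fun y : (V * V) * R => y.1.2)); [exact: cont_12|exact: co_cont].
Qed.

Lemma lkD f g : lk f -> lk g -> lk (fun z => f z + g z).
Proof.
move=> [c [cE cC]] [e [eE eC]]; exists (fun i y => c i y + e i y); split=> [p q x|y Gy].
  under eq_bigr do rewrite mulrDl.
  by rewrite big_split /= -cE -eE; ring.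
have [c1 c2 c3] := cC y Gy; have [e1 e2 e3] := eC y Gy.
by split=> [i||]; apply: contD.
Qed.

Lemma lkM f g : lk f -> lk g -> lk (fun z => f z * g z).
Proof.
move=> [c [cE cC]] [e [eE eC]].
exists (fun i y => c i y * g (y.1.2, y.2) + f (y.1.1, y.2) * e i y); split=> [p q x|y Gy].
  transitivity ((f (p, x) - f (q, x)) * g (q, x) + f (p, x) * (g (p, x) - g (q, x))).
    by ring.
  rewrite cE eE mulr_suml mulr_sumr -big_split /=; apply: eq_bigr => i _.
  by ring.
have [c1 c2 c3] := cC y Gy; have [e1 e2 e3] := eC y Gy.
by split=> [i||]; [apply: contD; apply: contM|apply: contM|apply: contM].
Qed.

Lemma lk_comp (u u' : C -> C) f :
  (forall y, G y -> (\forall z \near f (y.1.1, y.2), sd id u z (u' z)) /\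
                    (\forall z \near f (y.1.2, y.2), sd id u z (u' z))) ->
  lk f -> lk (fun z => u (f z)).
Proof.
move=> hu [c [cE cC]].
exists (fun i y => dq id u u' (f (y.1.1, y.2), f (y.1.2, y.2)) * c i y); split=> [p q x|y Gy].
  rewrite (dqE (@inj_id _) u u' (f (p, x), f (q, x))) /= cE mulr_sumr.
  by apply: eq_bigr => i _; rewrite mulrA.
have [c1 c2 c3] := cC y Gy; have [u1 u2] := hu y Gy.
split=> [i||].
- apply: contM; last exact: c1.
  apply: (cont_comp (cont_pair c2 c3)).
  exact: (dq_cont (@cont_id R C) (@inj_id _) (@no_isolatedC R C) u1 u2).
- exact: (cont_comp c2 (sd_cont (@cont_id R C) (nbhs_singleton u1))).
- exact: (cont_comp c3 (sd_cont (@cont_id R C) (nbhs_singleton u2))).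
Qed.

Lemma lkV f : (forall y, G y -> f (y.1.1, y.2) != 0 /\ f (y.1.2, y.2) != 0) ->
  lk f -> lk (fun z => (f z)^-1).
Proof.
move=> h; apply: (lk_comp (u := GRing.inv) (u' := fun z => - 1 / z ^+ 2)) => y /h [h1 h2].
have H (z : C) : z != 0 -> \forall w \near z, sd id GRing.inv w (- 1 / w ^+ 2).
  move=> z0; apply: nbhsS (near_neq0 (@cont_id R C z) z0) => w w0.
  exact: (sdV (@cont_id R C) w0 (sd_io id w)).
by split; exact: H.
Qed.

Lemma lk_csqrt f : (forall y, G y -> ~~ (f (y.1.1, y.2) <= 0) /\ ~~ (f (y.1.2, y.2) <= 0)) ->
  lk f -> lk (fun z => csqrt (f z)).
Proof.
move=> h; apply: (lk_comp (u := csqrt) (u' := fun z => (2 * csqrt z)^-1)) => y /h [h1 h2].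
have H (z : C) : ~~ (z <= 0) -> \forall w \near z, sd id csqrt w (2 * csqrt w)^-1.
  move=> z0; apply: nbhsS (near_npos (@cont_id R C z) z0) => w w0.
  exact: sd_csqrt.
by split; exact: H.
Qed.

Lemma lk_sum (K : finType) (A : pred K) (f : K -> V * R -> C) :
  (forall k, A k -> lk (f k)) -> lk (fun z => \sum_(k | A k) f k z).
Proof.
move=> h; suff : forall s : seq K, lk (fun z => \sum_(k <- s | A k) f k z).
  by move=> /(_ (index_enum K)).
elim=> [|k s ih].
  by apply: lk_eq (lk_cst 0) => z; rewrite big_nil.
case: (boolP (A k)) => Ak.
  by apply: lk_eq (lkD (h k Ak) ih) => z; rewrite big_cons Ak.
by apply: lk_eq ih => z; rewrite big_cons (negbTE Ak).
Qed.

Lemma lk_prod (K : finType) (A : pred K) (f : K -> V * R -> C) :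
  (forall k, A k -> lk (f k)) -> lk (fun z => \prod_(k | A k) f k z).
Proof.
move=> h; suff : forall s : seq K, lk (fun z => \prod_(k <- s | A k) f k z).
  by move=> /(_ (index_enum K)).
elim=> [|k s ih].
  by apply: lk_eq (lk_cst 1) => z; rewrite big_nil.
case: (boolP (A k)) => Ak.
  by apply: lk_eq (lkM (h k Ak) ih) => z; rewrite big_cons Ak.
by apply: lk_eq ih => z; rewrite big_cons (negbTE Ak).
Qed.

Lemma lkX f n : lk f -> lk (fun z => f z ^+ n).
Proof.
move=> h; elim: n => [|n ih]; first by apply: lk_eq (lk_cst 1) => z; rewrite expr0.
by apply: lk_eq (lkM h ih) => z; rewrite exprS.
Qed.

(* The line [ln i] through [p0] in the direction of the coordinate [i]
   identifies the diagonal value of the [i]-th quotient as a partial derivative. *)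
Lemma lk_int (p0 : V) f (ln : I -> C -> V) (D : I -> R -> C) :
  (forall x : R, 0 <= x <= 1 -> \forall y \near ((p0, p0), x), G y) ->
  lk f ->
  (forall i, {for 0, continuous (ln i)}) -> (forall i, ln i 0 = p0) ->
  (forall i k s r, co k (ln i s) - co k (ln i r) = (k == i)%:R * (s - r)) ->
  (forall i (x : R), 0 <= x <= 1 -> sd id (fun s => f (ln i s, x)) 0 (D i x)) ->
  exists M : I -> V * V -> C,
  [/\ forall i, {for (p0, p0), continuous (M i)},
      forall i, M i (p0, p0) = cint (D i) &
      \forall z \near (p0, p0), cint (fun x => f (z.1, x)) - cint (fun x => f (z.2, x)) =
        \sum_i M i z * (co i z.1 - co i z.2)].
Proof.
move=> hG [c [cE cC]] lnc ln0 lnco dD.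
have GG (x : R) : 0 <= x <= 1 -> G ((p0, p0), x) by move=> /hG /nbhs_singleton.
have nc i (x : R) : 0 <= x <= 1 -> \forall y \near ((p0, p0), x), {for y, continuous (c i)}.
  by move=> /hG; apply: nbhsS => y Gy; have [+ _ _] := cC y Gy; apply.
have GN : \forall z \near (p0, p0), forall x : R, 0 <= x <= 1 -> G (z, x).
  apply: (@near01 R _ (fun z x => G (z, x))) => x /hG.
  by apply: nbhsS => -[].
exists (fun i z => cint (fun x => c i (z, x))); split=> [i|i|].
- by have [_ _] := cint_cont (nc i); exact.
- apply: eq_cint => x hx; apply: (@sd_uniq R C (fun s => f (ln i s, x)) 0); last exact: dD.
  have [c1 _ _] := cC _ (GG x hx).
  exists (fun z => c i ((ln i z.1, ln i z.2), x)); split.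
  + by rewrite /= ln0.
  + apply: (cont_comp (f := fun z : C * C => ((ln i z.1, ln i z.2), x))); last first.
      by rewrite /= ln0; exact: c1.
    apply: cont_pair; last exact: cont_const.
    by apply: cont_pair; [exact: cont_ofst|exact: cont_osnd].
  apply: nbhsE_all => -[s r] /=; rewrite cE (bigD1 i) //= lnco eqxx mul1r.
  rewrite big1 ?addr0 // => k ki; by rewrite lnco (negbTE ki) mul0r mulr0.
- apply: nbhsS GN => -[p q] hz /=.
  have cslice x : {for x, continuous (fun x' : R => ((p, q), x'))}.
    by apply: cont_pair; [exact: cont_const|exact: cont_refl].
  have cp : cont01 (fun x => f (p, x)).
    move=> x hx; have [_ + _] := cC _ (hz x hx).
    exact: (cont_comp (cslice x)).
  have cq : cont01 (fun x => f (q, x)).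
    move=> x hx; have [_ _ +] := cC _ (hz x hx).
    exact: (cont_comp (cslice x)).
  have cNq : cont01 (fun x => -1 * f (q, x)).
    by move=> x hx; apply: contM; [exact: cont_cst|exact: cq].
  have cc i : cont01 (fun x => c i ((p, q), x)).
    move=> x hx; have [+ _ _] := cC _ (hz x hx) => /(_ i).
    exact: (cont_comp (cslice x)).
  have -> : cint (fun x => f (p, x)) - cint (fun x => f (q, x)) =
      cint (fun x => f (p, x) + -1 * f (q, x)).
    by rewrite (cintD cp cNq) (cintZ _ cq) mulN1r.
  transitivity (cint (fun x => \sum_i (co i p - co i q) * c i ((p, q), x))).
    apply: eq_cint => x hx; rewrite mulN1r cE; apply: eq_bigr => i _; exact: mulrC.
  have H (s : seq I) : cont01 (fun x => \sum_(i <- s) (co i p - co i q) * c i ((p, q), x)) /\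
      cint (fun x => \sum_(i <- s) (co i p - co i q) * c i ((p, q), x)) =
      \sum_(i <- s) cint (fun x => c i ((p, q), x)) * (co i p - co i q).
    elim: s => [|i s [ih1 ih2]].
      have E : (fun x => \sum_(i <- [::]) (co i p - co i q) * c i ((p, q), x)) = (fun=> 0).
        by apply/funext => x; rewrite big_nil.
      rewrite E big_nil cint_cst; split => // x _; exact: cont_cst.
    have E : (fun x => \sum_(i <- i :: s) (co i p - co i q) * c i ((p, q), x)) =
       (fun x => (co i p - co i q) * c i ((p, q), x) +
          \sum_(i <- s) (co i p - co i q) * c i ((p, q), x)).
      by apply/funext => x; rewrite big_cons.
    have ci : cont01 (fun x => (co i p - co i q) * c i ((p, q), x)).
      by move=> x hx; apply: contM; [exact: cont_cst|exact: cc].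
    rewrite E big_cons; split; first by move=> x hx; apply: contD; [exact: ci|exact: ih1].
    by rewrite (cintD ci ih1) (cintZ _ (cc i)) ih2 mulrC.
  exact: (H _).2.
Qed.

End ParametricQuotients.

Local Notation evalE := (hornerD, hornerN, hornerZ, hornerM, hornerX, hornerC).

Section PeriodDerivatives.
Variables (R : realType) (C : complexPlane R) (J : finType) (a : J -> C).
Hypothesis a_neq0 : forall j, a j != 0.
Hypothesis a_gen : forall j k, k != j -> ~~ (0 < a k / a j).
Implicit Types (P Q : {poly C}) (j k : J).

Lemma ofR01_sq (x : R) : 0 <= x <= 1 -> (ofR x : C) ^+ 2 <= 1.
Proof.
move=> /andP[x0 x1]; rewrite -rmorphXn -(rmorph1 (@ofR R C)) ofR_le.
by rewrite expr_le1.
Qed.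

Lemma dom_tau01 j (x : R) : 0 <= x <= 1 -> dom a (predC1 j) (tau a j (ofR x)).
Proof. by move=> hx; apply: VV_dom; apply: VV_real => //; exact: ofR01_sq. Qed.

Definition tauR j (x : R) : C := tau a j (ofR x).

Lemma sd_tauR j (x : R) : sd ofR (tauR j) x (- 2 * ofR x / a j).
Proof.
have := sd_comp (g := ofR) (@cont_ofR R C) (sd_tau a j (ofR x)) (sd_io ofR x).
by rewrite mulr1.
Qed.

Lemma near_dom_tauR j (x : R) : 0 <= x <= 1 ->
  \forall y \near x, dom a (predC1 j) (tauR j y).
Proof.
move=> hx; have c : {for x, continuous (tauR j)} := sd_cont (@cont_ofR R C) (sd_tauR j x).
have hd : dom a (predC1 j) (tauR j x) := @dom_tau01 j x hx.
exact: (c (dom a (predC1 j)) (dom_near hd)).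
Qed.

Lemma cont_form_tau Q j : cont01 (fun x => form a Q (predC1 j) (tauR j x)).
Proof.
move=> x hx; apply: (cont_comp (sd_cont (@cont_ofR R C) (sd_tauR j x))).
exact: (sd_cont (@cont_id R C) (sd_form Q (@dom_tau01 j x hx))).
Qed.

Lemma cont01Z (c : C) (h : R -> C) : cont01 h -> cont01 (fun x => c * h x).
Proof. by move=> hc x hx; apply: contM; [exact: cont_cst|exact: hc]. Qed.

Lemma IIE Q j : II a Q j = 2 / a j * cint (fun x => form a Q (predC1 j) (tauR j x)).
Proof.
rewrite /II /OO /prim -(cintZ _ (@cont_form_tau Q j)) -mulN1r.
have V1 : VV a j 1 by apply: VV_real => //; rewrite expr1n.
rewrite -(cintZ _ (@cont_gg_ray R C J a Q j 1 V1)).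
by apply: eq_cint => x _; rewrite /gg mulr1 /tauR; ring.
Qed.

Lemma IID P Q j : II a (P + Q) j = II a P j + II a Q j.
Proof.
rewrite !IIE -mulrDr -(cintD (@cont_form_tau P j) (@cont_form_tau Q j)); congr (_ * _).
by apply: eq_cint => x _; rewrite /form hornerD mulrDl.
Qed.

Lemma IIZ (c : C) P j : II a (c *: P) j = c * II a P j.
Proof.
rewrite !IIE mulrCA; congr (_ * _); rewrite -(cintZ c (@cont_form_tau P j)).
by apply: eq_cint => x _; rewrite /form hornerZ mulrA.
Qed.

Variable P : {poly C}.

Lemma Dp_root_neq0 k : (Dp a (predC1 k)).[(a k)^-1] != 0.
Proof.
rewrite Dp_eval; apply/prodf_neq0 => l /= lk; rewrite subr_eq0 eq_sym.
apply/eqP => e; have := a_gen lk; rewrite e; by rewrite ltr01.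
Qed.

(* Differentiating [P / w] in [a k] creates a double pole at [1 / a k]; it is
   removed by an exact form, leaving [Qk k / w] and the constant [ck k]. *)
Definition ck k : C := (a k)^-1 ^+ 2 * P.[(a k)^-1] / (Dp a (predC1 k)).[(a k)^-1].
Definition Mk k : {poly C} :=
  (ck k *: Dp a (predC1 k) - (a k)^-1 *: ('X * P)) %/ (1 - a k *: 'X).
Definition Qk k : {poly C} := - 2^-1 *: (a k *: Mk k + ck k *: (Dp a (predC1 k))^`()).

Lemma MkE k : ck k *: Dp a (predC1 k) - (a k)^-1 *: ('X * P) = (1 - a k *: 'X) * Mk k.
Proof.
rewrite [RHS]mulrC divpK //.
have -> : 1 - a k *: 'X = (- a k) *: ('X - (a k)^-1%:P).
  rewrite scalerBr -!mul_polyC -rmorphM mulNr divff ?a_neq0 // !rmorphN mulNr.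
  by rewrite rmorph1 opprK addrC.
rewrite dvdpZl ?oppr_eq0 // dvdp_XsubCl /root !(hornerD, hornerN, hornerZ, hornerM, hornerX) /ck.
by rewrite divfK ?Dp_root_neq0 // expr2 mulrA subrr.
Qed.

Lemma DpD1 (A : pred J) k : A k ->
  Dp a A = (1 - a k *: 'X) * Dp a (fun l => A l && (l != k)).
Proof. exact: bigD1. Qed.

Definition dZ (Q : {poly C}) j (x : R) : C := form a Q (predC1 j) (tauR j x) +
  ofR x * (dform a Q (predC1 j) (tauR j x) * (- 2 * ofR x / a j)).

Lemma sd_xform Q j (x : R) : dom a (predC1 j) (tauR j x) ->
  sd ofR (fun x => ofR x * form a Q (predC1 j) (tauR j x)) x (dZ Q j x).
Proof.
move=> hd.
have h1 := sd_comp (g := tauR j) (@cont_ofR R C) (sd_form Q hd) (sd_tauR j x).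
by apply: (sd_unit (sdM (@cont_ofR R C) (sd_io ofR x) h1)); rewrite mul1r.
Qed.

Lemma cont_dZ Q j : cont01 (dZ Q j).
Proof.
move=> x hx.
apply: (@sd_der_cont R C R ofR (@cont_ofR R C) (@ofR_inj R C) (@no_isolatedR R)
  (fun x => ofR x * form a Q (predC1 j) (tauR j x))).
by apply: nbhsS (@near_dom_tauR j x hx) => y; exact: sd_xform.
Qed.

Lemma cint_dZ Q j : cint (dZ Q j) = Q.[0].
Proof.
rewrite (@cint_FTC R C (fun x => ofR x * form a Q (predC1 j) (tauR j x))).
- rewrite rmorph0 mul0r subr0 rmorph1 mul1r /tauR /tau rmorph1 expr1n subrr mul0r.
  by rewrite /form rootw0 divr1.
- by move=> x hx; apply: sd_xform; exact: dom_tau01.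
- exact: cont_dZ.
Qed.

Lemma Dp0 (A : pred J) : (Dp a A).[0] = 1.
Proof. by rewrite Dp_eval big1 // => k _; rewrite mulr0 subr0. Qed.

Lemma Mk0 k : (Mk k).[0] = ck k.
Proof.
have := congr1 (fun p => p.[0]) (MkE k); rewrite /= !evalE Dp0.
by rewrite mul0r !mulr0 !subr0 mulr1 mul1r => ->.
Qed.

(* Partial derivatives of the integrand of [II a P j], in [a k] for [k <> j] and in [a j]. *)
Definition Dne k j (x : R) : C := 2 / a j * (form a P (predC1 j) (tauR j x) *
  (tauR j x / (2 * (1 - a k * tauR j x)))).
Definition Deq j (x : R) : C := - 2 * (a j)^-1 ^+ 2 *
  (form a P (predC1 j) (tauR j x) + tauR j x * dform a P (predC1 j) (tauR j x)).

Lemma Dne_eq k j (x : R) : k != j -> 0 <= x <= 1 ->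
  Dne k j x = 2 / a j * form a (Qk k) (predC1 j) (tauR j x) +
    -1 * (ck k * dZ (Dp a (fun l => (l != k) && (l != j))) j x).
Proof.
move=> kj hx; have hd := @dom_tau01 j x hx; rewrite -/(tauR j x) in hd.
set E := Dp a (fun l => (l != k) && (l != j)); set t := tauR j x.
have w0 := rootw_neq0 hd.
have uE : 1 - a j * t = ofR x ^+ 2 by exact: tauK.
have kt0 : 1 - a k * t != 0.
  by have := hd k kj; apply: contraNneq => ->.
have hDk : Dp a (predC1 k) = (1 - a j *: 'X) * E.
  by apply: (DpD1 (A := predC1 k)); rewrite /= eq_sym.
have hDj : Dp a (predC1 j) = (1 - a k *: 'X) * E.
  rewrite (DpD1 (A := predC1 j) (k := k)) //; congr (_ * _); apply: eq_bigl => l /=.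
  exact: andbC.
have wE := rootw_sqr a (predC1 j) t; rewrite hDj in wE.
have EM : (Mk k).[t] = (ck k * (Dp a (predC1 k)).[t] - (a k)^-1 * (t * P.[t])) / (1 - a k * t).
  have := congr1 (fun p => p.[t]) (MkE k); rewrite /= !evalE => ->.
  by rewrite mulrC mulKf.
rewrite /Dne /dZ /form /dform -/t /Qk !evalE EM.
have -> : (Dp a (predC1 k)).[t] = ofR x ^+ 2 * E.[t] by rewrite hDk !evalE uE.
have -> : (Dp a (predC1 k))^`().[t] = - a j * E.[t] + ofR x ^+ 2 * E^`().[t].
  by rewrite hDk derivM !evalE derivB derivC derivZ derivX !evalE uE; ring.
have -> : (Dp a (predC1 j))^`().[t] = - a k * E.[t] + (1 - a k * t) * E^`().[t].
  by rewrite hDj derivM !evalE derivB derivC derivZ derivX !evalE; ring.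
have w3 : rootw a (predC1 j) t ^+ 3 = rootw a (predC1 j) t * ((1 - a k * t) * E.[t]).
  by rewrite exprS wE !evalE.
have E0 : E.[t] != 0.
  apply: contra_neq w0 => e; apply/eqP; rewrite -sqrf_eq0 wE !evalE e mulr0 //.
rewrite w3; move: w0; set w := rootw _ _ _ => w0.
have ak := a_neq0 k; have aj := a_neq0 j.
by field; rewrite w0 ak aj kt0 E0.
Qed.

Lemma Deq_eq j (x : R) : 0 <= x <= 1 ->
  Deq j x = 2 / a j * form a (Qk j) (predC1 j) (tauR j x) + -1 * dZ (Mk j) j x.
Proof.
move=> hx; have hd := @dom_tau01 j x hx; rewrite -/(tauR j x) in hd.
set t := tauR j x.
have w0 := rootw_neq0 hd.
have uE : 1 - a j * t = ofR x ^+ 2 by exact: tauK.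
have wE := rootw_sqr a (predC1 j) t.
set D := Dp a (predC1 j) in wE *.
have D0 : D.[t] != 0 by rewrite -wE sqrf_eq0.
have e1 : ofR x ^+ 2 * (Mk j).[t] = ck j * D.[t] - (a j)^-1 * (t * P.[t]).
  by have := congr1 (fun p => p.[t]) (MkE j); rewrite /= !evalE uE.
have e2 : ofR x ^+ 2 * (Mk j)^`().[t] =
    ck j * D^`().[t] - (a j)^-1 * (P.[t] + t * P^`().[t]) + a j * (Mk j).[t].
  have := congr1 (fun p => p^`().[t]) (MkE j).
  rewrite /= derivB !derivZ !derivM derivX derivB derivC derivZ derivX !evalE -/D uE => e.
  by rewrite mul1r in e; rewrite e; ring.
have w3 : rootw a (predC1 j) t ^+ 3 = rootw a (predC1 j) t * D.[t] by rewrite exprS wE.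
rewrite /Deq /dZ /form /dform -/t /Qk !evalE w3 -/D.
move: w0; set w := rootw _ _ _ => w0.
have aj := a_neq0 j.
have -> : ofR x * (((Mk j)^`().[t] / w - (Mk j).[t] * D^`().[t] / (2 * (w * D.[t]))) *
    (- 2 * ofR x / a j))
  = (- 2 / a j) * ((ofR x ^+ 2 * (Mk j)^`().[t]) / w -
      (ofR x ^+ 2 * (Mk j).[t]) * D^`().[t] / (2 * (w * D.[t]))).
  by field; rewrite w0 aj D0.
rewrite e1 e2.
by field; rewrite w0 aj D0.
Qed.

Lemma cint_Dne k j : k != j -> cint (Dne k j) = II a (Qk k) j - ck k.
Proof.
move=> kj; set E := Dp a (fun l => (l != k) && (l != j)).
have c1 := @cont01Z (2 / a j) _ (@cont_form_tau (Qk k) j).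
have c2 := @cont01Z (ck k) _ (@cont_dZ E j).
rewrite IIE (eq_cint (fun x => Dne_eq kj)) (cintD c1 (@cont01Z (-1) _ c2)).
rewrite (cintZ _ (@cont_form_tau (Qk k) j)) (cintZ _ c2) (cintZ _ (@cont_dZ E j)).
by rewrite cint_dZ Dp0 mulr1 mulN1r.
Qed.

Lemma cint_Deq j : cint (Deq j) = II a (Qk j) j - ck j.
Proof.
have c1 := @cont01Z (2 / a j) _ (@cont_form_tau (Qk j) j).
rewrite IIE (eq_cint (@Deq_eq j)) (cintD c1 (@cont01Z (-1) _ (@cont_dZ (Mk j) j))).
rewrite (cintZ _ (@cont_form_tau (Qk j) j)) (cintZ _ (@cont_dZ (Mk j) j)).
by rewrite cint_dZ Mk0 mulN1r.
Qed.

End PeriodDerivatives.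

Section PeriodMap.
Variables (R : realType) (C : complexPlane R) (J : finType) (g : nat).
Variables (a0 : J -> C) (P0 : {poly C}) (iota : 'I_g -> J).
Hypothesis a_neq0 : forall j, a0 j != 0.
Hypothesis a_gen : forall j k, k != j -> ~~ (0 < a0 k / a0 j).
Local Notation V := 'rV[C]_(g.+1 + g).
Local Notation I := 'I_(g.+1 + g).

(* The first [g.+1] coordinates of [y] move the coefficients of [P0], the last [g]
   move the parameters [a0 (iota r)]. *)
Definition aa (y : V) (k : J) : C :=
  a0 k + \sum_(r < g) (iota r == k)%:R * y ord0 (rshift g.+1 r).
Definition PP (y : V) : {poly C} := P0 + \sum_(i < g.+1) y ord0 (lshift g i) *: 'X^i.

Definition co (i : I) (y : V) : C := y ord0 i.
Definition ln (i : I) (s : C) : V := s *: delta_mx ord0 i.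

Lemma co_cont i y : {for y, continuous (co i)}.
Proof. exact: coord_continuous. Qed.

Lemma ln_cont i : {for 0, continuous (ln i)}.
Proof. exact: scalel_continuous. Qed.

Lemma ln0 i : ln i 0 = 0. Proof. exact: scale0r. Qed.

Lemma ln_co i k s r : co k (ln i s) - co k (ln i r) = (k == i)%:R * (s - r).
Proof. by rewrite /co !mxE eqxx /=; ring. Qed.

Lemma aa0 k : aa 0 k = a0 k.
Proof. by rewrite /aa big1 ?addr0 // => r _; rewrite mxE mulr0. Qed.

Lemma PP0 : PP 0 = P0.
Proof. by rewrite /PP big1 ?addr0 // => i _; rewrite mxE scale0r. Qed.

Lemma aa_cont k y : {for y, continuous (fun y => aa y k)}.
Proof.
apply: contD; first exact: cont_cst.
suff : forall s : seq 'I_g, {for y, continuous (fun y : V =>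
    \sum_(r <- s) (iota r == k)%:R * y ord0 (rshift g.+1 r))}.
  by move=> /(_ (index_enum 'I_g)).
elim=> [|r s ih].
  apply: (@cont_near _ _ (fun=> 0)); last exact: cont_cst.
  by apply: nbhsE_all => z; rewrite big_nil.
apply: (@cont_near _ _ (fun y : V => (iota r == k)%:R * y ord0 (rshift g.+1 r) +
    \sum_(r <- s) (iota r == k)%:R * y ord0 (rshift g.+1 r))).
  by apply: nbhsE_all => z; rewrite big_cons.
apply: contD => //; apply: contM; [exact: cont_cst|exact: co_cont].
Qed.

Lemma near_good : \forall y \near (0 : V), (forall j, aa y j != 0) /\
  (forall j k, k != j -> ~~ (0 < aa y k / aa y j)).
Proof.
have n1 : \forall y \near (0 : V), forall j, aa y j != 0.
  apply: near_forall => j; apply: (near_neq0 (f := fun y => aa y j)); first exact: aa_cont.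
  by rewrite aa0.
apply: nbhsS2 n1 _; first by move=> y h1 h2; split; [exact: h1|exact: h2].
apply: (near_forall (P := fun j y => forall k, k != j -> ~~ (0 < aa y k / aa y j))) => j.
apply: (near_forall (P := fun k y => k != j -> ~~ (0 < aa y k / aa y j))) => k.
case: (eqVneq k j) => kj; first by apply: nbhsE_all.
have c : {for 0, continuous (fun y => - (aa y k / aa y j))}.
  apply: contN; apply: contM; first exact: aa_cont.
  by apply: contV; [rewrite aa0|exact: aa_cont].
have := near_npos c; rewrite !aa0 => /(_ _).
have h : ~~ (- (a0 k / a0 j) <= 0).
  rewrite oppr_le0; apply: contra (a_gen kj) => h; rewrite lt_neqAle h andbT eq_sym.
  by rewrite mulf_neq0 ?invr_eq0.
move=> /(_ h); apply: nbhsS => y h2 _; apply: contra h2 => h3.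
by rewrite oppr_le0 ltW.
Qed.

Variable j : J.

Definition good (z : V * R) := aa z.1 j != 0 /\
  dom (aa z.1) (predC1 j) (tau (aa z.1) j (ofR z.2)).
Definition GG (y : (V * V) * R) := good (y.1.1, y.2) /\ good (y.1.2, y.2).

Definition integrand (z : V * R) : C := 2 / aa z.1 j *
  form (aa z.1) (PP z.1) (predC1 j) (tau (aa z.1) j (ofR z.2)).

Lemma near_goodx (x : R) : 0 <= x <= 1 -> \forall z \near ((0 : V), x), good z.
Proof.
move=> hx.
have caa k (z : V * R) : {for z, continuous (fun z : V * R => aa z.1 k)}.
  by apply: (@cont_ofst _ _ _ (fun y => aa y k)); exact: aa_cont.
have n1 : \forall z \near ((0 : V), x), aa z.1 j != 0.
  apply: (near_neq0 (f := fun z : V * R => aa z.1 j)); first exact: caa.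
  by rewrite aa0.
apply: nbhsS2 n1 _; first by move=> z h1 h2; split; [exact: h1|exact: h2].
apply: (near_forall (P := fun k (z : V * R) => predC1 j k ->
   ~~ (1 - aa z.1 k * tau (aa z.1) j (ofR z.2) <= 0))) => k.
case: (boolP (predC1 j k)) => kj; last by apply: nbhsE_all.
have c : {for ((0 : V), x), continuous (fun z : V * R =>
    1 - aa z.1 k * tau (aa z.1) j (ofR z.2))}.
  apply: contD; first exact: cont_cst.
  apply: contN; apply: contM; first exact: caa.
  apply: contM; last by apply: contV; [rewrite aa0|exact: caa].
  apply: contD; first exact: cont_cst.
  apply: contN; apply: contM; apply: cont_osnd; exact: cont_ofR.
have h : dom a0 (predC1 j) (tau a0 j (ofR x)) := @dom_tau01 _ _ _ a0 a_gen j x hx.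
have := near_npos c; rewrite /= /tau !aa0 => /(_ (h k kj)).
by apply: nbhsS => z hz _.
Qed.

Lemma near_GG (x : R) : 0 <= x <= 1 -> \forall y \near (((0 : V), (0 : V)), x), GG y.
Proof.
move=> /near_goodx h.
have c1 : {for (((0 : V), (0 : V)), x), continuous (fun y : (V * V) * R => (y.1.1, y.2))}.
  by apply: cont_pair; [exact: cont_11|exact: cont_snd].
have c2 : {for (((0 : V), (0 : V)), x), continuous (fun y : (V * V) * R => (y.1.2, y.2))}.
  by apply: cont_pair; [exact: cont_12|exact: cont_snd].
exact: nbhsS2 (fun _ h1 h2 => conj h1 h2) (c1 _ h) (c2 _ h).
Qed.

Lemma lk_integrand : lk co GG integrand.
Proof.
have coc := co_cont.
have laa k : lk co GG (fun z => aa z.1 k).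
  apply: lkD; first exact: lk_cst.
  by apply: lk_sum => r _; apply: lkM; [exact: lk_cst|exact: (lk_co coc)].
have lV : lk co GG (fun z => (aa z.1 j)^-1).
  by apply: lkV (laa j) => y [[h1 _] [h2 _]].
have ltau : lk co GG (fun z => tau (aa z.1) j (ofR z.2)).
  apply: lkM lV; apply: (@lk_var R C V _ co GG (fun x => 1 - ofR x ^+ 2)) => x.
  apply: contD; first exact: cont_cst.
  by apply: contN; apply: contM; exact: cont_ofR.
apply: lkM; first by apply: lkM lV; exact: lk_cst.
apply: lkM.
  apply: (@lk_eq _ _ _ _ _ _ (fun z : V * R => P0.[tau (aa z.1) j (ofR z.2)] +
     \sum_(i < g.+1) co (lshift g i) z.1 * tau (aa z.1) j (ofR z.2) ^+ i)).
    move=> z; rewrite /PP hornerD horner_sum; congr (_ + _); apply: eq_bigr => i _.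
    by rewrite hornerZ hornerXn.
  apply: lkD.
    apply: (@lk_comp _ _ _ _ _ _ (fun t => P0.[t]) (fun t => P0^`().[t] * 1)) ltau => y _.
    by split; apply: nbhsE_all => t; apply: (sd_poly (@cont_id R C)); exact: sd_io.
  by apply: lk_sum => i _; apply: lkM; [exact: (lk_co coc)|exact: lkX].
apply: lkV.
  by move=> y [[_ h1] [_ h2]]; split; exact: rootw_neq0.
apply: lk_prod => k kj; apply: lk_csqrt.
  by move=> y [[_ h1] [_ h2]]; split; [exact: h1|exact: h2].
apply: lkD; first exact: lk_cst.
have := lkM (lk_cst _ _ (-1)) (lkM (laa k) ltau).
by apply: lk_eq => z; rewrite mulN1r.
Qed.

Definition DD (i : I) (x : R) : C :=
  match fintype.split i with
  | inl i' => 2 / a0 j * form a0 'X^i' (predC1 j) (tauR a0 j x)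
  | inr r => if iota r == j then Deq a0 P0 j x else Dne a0 P0 (iota r) j x
  end.

Lemma aa_lnl (i : 'I_g.+1) s k : aa (ln (lshift g i) s) k = a0 k.
Proof.
rewrite /aa big1 ?addr0 // => r _; rewrite !mxE eqxx /= eq_rlshift.
by rewrite !mulr0.
Qed.

Lemma PP_lnl (i : 'I_g.+1) s : PP (ln (lshift g i) s) = P0 + s *: 'X^i.
Proof.
rewrite /PP (bigD1 i) //= big1 => [|k ki].
  by rewrite addr0 !mxE !eqxx mulr1.
by rewrite !mxE eqxx /= (inj_eq (@lshift_inj _ _)) (negbTE ki) mulr0 scale0r.
Qed.

Lemma aa_lnr (r : 'I_g) s k : aa (ln (rshift g.+1 r) s) k = a0 k + (iota r == k)%:R * s.
Proof.
rewrite /aa (bigD1 r) //= big1 => [|l lr].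
  by rewrite addr0 !mxE !eqxx mulr1.
by rewrite !mxE eqxx /= (inj_eq (@rshift_inj _ _)) (negbTE lr) !mulr0.
Qed.

Lemma PP_lnr (r : 'I_g) s : PP (ln (rshift g.+1 r) s) = P0.
Proof.
rewrite /PP big1 ?addr0 // => i _.
by rewrite !mxE eqxx /= eq_lrshift mulr0 scale0r.
Qed.

Lemma sd_DD i (x : R) : 0 <= x <= 1 -> sd id (fun s => integrand (ln i s, x)) 0 (DD i x).
Proof.
move=> hx; have hd := @dom_tau01 _ _ _ a0 a_gen j x hx; have w0 := rootw_neq0 hd.
rewrite -/(tauR a0 j x) in hd w0.
have idc := @cont_id R C; have aj := a_neq0 j.
have sdi : sd id (fun s : C => s) 0 1 by exact: sd_io.
rewrite /DD; case: (fintype.splitP i) => [i' Ei | r Er].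
  have -> : i = lshift g i' by exact: val_inj.
  have aE s : aa (ln (lshift g i') s) = a0 by apply/funext => k; exact: aa_lnl.
  set t := tauR a0 j x; set c := 2 / a0 j * form _ _ _ _.
  have := sdD (sd_cst id (2 / a0 j * form a0 P0 (predC1 j) t) 0) (sdZ idc c sdi).
  rewrite add0r mulr1; apply: sd_near; apply: nbhsE_all => s.
  rewrite /integrand /= aE PP_lnl /c /form -/(tauR a0 j x) -/t hornerD hornerZ.
  by ring.
have -> : i = rshift g.+1 r by exact: val_inj.
set k := iota r.
have aE s l : l != k -> aa (ln (rshift g.+1 r) s) l = a0 l.
  by move=> lk; rewrite aa_lnr eq_sym (negbTE lk) mul0r addr0.
have ak s : aa (ln (rshift g.+1 r) s) k = a0 k + s by rewrite aa_lnr eqxx mul1r.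
case: eqVneq => kj.
  have lin : sd id (fun s => a0 j + s) 0 1.
    by apply: (sd_unit (sdD (sd_cst id (a0 j) 0) sdi)); rewrite add0r.
  have aj' : a0 j + 0 != 0 by rewrite addr0.
  have inv := sdV idc aj' lin; rewrite addr0 in inv.
  pose v := 1 - ofR x ^+ 2 : C.
  have tE : tauR a0 j x = v / (a0 j + 0) by rewrite addr0.
  have hf : sd id (form a0 P0 (predC1 j)) (v / (a0 j + 0))
      (dform a0 P0 (predC1 j) (v / (a0 j + 0))) by apply: sd_form; rewrite -tE.
  have ht := sdZ idc v inv.
  have h := sdM idc (sdZ idc 2 inv) (sd_comp (g := fun s => v / (a0 j + s)) idc hf ht).
  have h' : sd id (fun s => 2 * (a0 j + s)^-1 * form a0 P0 (predC1 j) (v * (a0 j + s)^-1)) 0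
      (Deq a0 P0 j x).
    apply: (sd_unit h); rewrite -tE /Deq addr0.
    set A := form _ _ _ _; set B := dform _ _ _ _.
    have -> : tauR a0 j x = v / a0 j by [].
    by rewrite exprVn; field.
  apply: sd_near h'; apply: nbhsE_all => s.
  have akj : aa (ln (rshift g.+1 r) s) j = a0 j + s by rewrite -kj ak.
  rewrite /integrand /= PP_lnr /tau akj /form -/v; congr (_ * _ * (_ / _)).
  apply: eq_bigr => l /= lj.
  by rewrite aE // kj.
set t := tauR a0 j x in hd w0 *.
have kA : predC1 j k by [].
set A' := fun l => predC1 j l && (l != k).
have wE := rootwD1 a0 t kA; rewrite -/A' in wE.
have z0 := hd k kA.
have lin : sd id (fun s => 1 - (a0 k + s) * t) 0 (- t).
  have := sdB idc (sd_cst id 1 0) (sdM idc (sdD (sd_cst id (a0 k) 0) sdi) (sd_cst id t 0)).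
  by move/sd_unit; apply; ring.
have hs : sd id csqrt (1 - (a0 k + 0) * t) (2 * csqrt (1 - a0 k * t))^-1.
  by rewrite addr0; exact: sd_csqrt.
have sq := sd_comp (g := fun s => 1 - (a0 k + s) * t) idc hs lin.
have s0 : csqrt (1 - a0 k * t) != 0 by apply: csqrt_neq0; apply: contraNneq z0 => ->.
have w'0 : rootw a0 A' t != 0 by apply: contra_neq w0 => e; rewrite wE e mulr0.
have s0' : csqrt (1 - (a0 k + 0) * t) * rootw a0 A' t != 0.
  by rewrite addr0 mulf_neq0.
have sw := sdM idc sq (sd_cst id (rootw a0 A' t) 0).
have h := sdZ idc (2 / a0 j * P0.[t])
  (sdV (f := fun s => csqrt (1 - (a0 k + s) * t) * rootw a0 A' t) idc s0' sw).
have h' : sd id (fun s => 2 / a0 j * P0.[t] * (csqrt (1 - (a0 k + s) * t) * rootw a0 A' t)^-1) 0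
    (Dne a0 P0 k j x).
  apply: (sd_unit h); rewrite addr0 /Dne /form -/t wE.
  move: s0 w'0 (csqrt_sqr (1 - a0 k * t)); set S := csqrt _; set W := rootw _ _ _ => s0 w'0 sE.
  by rewrite -sE; field; rewrite s0 w'0.
apply: sd_near h'; apply: nbhsE_all => s.
rewrite /integrand /= PP_lnr (aE s j) 1?eq_sym // /form /tau (aE s j) 1?eq_sym //.
rewrite -/(tau a0 j (ofR x)) -/(tauR a0 j x) -/t (rootwD1 _ _ kA) ak -/A'.
rewrite -!mulrA; congr (_ * (_ * (_ / (_ * _)))).
by apply: eq_bigr => l /andP[_ lk]; rewrite aE.
Qed.

Definition DII (i : I) : C :=
  match fintype.split i with
  | inl i' => II a0 'X^i' j
  | inr r => II a0 (Qk a0 P0 (iota r)) j - ck a0 P0 (iota r)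
  end.

Lemma cint_DD i : cint (DD i) = DII i.
Proof.
rewrite /DII -(eq_cint (h := fun x => DD i x)) // /DD.
case: (fintype.split i) => [i'|r].
  by rewrite (cintZ _ (@cont_form_tau R C J a0 a_gen _ j)) -IIE.
by case: eqVneq => [->|kj]; [exact: cint_Deq|exact: cint_Dne].
Qed.

Lemma period_quotient : exists M : I -> V * V -> C,
  [/\ forall i, {for (0, 0), continuous (M i)}, forall i, M i (0, 0) = DII i &
    \forall z \near ((0, 0) : V * V),
      II (aa z.1) (PP z.1) j - II (aa z.2) (PP z.2) j =
      \sum_i M i z * (z.1 ord0 i - z.2 ord0 i)].
Proof.
have [M [Mc M0 hM]] := lk_int near_GG lk_integrand ln_cont ln0 ln_co sd_DD.
exists M; split=> // [i|]; first by rewrite M0 cint_DD.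
have IE (y : V) : (forall j, aa y j != 0) /\ (forall j k, k != j -> ~~ (0 < aa y k / aa y j)) ->
    cint (fun x => integrand (y, x)) = II (aa y) (PP y) j.
  by move=> [h1 h2]; rewrite IIE // -(cintZ _ (@cont_form_tau R C J (aa y) h2 _ j)).
apply: nbhsS2 hM (near_diag near_good near_good) => z /= h [h1 h2].
by rewrite -!IE.
Qed.

End PeriodMap.

(** * Local surjectivity of the period map *)

Lemma geom_cauchy (R : realType) (r : nat -> R) (K : R) :
  (forall n, `|r n.+1 - r n| <= K / 2 ^+ n) ->
  exists L, forall n, `|r n - L| <= 2 * K / 2 ^+ n.
Proof.
move=> hr; pose A n := r n - 2 * K / 2 ^+ n; pose B n := r n + 2 * K / 2 ^+ n.
have p2 n : (0 : R) < 2 ^+ n by rewrite exprn_gt0.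
have K0 : 0 <= K by have := le_trans (normr_ge0 _) (hr 0); rewrite expr0 divr1.
have half n : K / 2 ^+ n = 2 * K / 2 ^+ n.+1.
  by rewrite exprS; field; rewrite gt_eqF.
have dbl n : 2 * K / 2 ^+ n = K / 2 ^+ n + K / 2 ^+ n by rewrite mulr2n mulrDl mulrDl mul1r.
have step n : A n <= A n.+1 /\ B n.+1 <= B n.
  have := hr n; rewrite ler_norml /A /B -half dbl => /andP[h1 h2]; split; lra.
have AM : {homo A : m n / (m <= n)%N >-> m <= n}.
  by apply: homo_leq => [x|y x z|n]; [exact: lexx|exact: le_trans|have [] := step n].
have BM : {homo B : m n / (m <= n)%N >-> n <= m}.
  apply: (homo_leq (r := fun x y => y <= x)) => [x|y x z h1 h2|n]; first exact: lexx.
    exact: le_trans h2 h1.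
  by have [] := step n.
have AB n : A n <= B n.
  have : 0 <= 2 * K / 2 ^+ n by rewrite divr_ge0 ?mulr_ge0 // ltW.
  rewrite /A /B; lra.
have ub m : ubound (range A) (B m).
  move=> _ [n _ <-].
  exact: le_trans (AM _ _ (leq_maxl n m)) (le_trans (AB _) (BM _ _ (leq_maxr n m))).
have hA n : A n <= sup (range A) by apply: ub_le_sup; [exists (B 0); exact: ub|exists n].
have hB n : sup (range A) <= B n by apply: ge_sup; [exists (A 0), 0|exact: ub].
exists (sup (range A)) => n; have := hA n; have := hB n; rewrite /A /B ler_norml => h1 h2.
by apply/andP; split; lra.
Qed.

Lemma le0_geom (R : realType) (x K : R) : (forall n, x <= K / 2 ^+ n) -> x <= 0.
Proof.
move=> h; rewrite leNgt; apply/negP => x0.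
have K0 : 0 <= K by have := h 0; rewrite expr0 divr1 => /(lt_le_trans x0)/ltW.
have /(_ (K / x)) [n hn] : forall y : R, exists n, y < n%:R.
  by move=> y; exists (Num.bound `|y|); rewrite (le_lt_trans (ler_norm y)) // archi_boundP.
have h1 := h n; have : K < x * 2 ^+ n.
  rewrite mulrC -ltr_pdivrMr //; apply: lt_le_trans hn _.
  by rewrite -natrX ler_nat ltnW // ltn_expl.
by rewrite -ltr_pdivrMr ?exprn_gt0 // => /lt_le_trans/(_ h1); rewrite ltxx.
Qed.

Section Newton.
Variables (R : realType) (C : complexPlane R) (N : nat).
Local Notation V := 'rV[C]_N.
Implicit Types (v w : V).

Definition nm v : R := \sum_i nrm (v ord0 i).

Lemma nm_ge0 v : 0 <= nm v.
Proof. by apply: sumr_ge0 => i _; exact: nrm_ge0. Qed.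

Lemma nrm_le_nm v i : nrm (v ord0 i) <= nm v.
Proof. by rewrite /nm (bigD1 i) //= lerDl sumr_ge0 // => k _; exact: nrm_ge0. Qed.

Lemma nmD v w : nm (v + w) <= nm v + nm w.
Proof. by rewrite /nm -big_split; apply: ler_sum => i _; rewrite mxE nrmD. Qed.

Lemma nmN v : nm (- v) = nm v.
Proof. by apply: eq_bigr => i _; rewrite mxE nrmN. Qed.

Lemma nm0 : nm 0 = 0.
Proof. by apply: big1 => i _; rewrite mxE nrm0. Qed.

Lemma nm_eq0 v : nm v <= 0 -> v = 0.
Proof.
move=> h; apply/rowP => i; rewrite mxE; apply/eqP; rewrite -nrm_eq0.
by rewrite eq_le nrm_ge0 andbT (le_trans (nrm_le_nm v i)).
Qed.

Lemma nm_bound v (e : R) : (forall i, nrm (v ord0 i) <= e) -> nm v <= N%:R * e.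
Proof.
move=> h; apply: le_trans (ler_sum _ (fun i _ => h i)) _.
by rewrite sumr_const card_ord mulr_natl.
Qed.

Lemma nm_mulmx v (A : 'M[C]_N) (e : R) : (forall i j, nrm (A i j) <= e) ->
  nm (v *m A) <= nm v * (N%:R * e).
Proof.
move=> h; rewrite mulrCA; apply: nm_bound => j; rewrite mxE.
apply: le_trans (nrm_sum _) _; rewrite mulr_suml; apply: ler_sum => i _.
by rewrite nrmM ler_wpM2l ?nrm_ge0.
Qed.

Lemma near_nm (P : V * V -> Prop) : (\forall z \near ((0 : V), (0 : V)), P z) ->
  exists2 e : R, 0 < e & forall p q, nm p < e -> nm q < e -> P (p, q).
Proof.
case=> -[A B] [/= hA hB] AB.
have H (S : set V) : nbhs (0 : V) S -> exists2 e : R, 0 < e & forall p, nm p < e -> S p.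
  move=> /nbhs_ballP [e e0 he].
  have er : e = ofR (nrm e) by rewrite -nrmE gtr0_norm.
  exists (nrm e) => [|p hp]; first by rewrite nrm_gt0 gt_eqF.
  apply: he; split => // i j; rewrite (ord1 i) mxE -ball_normE /= sub0r normrN nrmE er ofR_lt.
  exact: le_lt_trans (nrm_le_nm p j) hp.
have [e1 e10 h1] := H _ hA; have [e2 e20 h2] := H _ hB.
exists (Num.min e1 e2) => [|p q hp hq]; first by rewrite lt_min e10.
by apply: AB; split; [apply: h1; apply: lt_le_trans hp _|apply: h2; apply: lt_le_trans hq _];
  rewrite ge_min lexx ?orbT.
Qed.

Lemma geom_cauchy_nm (u : nat -> V) (K : R) :
  (forall n, nm (u n.+1 - u n) <= K / 2 ^+ n) ->
  exists l, forall n, nm (u n - l) <= N%:R * (4 * K / 2 ^+ n).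
Proof.
move=> hu.
have H i : exists z, forall n, nrm (u n ord0 i - z) <= 4 * K / 2 ^+ n.
  have hi n : nrm (u n.+1 ord0 i - u n ord0 i) <= K / 2 ^+ n.
    apply: le_trans (hu n); have := nrm_le_nm (u n.+1 - u n) i; by rewrite !mxE.
  have [|x hx] := @geom_cauchy R (fun n => re (u n ord0 i)) K.
    by move=> n; rewrite -reB; exact: le_trans (re_le_nrm _) (hi n).
  have [|y hy] := @geom_cauchy R (fun n => im (u n ord0 i)) K.
    by move=> n; rewrite -imB; exact: le_trans (im_le_nrm _) (hi n).
  exists (ofR x + 'i * ofR y) => n; apply: le_trans (nrm_le _) _.
  rewrite reB imB reD imD reM imM !re_ofR !im_ofR re_i im_i.
  rewrite !(mul0r, mulr0, mul1r, addr0, add0r, subr0).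
  have := hx n; have := hy n; set b := _ / 2 ^+ n => h1 h2.
  have -> : 4 * K / 2 ^+ n = b + b by rewrite /b; ring.
  exact: lerD.
have [f hf] := choice H; exists (\row_i f i) => n.
by apply: nm_bound => i; rewrite !mxE; exact: hf.
Qed.

(* Newton iteration with the fixed matrix [M (0, 0)]. *)
Lemma locally_onto (Phi : V -> V) (M : V * V -> 'M[C]_N) (eps : R) :
  (forall i j, {for ((0 : V), (0 : V)), continuous (fun z => M z i j)}) ->
  M (0, 0) \in unitmx ->
  (\forall z \near ((0 : V), (0 : V)), Phi z.1 - Phi z.2 = (z.1 - z.2) *m M z) -> 0 < eps ->
  exists2 del : R, 0 < del & forall w, (forall j, nrm (w ord0 j - Phi 0 ord0 j) < del) ->
    exists2 p, nm p < eps & Phi p = w.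
Proof.
move=> Mc Mu hM eps0; set B := invmx (M (0, 0)).
pose A z := 1%:M - M z *m B.
have Ac i j : {for ((0 : V), (0 : V)), continuous (fun z => A z i j)}.
  have c : {for ((0 : V), (0 : V)), continuous (fun z =>
      (1%:M : 'M[C]_N) i j - \sum_k M z i k * B k j)}.
    apply: contD; first exact: cont_cst.
    apply: contN; suff : forall s : seq 'I_N,
        {for ((0 : V), (0 : V)), continuous (fun z => \sum_(k <- s) M z i k * B k j)}.
      by move=> /(_ (index_enum _)).
    elim=> [|k s ih].
      apply: (@cont_near _ _ (fun=> 0)); last exact: cont_cst.
      by apply: nbhsE_all => z; rewrite big_nil.
    apply: (@cont_near _ _ (fun z => M z i k * B k j + \sum_(k <- s) M z i k * B k j)).
      by apply: nbhsE_all => z; rewrite big_cons.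
    by apply: contD => //; apply: contM; [exact: Mc|exact: cont_cst].
  by apply: cont_near c; apply: nbhsE_all => z; rewrite !mxE.
have A0 : A (0, 0) = 0 by rewrite /A mulmxV // subrr.
pose eta : R := (2 * N.+1%:R)^-1.
have eta0 : 0 < eta by rewrite invr_gt0 mulr_gt0.
have Neta : N%:R * eta <= 1 / 2.
  rewrite /eta ler_pdivrMr ?mulr_gt0 // mulrA mul1r mulVf ?pnatr_eq0 // mul1r ler_nat.
  exact: leqnSn.
have nA : \forall z \near ((0 : V), (0 : V)), forall i j, nrm (A z i j) <= eta.
  apply: (near_forall (P := fun i z => forall j, nrm (A z i j) <= eta)) => i.
  apply: (near_forall (P := fun j z => nrm (A z i j) <= eta)) => j.
  move/contC_P: (Ac i j) => /(_ _ eta0); apply: nbhsS => z.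
  by rewrite A0 mxE sub0r nrmN => /ltW.
have [e0 e00 he0] := near_nm (nbhsS2 (fun z h1 h2 => conj h1 h2) hM nA).
pose e := Num.min e0 eps; have e_gt0 : 0 < e by rewrite lt_min e00.
have he p q : nm p < e -> nm q < e ->
   Phi p - Phi q = (p - q) *m M (p, q) /\ forall i j, nrm (A (p, q) i j) <= eta.
  by rewrite !lt_min => /andP[h1 _] /andP[h2 _]; exact: (he0 p q h1 h2).
pose K : R := e / (4 * N%:R + 4).
have N4 : 0 < 4 * N%:R + 4 :> R by rewrite ltr_wpDl ?mulr_ge0.
have K0 : 0 < K by rewrite divr_gt0.
have KE : K * (4 * N%:R + 4) = e by rewrite divfK // gt_eqF.
pose b := \sum_i \sum_j nrm (B i j).
have b0 : 0 <= b by apply: sumr_ge0 => i _; apply: sumr_ge0 => j _; exact: nrm_ge0.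
have hb i j : nrm (B i j) <= b.
  rewrite /b (bigD1 i) //= (bigD1 j) //= -addrA lerDl addr_ge0 //.
    by apply: sumr_ge0 => k _; exact: nrm_ge0.
  by apply: sumr_ge0 => k _; apply: sumr_ge0 => l _; exact: nrm_ge0.
pose del := K / (N%:R * (N%:R * b) + 1).
have Nb : 0 < N%:R * (N%:R * b) + 1 by rewrite ltr_wpDl // !mulr_ge0.
exists del => [|w hw]; first by rewrite divr_gt0.
pose T p := p - (Phi p - w) *m B.
have TB p q : nm p < e -> nm q < e -> nm (T p - T q) <= nm (p - q) / 2.
  move=> hp hq; have [h1 h2] := he p q hp hq.
  have -> : T p - T q = (p - q) *m A (p, q).
    rewrite /A mulmxBr mulmx1 mulmxA -h1 /T !mulmxBl.
    move: (Phi p *m B) (Phi q *m B) (w *m B) => x y z.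
    by apply/rowP => i; rewrite !mxE; ring.
  apply: le_trans (nm_mulmx _ h2) _; rewrite ler_wpM2l ?nm_ge0 //.
  by rewrite -[X in _ <= X]mul1r.
pose u n := iter n T 0.
have T0 : nm (T 0 - 0) <= K.
  rewrite subr0 /T sub0r -mulNmx opprB; apply: le_trans (nm_mulmx _ hb) _.
  have : nm (w - Phi 0) <= N%:R * del.
    by apply: nm_bound => i; rewrite !mxE ltW.
  move=> /(ler_wpM2r (mulr_ge0 (ler0n R N) b0)) /le_trans; apply.
  have -> : N%:R * del * (N%:R * b) = K * (N%:R * (N%:R * b) / (N%:R * (N%:R * b) + 1)).
    by rewrite /del; ring.
  by rewrite ler_piMr ?(ltW K0) // ler_pdivrMr // mul1r lerDl.
have uS n : nm (u n.+1 - u n) <= K / 2 ^+ n /\ nm (u n) <= 2 * K - 2 * K / 2 ^+ n.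
  have p2 m : (2 : R) ^+ m != 0 by rewrite expf_neq0.
  have lt_e m : nm (u m) <= 2 * K - 2 * K / 2 ^+ m -> nm (u m) < e.
    move=> /le_lt_trans; apply.
    have : 0 <= 2 * K / 2 ^+ m by rewrite divr_ge0 ?exprn_ge0 // mulr_ge0 // ltW.
    have := mulr_ge0 (ltW K0) (ler0n R N); rewrite -KE mulrDr; lra.
  elim: n => [|n [ih1 ih2]].
    by rewrite expr0 !divr1 subrr; split => //; rewrite nm0.
  have h2 : nm (u n.+1) <= 2 * K - 2 * K / 2 ^+ n.+1.
    have -> : u n.+1 = (u n.+1 - u n) + u n by rewrite subrK.
    apply: le_trans (nmD _ _) (le_trans (lerD ih1 ih2) _).
    by rewrite le_eqVlt; apply/orP; left; apply/eqP; rewrite exprS; field.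
  split => //; apply: le_trans (TB _ _ (lt_e _ h2) (lt_e _ ih2)) _.
  have -> : K / 2 ^+ n.+1 = K / 2 ^+ n / 2 by rewrite exprS invfM; ring.
  by rewrite ler_wpM2r // invr_ge0.
have [l hl] := geom_cauchy_nm (fun n => (uS n).1).
have lle : nm l < e.
  have := hl 0; rewrite sub0r nmN expr0 divr1 => /le_lt_trans; apply.
  rewrite -KE -subr_gt0.
  have -> : K * (4 * N%:R + 4) - N%:R * (4 * K) = 4 * K by ring.
  by rewrite mulr_gt0.
have ule n : nm (u n) < e.
  apply: le_lt_trans (uS n).2 _.
  have : 0 <= 2 * K / 2 ^+ n by rewrite divr_ge0 ?exprn_ge0 // mulr_ge0 // ltW.
  have := mulr_ge0 (ltW K0) (ler0n R N); rewrite -KE mulrDr; lra.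
have Tl : T l = l.
  apply/eqP; rewrite -subr_eq0; apply/eqP; apply: nm_eq0.
  apply: (@le0_geom R _ (N%:R * (4 * K) * 2)) => n.
  have -> : T l - l = (T l - T (u n)) + (u n.+1 - l) by rewrite addrA subrK.
  apply: le_trans (nmD _ _) _.
  have h1 := TB l (u n) lle (ule n); have h2 := hl n; have h3 := hl n.+1.
  rewrite -nmN opprB in h2.
  have h4 : N%:R * (4 * K / 2 ^+ n.+1) = N%:R * (4 * K / 2 ^+ n) / 2.
    by rewrite exprS; field; rewrite expf_neq0.
  have -> : N%:R * (4 * K) * 2 / 2 ^+ n = N%:R * (4 * K / 2 ^+ n) * 2 by ring.
  rewrite h4 in h3; move: h1 h2 h3; set x := nm _; set y := nm _; set z := nm _.
  set c := N%:R * _ => h1 h2 h3.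
  have : 0 <= c.
    apply: mulr_ge0 => //; apply: divr_ge0; last exact: exprn_ge0.
    by apply: mulr_ge0 => //; exact: ltW.
  lra.
exists l; first by move: lle; rewrite lt_min => /andP[].
move: Tl; rewrite /T => /eqP; rewrite subr_eq addrC -subr_eq subrr eq_sym => /eqP h.
have /(congr1 (fun v => v *m M (0, 0))) := h; rewrite mulmxKV // mul0mx => /eqP.
by rewrite subr_eq0 => /eqP.
Qed.

End Newton.

Lemma coef_mul_top (F : nzRingType) (p q : {poly F}) m n :
  (size p <= m.+1)%N -> (size q <= n.+1)%N -> (p * q)`_(m + n) = p`_m * q`_n.
Proof.
move=> sp sq; rewrite coefM.
have hm : (m < (m + n).+1)%N by rewrite ltnS leq_addr.
rewrite (bigD1 (Ordinal hm)) //= addKn big1 ?addr0 // => i.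
rewrite -(inj_eq val_inj) /= => im; case: (ltngtP i m) im => // him _.
  rewrite [q`__]nth_default ?mulr0 //; apply: leq_trans sq _.
  by rewrite ltn_subRL ltn_add2r.
by rewrite [p`__]nth_default ?mul0r //; exact: leq_trans sp him.
Qed.

Section Kernel.
Variables (R : realType) (C : complexPlane R) (J : finType) (g : nat).
Variables (a0 : J -> C) (P0 : {poly C}) (iota : 'I_g -> J).
Hypothesis a_neq0 : forall j, a0 j != 0.
Hypothesis a_gen : forall j k, k != j -> ~~ (0 < a0 k / a0 j).
Hypothesis cardJ : #|J| = (2 * g.+1)%N.
Hypothesis size_P0 : (size P0 <= g.+1)%N.
Hypothesis iota_inj : injective iota.
Hypothesis P0_iota : forall r, P0.[(a0 (iota r))^-1] != 0.
Local Notation D := (Dp a0 xpredT).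
Local Notation DD k := (Dp a0 (predC1 k)).

(* The derivative of [S / rootw] is [wron S / rootw ^+ 3]. *)
Definition wron (S : {poly C}) : {poly C} := D * S^`() - 2^-1 *: (S * D^`()).

Lemma wronD S T : wron (S + T) = wron S + wron T.
Proof. by rewrite /wron derivD mulrDr mulrDl scalerDr opprD addrACA. Qed.

Lemma wron0 : wron 0 = 0.
Proof. by rewrite /wron deriv0 mulr0 mul0r scaler0 subr0. Qed.

Lemma wronZ c S : wron (c *: S) = c *: wron S.
Proof.
by rewrite /wron derivZ -!mul_polyC; ring.
Qed.

Lemma DDE k : D = (1 - a0 k *: 'X) * DD k.
Proof. by rewrite (@DpD1 _ _ _ a0 xpredT k). Qed.

Lemma size_lin (c : C) : c != 0 -> size (1 - c *: 'X : {poly C}) = 2%N.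
Proof.
move=> c0; rewrite addrC size_polyDl ?size_polyN size_scale ?size_polyX //.
by rewrite size_poly1.
Qed.

Lemma size_Dp (A : pred J) : size (Dp a0 A) = #|A|.+1.
Proof.
rewrite size_prod => [|k _]; last by rewrite -size_poly_gt0 size_lin.
rewrite (eq_bigr (fun=> 2%N)) => [|k _]; last exact: size_lin.
by rewrite sum_nat_const muln2 -addnn subSn ?addnK // leq_addr.
Qed.

Lemma wron_exact (B : {poly C}) : wron (B * D) = D * (B^`() * D + 2^-1 *: (B * D^`())).
Proof.
rewrite /wron derivM -!mul_polyC; set h := 2^-1%:P.
have hE : h + h = 1 by rewrite /h -rmorphD -mulr2n -[_ *+ 2]mulr_natl mulfV ?pnatr_eq0.
by transitivity (D * (B^`() * D + (h + h) * (B * D^`())) - h * (B * D * D^`()));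
  [rewrite hE mul1r|ring].
Qed.

Lemma D_Qk k : D * Qk a0 P0 k =
  2^-1 *: ('X * P0 * DD k) - wron (ck a0 P0 k *: DD k).
Proof.
have ak := a_neq0 k.
have hM := MkE a_neq0 a_gen P0 k.
have hD' : D^`() = - a0 k *: DD k + (1 - a0 k *: 'X) * (DD k)^`().
  by rewrite (DDE k) derivM derivB derivC derivZ derivX -!mul_polyC polyCN; ring.
have hDM : D * Mk a0 P0 k = DD k * (ck a0 P0 k *: DD k - (a0 k)^-1 *: ('X * P0)).
  by rewrite hM (DDE k); ring.

have e1 : (a0 k)%:P * (a0 k)^-1%:P = 1 :> {poly C} by rewrite -polyCM divff.
rewrite -!mul_polyC in hD' hM.
set c := (ck a0 P0 k)%:P in hM; set h := (2^-1)%:P : {poly C}.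
have hE : h + h = 1 by rewrite /h -rmorphD -mulr2n -[_ *+ 2]mulr_natl mulfV ?pnatr_eq0.
rewrite /wron derivZ hD' /Qk -!mul_polyC -/c (DDE k) polyCN -/h.
move: hM; rewrite -!mul_polyC; set M := Mk _ _ _.
set E := DD k; set E' := E^`(); set u := (a0 k)%:P in e1 *.
set ui := _%:P in e1 *; move: (polyCN (a0 k)) => /= uN hM.
rewrite -/u in uN; rewrite uN; apply/eqP; rewrite -subr_eq0; apply/eqP.
transitivity ((1 - (h + h)) * (c * (1 - u * 'X) * E * E') +
  h * u * E * (c * E - ui * ('X * P0) - (1 - u * 'X) * M) -
  h * E * (1 - u * ui) * 'X * P0); first by ring.
by rewrite hE e1 hM !subrr; ring.
Qed.

Lemma IIsum (T : finType) (F : T -> {poly C}) j : II a0 (\sum_i F i) j = \sum_i II a0 (F i) j.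
Proof.
have II0 : II a0 0 j = 0 by rewrite -(scale0r (0 : {poly C})) IIZ // mul0r.
by apply: (big_morph (fun Q => II a0 Q j) _ II0) => P Q; exact: IID.
Qed.

Lemma size_wron_eq0 (S : {poly C}) : (size (wron S) <= 3 * g.+1)%N -> (size S <= g.+2)%N.
Proof.
move=> hS; rewrite leqNgt; apply/negP => hs.
have s0 : (0 < size S)%N by exact: leq_trans hs.
case E : (size S) hs s0 => [//|s] hs _; rewrite ltnS in hs.
have E2 : size D = (2 * g.+1).+1 by rewrite size_Dp (eq_card (B := predT)) // cardJ.
have : (wron S)`_(s + (2 * g.+1).-1) = 0.
  by apply: nth_default; apply: leq_trans hS _; lia.
have hsp : s = s.-1.+1 by rewrite prednK //; lia.
have dS : (size S^`() <= s.-1.+1)%N by rewrite -hsp -ltnS -E lt_size_deriv // -size_poly_eq0 E.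
have D0 : D != 0 by rewrite -size_poly_eq0 E2.
have hdp : (2 * g.+1)%N = (2 * g.+1).-1.+1 by lia.
have dD : (size D^`() <= (2 * g.+1).-1.+1)%N.
  by rewrite -hdp -ltnS -E2 lt_size_deriv.
have i1 : (s + (2 * g.+1).-1 = 2 * g.+1 + s.-1)%N by lia.
rewrite /wron coefB coefZ (@coef_mul_top _ S D^`() s) ?E // i1 (@coef_mul_top _ D S^`()) ?E2 //.
rewrite !coef_deriv -hsp -hdp.
have lS : S`_s != 0 by have := lead_coef_eq0 S; rewrite lead_coefE E /= -size_poly_eq0 E => ->.
have lD : D`_(2 * g.+1) != 0 by have := lead_coef_eq0 D; rewrite lead_coefE E2 /= (negbTE D0) => ->.
have -> : D`_(2 * g.+1) * (S`_s *+ s) - 2^-1 * (S`_s * (D`_(2 * g.+1) *+ (2 * g.+1))) =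
    (s%:R - g.+1%:R) * (S`_s * D`_(2 * g.+1)).
  rewrite -(mulr_natl S`_s) -(mulr_natl D`_(2 * g.+1)) natrM.
  by move: S`_s D`_(2 * g.+1) (s%:R : C) (g.+1%:R : C) => x y n m; field.
move/eqP; rewrite !mulf_eq0 (negbTE lS) (negbTE lD) !orbF subr_eq0 eqr_nat.
by move=> /eqP e; rewrite e ltnn in hs.
Qed.

Lemma DII_kernel (v : 'I_(g.+1 + g) -> C) (kappa : C) :
  (forall j, \sum_i v i * DII a0 P0 iota j i = kappa) -> v =1 fun=> 0.
Proof.
move=> hv; pose vl i := v (lshift g i); pose vr r := v (rshift g.+1 r).
pose dP : {poly C} := \sum_i vl i *: 'X^i.
pose Q := dP + \sum_r vr r *: Qk a0 P0 (iota r).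
have IQ j : II a0 Q j = kappa + \sum_r vr r * ck a0 P0 (iota r).
  rewrite -(hv j) big_split_ord /= /Q IID // !IIsum -addrA; congr (_ + _).
    apply: eq_bigr => i _; rewrite IIZ // /DII.
    by have -> : fintype.split (lshift g i) = inl i := unsplitK (inl i).
  rewrite -big_split; apply: eq_bigr => r _; rewrite IIZ // /DII /=.
  have -> : fintype.split (rshift g.+1 r) = inr r := unsplitK (inr r).
  by rewrite mulrBr subrK.
have [B hB] := period_exact a_neq0 a_gen IQ.
have QE : Q = B^`() * D + 2^-1 *: (B * D^`()).
  apply/eqP; rewrite -subr_eq0; apply/eqP; apply: (@poly_eq0_dom _ _ _ a0) => t dt.
  have h1 : sd id (fun t => FF a0 Q t - (kappa + \sum_r vr r * ck a0 P0 (iota r))) t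
      (form a0 Q xpredT t - 0).
    exact: (sdB (@cont_id R C) (sd_FF Q dt) (sd_cst id _ t)).
  have h2 : sd id (fun t => B.[t] * rootw a0 xpredT t) t
      (B^`().[t] * 1 * rootw a0 xpredT t + B.[t] * (D^`().[t] / (2 * rootw a0 xpredT t))).
    apply: (sdM (@cont_id R C)) (sd_rootw dt).
    exact: (sd_poly (@cont_id R C) B (sd_io id t)).
  have h3 := sd_near (nbhsS (fun s ds => hB s ds) (dom_near dt)) h1.
  have := sd_uniq h3 h2; rewrite subr0 mulr1 /form.
  have w0 := rootw_neq0 dt; have wE := rootw_sqr a0 xpredT t.
  move=> /(congr1 (fun z => z * rootw a0 xpredT t)); rewrite divfK //.
  move: (Q) => Q' e.
  rewrite !(hornerD, hornerN, hornerM, hornerZ) e -wE; field.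
  exact: w0.
pose S := B * D + \sum_r vr r *: (ck a0 P0 (iota r) *: DD (iota r)).
pose E := \sum_r vr r *: DD (iota r).
have SE : wron S = D * dP + 2^-1 *: ('X * P0 * E).
  have wsum : wron (\sum_r vr r *: (ck a0 P0 (iota r) *: DD (iota r))) =
      \sum_r vr r *: wron (ck a0 P0 (iota r) *: DD (iota r)).
    rewrite (big_morph wron wronD (id1 := 0)); last exact: wron0.
    by apply: eq_bigr => r _; exact: wronZ.
  rewrite wronD wron_exact -QE /Q mulrDr -addrA; congr (_ + _).
  rewrite wsum mulr_sumr -big_split mulr_sumr scaler_sumr; apply: eq_bigr => r _ /=.
  by rewrite -scalerAr D_Qk scalerBr subrK -scalerAr [RHS]scalerA [LHS]scalerA mulrC.
have size_dP : (size dP <= g.+1)%N.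
  apply: leq_trans (size_sum _ _ _) _; apply/bigmax_leqP => i _.
  by apply: leq_trans (size_scale_leq _ _) _; rewrite size_polyXn.
have sD : size D = (2 * g.+1).+1 by rewrite size_Dp (eq_card (B := predT)) // cardJ.
have sDk k : size (DD k) = (2 * g.+1).-1.+1.
  by rewrite size_Dp cardC1 cardJ.
have Droot k : D.[(a0 k)^-1] = 0.
  by rewrite (DDE k) !evalE divff // subrr mul0r.
have DDroot k l : l != k -> (DD k).[(a0 l)^-1] = 0.
  move=> lk; apply/eqP; rewrite Dp_eval; apply/prodf_eq0; exists l => //.
  by rewrite divff // subrr.
have size_E : (size E <= 2 * g.+1)%N.
  apply: leq_trans (size_sum _ _ _) _; apply/bigmax_leqP => r _.
  by apply: leq_trans (size_scale_leq _ _) _; rewrite sDk prednK // mulnS.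
have S0 : S = 0.
  apply/eqP/negPn/negP => S0; pose rs := [seq (a0 k)^-1 | k in [predC (codom iota)]].
  have inj : injective (fun k => (a0 k)^-1).
    by move=> k l /invr_inj; exact: (@a_inj R C J a0 a_neq0 a_gen).
  have := max_poly_roots S0 (rs := rs); rewrite size_map -cardE.
  have -> : #|[predC (codom iota)]| = g.+2.
    have := cardC (mem (codom iota)); rewrite card_codom // card_ord cardJ => h.
    by apply/eqP; rewrite -(eqn_add2l g) h; apply/eqP; lia.
  rewrite ltnNge size_wron_eq0 => [h|]; last first.
    rewrite SE; apply: leq_trans (size_polyD _ _) _; rewrite geq_max; apply/andP; split.
      apply: leq_trans (size_polyMleq _ _) _; rewrite sD; lia.
    apply: leq_trans (size_scale_leq _ _) _; apply: leq_trans (size_polyMleq _ _) _.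
    have := size_polyMleq ('X : {poly C}) P0; rewrite size_polyX; lia.
  have : false.
    apply: h; last by rewrite map_inj_uniq // enum_uniq.
    apply/allP => _ /mapP[k + ->]; rewrite mem_enum inE /= => kI.
    rewrite /root /S hornerD hornerM Droot mulr0 add0r horner_sum big1 // => r _.
    rewrite !hornerZ DDroot ?mulr0 //; apply: contraNneq kI => ->; exact: codom_f.
  by [].
have vr0 r : vr r = 0.
  have /(congr1 (fun p => p.[(a0 (iota r))^-1])) := SE.
  rewrite S0 wron0 horner0 hornerD [(D * _).[_]]hornerM Droot mul0r add0r.
  rewrite hornerZ hornerM [('X * _).[_]]hornerM hornerX /E horner_sum (bigD1 r) //= big1 => [|l lr].
    rewrite addr0 hornerZ => /esym/eqP; rewrite !mulf_eq0 !invr_eq0 pnatr_eq0 /=.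
    rewrite (negbTE (a_neq0 _)) (negbTE (P0_iota _)) (negbTE (Dp_root_neq0 _ _)) //=.
    by rewrite orbF => /eqP.
  by rewrite hornerZ DDroot ?mulr0 // (inj_eq iota_inj) eq_sym.
have dP0 : dP = 0.
  have /eqP := SE; rewrite S0 wron0 /E big1 => [|r _].
    rewrite mulr0 scaler0 addr0 eq_sym mulf_eq0 -size_poly_eq0 sD /= => /eqP //.
  by rewrite vr0 scale0r.
move=> i; case: (splitP i) => [k ik|r ir].
  have -> : i = lshift g k by exact: val_inj.
  have := coef0 C k; rewrite -dP0 coef_sum (bigD1 k) //= big1 => [|l lk].
    by rewrite addr0 coefZ coefXn eqxx mulr1.
  by rewrite coefZ coefXn eq_sym (inj_eq val_inj) (negbTE lk) mulr0.
have -> : i = rshift g.+1 r by exact: val_inj.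
exact: vr0.
Qed.

End Kernel.

Section RealPeriods.
Variables (R : realType) (C : complexPlane R) (J : finType) (a : J -> C).
Hypothesis a_neq0 : forall j, a j != 0.
Hypothesis a_gen : forall j k, k != j -> ~~ (0 < a k / a j).

(* There are [2 m] real coefficients for [n] real conditions. *)
Lemma exists_imaginary_periods (n m : nat) (p : 'I_n.+1 -> J) : (n < m + m)%N ->
  exists P : {poly C}, [/\ P != 0, (size P <= m)%N &
    forall j, re (II a P (p j)) = re (II a P (p ord0))].
Proof.
move=> nm; pose b (i : 'I_(m + m)) : {poly C} :=
  match fintype.split i with inl i => 'X^i | inr i => 'i *: 'X^i end.
pose A : 'M[R]_(m + m, n) := \matrix_(i, j)
  (re (II a (b i) (p (lift ord0 j))) - re (II a (b i) (p ord0))).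
have : kermx A != 0.
  rewrite kermx_eq0 /row_free; apply: contraTneq nm => <-.
  by rewrite -leqNgt rank_leq_col.
case/rowV0Pn => v /sub_kermxP vA v0.
pose P : {poly C} := \sum_i ofR (v ord0 i) *: b i.
have bl i : b (lshift m i) = 'X^i.
  by rewrite /b; have -> : fintype.split (lshift m i) = inl i := unsplitK (inl i).
have br i : b (rshift m i) = 'i *: 'X^i.
  by rewrite /b; have -> : fintype.split (rshift m i) = inr i := unsplitK (inr i).
have coefP (k : 'I_m) : P`_k = ofR (v ord0 (lshift m k)) + 'i * ofR (v ord0 (rshift m k)).
  rewrite coef_sum big_split_ord /= (bigD1 k) //= big1 => [|l lk]; last first.
    by rewrite bl coefZ coefXn eq_sym (inj_eq val_inj) (negbTE lk) mulr0.
  rewrite [X in _ + X](bigD1 k) //= big1 => [|l lk]; last first.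
    by rewrite br !coefZ coefXn eq_sym (inj_eq val_inj) (negbTE lk) !mulr0.
  by rewrite bl br !coefZ !coefXn eqxx !mulr1 !addr0 mulrC ['i * _]mulrC.
exists P; split.
- apply: contra_neq v0 => P0; apply/rowP => i; rewrite mxE.
  case: (splitP i) => k ik.
    have -> : i = lshift m k by exact: val_inj.
    have := congr1 (@re R C) (coefP k); rewrite P0 coef0 reD reM !re_ofR !im_ofR re_i im_i re0.
    by rewrite mul0r mulr0 subr0 addr0.
  have -> : i = rshift m k by exact: val_inj.
  have := congr1 (@im R C) (coefP k); rewrite P0 coef0 imD imM !re_ofR !im_ofR re_i im_i im0.
  by rewrite mul0r mul1r !add0r.
- apply: leq_trans (size_sum _ _ _) _; apply/bigmax_leqP => i _.
  apply: leq_trans (size_scale_leq _ _) _; rewrite /b; case: (fintype.split i) => k.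
    by rewrite size_polyXn.
  by apply: leq_trans (size_scale_leq _ _) _; rewrite size_polyXn.
move=> j; apply/eqP; rewrite -subr_eq0.
have rII k : re (II a P k) = \sum_i v ord0 i * re (II a (b i) k).
  rewrite IIsum // (big_morph (@re R C) (@reD R C) (@re0 R C)); apply: eq_bigr => i _.
  by rewrite IIZ // mulrC re_mulR mulrC.
rewrite (rII (p j)) (rII (p ord0)) -sumrB; case: (unliftP ord0 j) => [k ->|->]; last first.
  by rewrite big1 // => i _; rewrite subrr.
have /rowP/(_ k) := vA; rewrite !mxE => h; rewrite -[X in _ == X]h; apply/eqP.
by apply: eq_bigr => i _; rewrite mxE mulrBr.
Qed.

Lemma exists_nonroots (P : {poly C}) (g : nat) : P != 0 -> (size P <= g.+1)%N ->
  #|J| = (2 * g.+1)%N ->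
  exists iota : 'I_g -> J, injective iota /\ forall r, P.[(a (iota r))^-1] != 0.
Proof.
move=> P0 sP cardJ; pose A := [pred k | P.[(a k)^-1] != 0].
have inj : injective (fun k => (a k)^-1).
  by move=> k l /invr_inj; exact: (@a_inj R C J a a_neq0 a_gen).
have cA : (g <= #|A|)%N.
  have := max_poly_roots P0 (rs := [seq (a k)^-1 | k in [predC A]]).
  rewrite size_map -cardE => h.
  have {}h : (#|[predC A]| < size P)%N.
    apply: h; last by rewrite map_inj_uniq // enum_uniq.
    by apply/allP => _ /mapP[k + ->]; rewrite mem_enum inE /= negbK.
  have := cardC A; rewrite cardJ => e; rewrite -(leq_add2r #|[predC A]|) e.
  by move: (leq_trans h sP); move: #|_| => x; lia.
have j0 : 'I_g -> J.
  move=> r; have /card_gt0P/sigW[x _] // : (0 < #|A|)%N.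
  by apply: leq_trans cA; case: r => r; exact: leq_ltn_trans.
exists (fun r => nth (j0 r) (enum A) r); split=> [r s|r].
  have hr (q : 'I_g) : (q < size (enum A))%N by rewrite -cardE (leq_trans _ cA).
  rewrite (set_nth_default (j0 r)) // => /eqP; rewrite nth_uniq ?enum_uniq ?hr //.
  by move=> /eqP e; exact: val_inj.
have : nth (j0 r) (enum A) r \in enum A by rewrite mem_nth // -cardE (leq_trans _ cA).
by rewrite mem_enum.
Qed.

End RealPeriods.

Section LocalDensity.
Variables (R : realType) (C : complexPlane R) (g : nat).
Local Notation J := 'I_(g.+1 + g).+1.
Local Notation V := 'rV[C]_(g.+1 + g).
Variable a0 : J -> C.
Hypothesis a_neq0 : forall j, a0 j != 0.
Hypothesis a_gen : forall j k, k != j -> ~~ (0 < a0 k / a0 j).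

Theorem pellian_near (eps : R) : 0 < eps -> exists a : J -> C,
  [/\ forall k, nrm (a k - a0 k) < eps, forall k, a k != 0, injective a &
    Pellian (Dp a xpredT)].
Proof.
move=> eps0.
have cardJ : #|{: J}| = (2 * g.+1)%N by rewrite card_ord; lia.
have [|P0 [P0n sP0 hP0]] := @exists_imaginary_periods R C J a0 a_gen (g.+1 + g) g.+1 id.
  by lia.
have [iota [iota_inj hiota]] := exists_nonroots a_neq0 a_gen P0n sP0 cardJ.
have /choice [f hf] := @period_quotient R C J g a0 P0 iota a_neq0 a_gen.
pose M (z : V * V) : 'M[C]_(g.+1 + g) := \matrix_(i, j) (f (lift ord0 j) i z - f ord0 i z).
pose per p j := II (aa a0 iota p) (PP P0 p) j.
pose Phi (p : V) : V := \row_j (per p (lift ord0 j) - per p ord0).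
have Mc i j : {for ((0 : V), (0 : V)), continuous (fun z => M z i j)}.
  have c : {for ((0 : V), (0 : V)), continuous (fun z => f (lift ord0 j) i z - f ord0 i z)}.
    apply: contD; first by have [+ _ _] := hf (lift ord0 j).
    by apply: contN; have [+ _ _] := hf ord0.
  by apply: cont_near c; apply: nbhsE_all => z; rewrite mxE.
have Mu : M (0, 0) \in unitmx.
  rewrite -row_free_unit; apply: inj_row_free => v vM.
  pose kappa := \sum_i v ord0 i * DII a0 P0 iota ord0 i.
  have hv : (fun i => v ord0 i) =1 fun=> 0.
    apply: (@DII_kernel R C J g a0 P0 iota a_neq0 a_gen cardJ sP0 iota_inj hiota _ kappa) => j.
    case: (unliftP ord0 j) => [k ->|-> //].
    have /rowP/(_ k) := vM; rewrite !mxE => /eqP.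
    under eq_bigr do rewrite mxE (let: And3 _ h _ := hf (lift ord0 k) in h)
      (let: And3 _ h _ := hf ord0 in h) mulrBr.
    by rewrite sumrB subr_eq0 => /eqP.
  by apply/rowP => i; rewrite hv mxE.
have hM : \forall z \near ((0 : V), (0 : V)), Phi z.1 - Phi z.2 = (z.1 - z.2) *m M z.
  have : \forall z \near ((0 : V), (0 : V)), forall j, per z.1 j - per z.2 j =
      \sum_i f j i z * (z.1 ord0 i - z.2 ord0 i).
    apply: (near_forall (P := fun j z => per z.1 j - per z.2 j =
      \sum_i f j i z * (z.1 ord0 i - z.2 ord0 i))) => j.
    by have [_ _] := hf j.
  apply: nbhsS => z h; apply/rowP => j; rewrite !mxE.
  transitivity ((per z.1 (lift ord0 j) - per z.2 (lift ord0 j)) - (per z.1 ord0 - per z.2 ord0)).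
    by move: (per _ _) (per _ _) (per _ _) (per _ _) => x y u v; ring.
  by rewrite !h -sumrB; apply: eq_bigr => i _; rewrite !mxE; ring.
have ng := near_good iota a_neq0 a_gen.
have [e1 e10 he1] := near_nm (near_diag ng ng).
pose l0 := nrm (lead_coef P0).
have l00 : 0 < l0 by rewrite nrm_gt0 lead_coef_eq0.
have e0 : 0 < Num.min eps (Num.min e1 l0) by rewrite !lt_min eps0 e10.
have [del del0 hdel] := locally_onto Mc Mu hM e0.
pose n := (Num.bound (pi / del)).+1.
have n0 : 0 < n%:R :> R by rewrite ltr0n.
have hn : pi / n%:R < del.
  rewrite ltr_pdivrMr // mulrC -ltr_pdivrMr //.
  have := archi_boundP (divr_ge0 (pi_ge0 R) (ltW del0)) => /lt_trans; apply.
  by rewrite ltr_nat.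
pose K j := Num.floor (n%:R * im (Phi 0 ord0 j) / pi).
pose w : V := \row_j ('i * ofR (pi * (K j)%:~R / n%:R)).
have [j|p] := hdel w.
  have reP : re (Phi 0 ord0 j) = 0.
    rewrite mxE reB /per; have -> : aa a0 iota 0 = a0 by apply/funext => k; exact: aa0.
    by rewrite PP0 hP0 subrr.
  pose y := im (Phi 0 ord0 j).
  have -> : w ord0 j - Phi 0 ord0 j = 'i * ofR (pi * (K j)%:~R / n%:R - y).
    by rewrite [Phi 0 ord0 j]cE reP rmorph0 add0r [w ord0 j]mxE -mulrBr -rmorphB.
  rewrite nrmM nrm_i mul1r nrm_ofR; apply: le_lt_trans hn.
  have /andP[k1 k2] := floor_itv (n%:R * y / pi).
  have pi0 := pi_gt0 R; rewrite -/(K j) ler_pdivlMr // in k1.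
  rewrite -/(K j) ltr_pdivrMr // in k2.
  have h1 : pi * (K j)%:~R / n%:R <= y by rewrite ler_pdivrMr // mulrC [leRHS]mulrC.
  have h2 : y <= pi * (K j)%:~R / n%:R + pi / n%:R.
    rewrite -mulrDl ler_pdivlMr // mulrC; apply: ltW; apply: lt_le_trans k2 _.
    by rewrite intrD mulrDl mul1r mulrC.
  by rewrite ler_norml; apply/andP; split; lra.
rewrite !lt_min => /and3P[p1 p2 p3] Phip.
exists (aa a0 iota p); have [[ap apg] _] := he1 p p p2 p2.
split=> // [k||].
- rewrite /aa addrC addKr; apply: le_lt_trans p1.
  apply: le_trans (nrm_sum _) _; rewrite /nm big_split_ord /= ler_wpDl //.
    by apply: sumr_ge0 => i _; exact: nrm_ge0.
  apply: ler_sum => r _; rewrite nrmM -[leRHS]mul1r ler_wpM2r ?nrm_ge0 //.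
  by case: eqP => _; rewrite ?nrm1 ?nrm0.
- exact: a_inj ap apg.
apply: (@pellian_of_periods R C J (aa a0 iota p) ap apg g.+1 (PP P0 p) n (per p ord0)) => //.
- apply: leq_trans (size_polyD _ _) _; rewrite geq_max sP0 /=.
  apply: leq_trans (size_sum _ _ _) _; apply/bigmax_leqP => i _.
  by apply: leq_trans (size_scale_leq _ _) _; rewrite size_polyXn.
- apply/negP => /eqP PP0'; have sz : (0 < size P0)%N by rewrite size_poly_gt0.
  have hs : ((size P0).-1 < g.+1)%N by rewrite prednK.
  have := congr1 (fun Q : {poly C} => Q`_(Ordinal hs)) PP0'.
  rewrite /= /PP coefD coef0 coef_sum (bigD1 (Ordinal hs)) //= big1 => [|l lk]; last first.
    rewrite coefZ coefXn eq_sym (_ : (_ == _) = false) ?mulr0 //.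
    by apply: contraNF lk => /eqP e; apply/eqP/val_inj.
  rewrite coefZ coefXn eqxx mulr1 addr0 -lead_coefE => /eqP; rewrite addr_eq0 => /eqP e.
  have := le_lt_trans (nrm_le_nm p _) p3; rewrite /l0 e nrmN => /(_ (lshift g (Ordinal hs))).
  by rewrite ltxx.
move=> j; rewrite -/(per p j).
case: (unliftP ord0 j) => [k ->|->]; last first.
  by exists 0; rewrite subrr mulr0 mulr0z mulr0 rmorph0 mulr0.
exists (K k); have /rowP/(_ k) := Phip; rewrite !mxE => ->.
rewrite mulrCA -(rmorph_nat (@ofR R C)) -rmorphM; congr (_ * ofR _).
by field; rewrite gt_eqF.
Qed.

End LocalDensity.

(** * From branch points to coefficients *)

Section MonicSplit.
Variables (F : fieldType) (n : nat).
Implicit Types (e : 'I_n -> F) (s : 'rV[F]_n).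

Definition prodX e : {poly F} := \prod_k ('X - (e k)%:P).

Lemma size_prodX e : size (prodX e) = n.+1.
Proof.
by rewrite size_prod_XsubC /index_enum; case: index_enum_key; rewrite /= -enumT size_enum_ord.
Qed.

Lemma disc_prodX e : (disc (prodX e) != 0) = injectiveb e.
Proof.
rewrite /disc (monicP (monic_prod_XsubC _ _ _)) invr1 mulr1 mulf_eq0 signr_eq0 /=.
rewrite resultant_eq0 -leqNgt.
have -> : injectiveb e = separable.separable_poly (prodX e).
  rewrite /prodX -(big_map e predT (fun x => 'X - x%:P)) separable_prod_XsubC.
  by rewrite /index_enum; case: index_enum_key; rewrite /= -enumT.
rewrite unlock /coprimep eqn_leq andbC.
have -> // : (0 < size (gcdp (prodX e) (prodX e)^`()))%N.
rewrite size_poly_gt0 gcdp_eq0 negb_and.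
by rewrite monic_neq0 // monic_prod_XsubC.
Qed.

Lemma size_Dpoly_tail s : (size (\sum_(i < n) s ord0 i *: 'X^(n - i.+1) : {poly F})%R <= n)%N.
Proof.
apply: leq_trans (size_sum _ _ _) _; apply/bigmax_leqP => i _.
apply: leq_trans (size_scale_leq _ _) _; rewrite size_polyXn.
by case: i => i /= h; lia.
Qed.

Lemma size_Dpoly s : size (Dpoly s) = n.+1.
Proof. by rewrite /Dpoly size_polyDl ?size_polyXn // ltnS size_Dpoly_tail. Qed.

Lemma Dpoly_monic s : Dpoly s \is monic.
Proof.
by rewrite monicE /Dpoly lead_coefDl ?size_polyXn ?ltnS ?size_Dpoly_tail // lead_coefXn.
Qed.

Lemma coef_Dpoly s (i : 'I_n) : (Dpoly s)`_(n - i.+1) = s ord0 i.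
Proof.
have li := ltn_ord i.
rewrite coefD coefXn (_ : (_ == _) = false) ?add0r; last by apply/eqP; lia.
rewrite coef_sum (bigD1 i) //= coefZ coefXn eqxx mulr1 big1 ?addr0 // => k ki.
rewrite coefZ coefXn (_ : (_ == _) = false) ?mulr0 //; apply: contraNF ki => /eqP h.
by apply/eqP/val_inj; have := ltn_ord k; move: h li => /=; lia.
Qed.

Lemma Dpoly_coef (p : {poly F}) : p \is monic -> size p = n.+1 ->
  Dpoly (\row_i p`_(n - (i : 'I_n).+1)) = p.
Proof.
move=> pm sp; apply/polyP => m; case: (ltngtP m n) => hm.
- have hi : (n - m.+1 < n)%N by lia.
  have -> : m = (n - (Ordinal hi).+1)%N by rewrite /=; lia.
  by rewrite coef_Dpoly mxE.
- by rewrite !nth_default ?size_Dpoly ?sp.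
have := monicP pm; have := monicP (Dpoly_monic (\row_i p`_(n - (i : 'I_n).+1))).
by rewrite !lead_coefE size_Dpoly sp hm /= => -> ->.
Qed.

End MonicSplit.

Lemma monic_split (F : closedFieldType) n (p : {poly F}) : p \is monic -> size p = n.+1 ->
  exists e : 'I_n -> F, p = prodX e.
Proof.
move=> pm sp; have [rs] := closed_field_poly_normal p; rewrite (monicP pm) scale1r => pE.
have srs : size rs = n by have := size_prod_XsubC rs id; rewrite -pE sp => -[].
by exists (fun k : 'I_n => rs`_k); rewrite pE (big_nth 0) srs big_mkord.
Qed.

Section Configuration.
Variables (R : realType) (C : complexPlane R).

Lemma cont_coef_prod (T : topologicalType) (J : Type) (u : J -> T -> C) (y : T) (s : seq J) i :
  (forall k, {for y, continuous (u k)}) ->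
  {for y, continuous (fun y => (\prod_(k <- s) ('X - (u k y)%:P))`_i)}.
Proof.
move=> uc; elim: s i => [|k s ih] i.
  apply: (@cont_near _ _ (fun=> (1 : {poly C})`_i)); last exact: cont_cst.
  by apply: nbhsE_all => z; rewrite big_nil.
apply: (@cont_near _ _ (fun y => (if i == 0%N then 0 else
    (\prod_(k <- s) ('X - (u k y)%:P))`_i.-1) - u k y * (\prod_(k <- s) ('X - (u k y)%:P))`_i)).
  by apply: nbhsE_all => z; rewrite big_cons mulrBl coefB coefXM coefCM.
apply: contD; first by case: eqP => _; [exact: cont_cst|exact: ih].
by apply: contN; apply: contM; [exact: uc|exact: ih].
Qed.

Lemma poly_nonroot (p : {poly R}) : p != 0 -> exists x, p.[x] != 0.
Proof.
move=> p0; pose rs : seq R := [seq i%:R | i <- iota 0 (size p)].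
have : ~~ all (root p) rs.
  apply/negP => h; suff u : uniq rs.
    by have := max_poly_roots p0 h u; rewrite size_map size_iota ltnn.
  by rewrite map_inj_uniq ?iota_uniq // => i j /eqP; rewrite eqr_nat => /eqP.
by case/allPn => x _ h; exists x.
Qed.

(* Each excluded direction is a line, which meets the parabola [x + 'i x^2] in
   finitely many points. *)
Lemma generic_center (J : finType) (e : J -> C) : injective e ->
  exists c, (forall k, e k - c != 0) /\
    forall j k, k != j -> ~~ (0 < (e j - c) / (e k - c)).
Proof.
move=> einj.
pose lp (j k : J) : {poly R} := if k == j then 1 else
  ((re (e j))%:P - 'X) * ((im (e k))%:P - 'X^2) - ((im (e j))%:P - 'X^2) * ((re (e k))%:P - 'X).
have lp0 j k : lp j k != 0.
  rewrite /lp; case: (eqVneq k j) => [_|kj]; first exact: oner_neq0.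
  pose x0 := re (e j) * im (e k) - im (e j) * re (e k).
  rewrite [_ - _ * _](_ : _ = x0%:P + (im (e j) - im (e k))%:P * 'X +
    (re (e k) - re (e j))%:P * 'X^2); last by rewrite /x0 !(rmorphB, rmorphM) /=; ring.
  apply/negP => /eqP h; case/negP: kj; apply/eqP/einj/c_ext; apply/eqP.
    have := congr1 (fun p : {poly R} => p`_2) h.
    rewrite /= !coefD !coefCM coefC coefX coefXn coef0 /= mulr0 mulr1 !add0r => /eqP.
    by rewrite subr_eq0.
  have := congr1 (fun p : {poly R} => p`_1) h.
  rewrite /= !coefD !coefCM coefC coefX coefXn coef0 /= mulr0 mulr1 addr0 add0r => /eqP.
  by rewrite subr_eq0 eq_sym.
pose p := (\prod_k ('X - (re (e k))%:P)) * \prod_j \prod_k lp j k.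
have p0 : p != 0.
  rewrite mulf_neq0 //; first by rewrite monic_neq0 // monic_prod_XsubC.
  by apply/prodf_neq0 => j _; apply/prodf_neq0 => k _.
have [x] := poly_nonroot p0; rewrite /p hornerM !horner_prod mulf_eq0 negb_or.
move=> /andP[/prodf_neq0 h1 /prodf_neq0 h2].
have {}h2 j k : (lp j k).[x] != 0.
  by have := h2 j isT; rewrite horner_prod => /prodf_neq0; apply.
pose c : C := ofR x + 'i * ofR (x ^+ 2).
have rc : re c = x by rewrite reD reM !re_ofR !im_ofR re_i im_i; ring.
have ic : im c = x ^+ 2 by rewrite imD imM !re_ofR !im_ofR re_i im_i; ring.
exists c; split=> [k|j k kj].
  apply/negP => /eqP/(congr1 (@re R C)); rewrite reB rc re0 => h.
  by have := h1 k isT; rewrite !hornerE -oppr_eq0 opprB h eqxx.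
apply/negP => hz; have := h2 j k; rewrite /lp (negbTE kj) => /negP; apply.
have vk : e k - c != 0.
  apply/negP => /eqP/(congr1 (@re R C)); rewrite reB rc re0 => h.
  by have := h1 k isT; rewrite !hornerE -oppr_eq0 opprB h eqxx.
set z := _ / _ in hz.
have iz : im z = 0 by have := ltW hz; rewrite leCE im0 => /andP[/eqP].
have E : e j - c = z * (e k - c) by rewrite /z divfK.
have := congr1 (@re R C) E; have := congr1 (@im R C) E.
rewrite reM imM iz !reB !imB rc ic !mul0r subr0 addr0 => e1 e2.
rewrite !(hornerD, hornerN, hornerM, hornerX, hornerXn, hornerC) e1 e2.
by apply/eqP; ring.
Qed.

Lemma pellian_transport (D : {poly C}) (c k : C) : k != 0 -> Pellian D ->
  Pellian ((k *: D) \Po ('X - c%:P)).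
Proof.
move=> k0 [A [B [B0 AB]]]; have s0 := csqrt_neq0 k0.
have sz : size ('X - c%:P : {poly C}) = 2%N by rewrite size_XsubC.
exists (A \Po ('X - c%:P)), (((csqrt k)^-1 *: B) \Po ('X - c%:P)); split.
  by rewrite comp_poly_eq0 ?sz // scaler_eq0 negb_or invr_eq0 s0.
rewrite -!rmorphXn -rmorphM -rmorphB /= exprZn -scalerAl -scalerAr scalerA exprVn csqrt_sqr.
by rewrite mulfV // scale1r AB comp_polyC.
Qed.

Lemma pellian_dense (g : nat) (s : 'rV[C]_(g.+1 + g).+1) (eps : C) : Bset s -> 0 < eps ->
  exists s', Pset s' /\ forall j, `|s' ord0 j - s ord0 j| < eps.
Proof.
move=> sB eps0; set n := (g.+1 + g).+1 in s sB *.
have epsE : eps = ofR (nrm eps) by rewrite -nrmE gtr0_norm.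
have ne0 : 0 < nrm eps by rewrite nrm_gt0 gt_eqF.
have [e sE] := monic_split (Dpoly_monic s) (size_Dpoly s).
have einj : injective e by apply/injectiveP; rewrite -disc_prodX -sE.
have [c [ec cgen]] := generic_center einj.
pose a0 k := (e k - c)^-1.
have a0n k : a0 k != 0 by rewrite invr_eq0.
have a0g j k : k != j -> ~~ (0 < a0 k / a0 j) by move=> kj; rewrite /a0 invrK mulrC cgen.
pose V := 'rV[C]_n.
pose u k (y : V) : C := c + (a0 k + y ord0 k)^-1.
have uc k : {for (0 : V), continuous (u k)}.
  apply: contD; first exact: cont_cst.
  apply: contV; first by rewrite mxE addr0.
  by apply: contD; [exact: cont_cst|exact: coord_continuous].
have uE k : u k 0 = e k by rewrite /u mxE addr0 /a0 invrK addrC subrK.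
have eE : prodX e = prodX (u^~ 0) by apply: eq_bigr => k _; rewrite uE.
have nr : \forall y \near (0 : V), forall i : 'I_n,
    nrm ((prodX e)`_(n - i.+1) - (prodX (u^~ y))`_(n - i.+1)) < nrm eps.
  apply: (near_forall (P := fun (i : 'I_n) y =>
    nrm ((prodX e)`_(n - i.+1) - (prodX (u^~ y))`_(n - i.+1)) < nrm eps)) => i.
  have /contC_P/(_ _ ne0) := @cont_coef_prod V 'I_n u 0 (index_enum 'I_n) (n - i.+1) uc.
  by apply: nbhsS => y; rewrite -/(prodX (u^~ 0)) -eE -/(prodX (u^~ y)).
have [e1 e10 he1] := near_nm (near_diag nr nr).
have d0 : 0 < e1 / n.+1%:R by rewrite divr_gt0.
have [a [an a_neq0 a_inj aP]] := pellian_near a0n a0g d0.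
pose y : V := \row_k (a k - a0 k).
have ye : nm y < e1.
  have h k : nrm (y ord0 k) <= e1 / n.+1%:R by rewrite mxE ltW.
  apply: le_lt_trans (nm_bound h) _; rewrite mulrCA gtr_pMr //.
  by rewrite ltr_pdivrMr // mul1r ltr_nat.
have [hy _] := he1 y y ye ye.
have uy k : u k y = c + (a k)^-1 by rewrite /u mxE [a0 k + _]addrC subrK.
pose q := prodX (u^~ y).
have qm : q \is monic by exact: monic_prod_XsubC.
have qs : size q = n.+1 by exact: size_prodX.
exists (\row_i q`_(n - (i : 'I_n).+1)); split; last first.
  by move=> j; rewrite mxE -[s _ _]coef_Dpoly sE epsE nrmE ofR_lt nrmB.
rewrite /Pset /Bset Dpoly_coef // disc_prodX; split.
  by apply/injectiveP => k l; rewrite !uy => /addrI/invr_inj/a_inj.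
have -> : q = ((\prod_k (- (a k)^-1)) *: Dp a xpredT) \Po ('X - c%:P).
  rewrite /Dp -mul_polyC rmorph_prod -big_split rmorph_prod; apply: eq_bigr => k _ /=.
  rewrite rmorphM /= comp_polyC rmorphB /= comp_polyC comp_polyZ comp_polyX uy.
  have hk : (a k)^-1%:P * (a k)%:P = 1 :> {poly C} by rewrite -polyCM mulVf.
  rewrite -mul_polyC polyCN polyCD; apply/eqP; rewrite -subr_eq0; apply/eqP.
  transitivity ((1 - (a k)^-1%:P * (a k)%:P) * ('X - c%:P) : {poly C}); first by ring.
  by rewrite hk subrr mul0r.
apply: pellian_transport => //; apply/prodf_neq0 => k _; by rewrite oppr_eq0 invr_eq0.
Qed.

End Configuration.

Lemma re_sqrtc_ge0 (R : rcfType) (z : R[i]) : 0 <= complex.Re (sqrtc z).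
Proof. by case: z => x y /=; exact: sqrtr_ge0. Qed.

Definition complex_plane (R : realType) : complexPlane R.
Proof.
apply: (@ComplexPlane R R[i] (@real_complex R) (@complex.Re R) (@complex.Im R) (@sqrtc R)).
- case=> x y; rewrite -complexiE; apply/eqP; rewrite eq_complex /=.
  by apply/andP; split; apply/eqP; ring.
- by [].
- by [].
- by rewrite -complexiE.
- by rewrite -complexiE.
- by case=> [x y] [u v].
- by case=> [x y] [u v].
- by move=> z w; rewrite lecE.
- exact: sqr_sqrtc.
- exact: re_sqrtc_ge0.
Defined.

(* C = R[i] for an arbitrary real-closed field model R : realType of the reals. *)
Theorem theorem1p2 (R : realType) (d : nat) (hd : (2 <= d)%N) :
  dense_in (@Pset R[i] (2 * d)) (@Bset R[i] (2 * d)).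
Proof.
suff H n : n = (d.-1.+1 + d.-1).+1 -> dense_in (@Pset R[i] n) (@Bset R[i] n).
  by apply: H; lia.
by move=> -> s sB eps eps0; exact: (@pellian_dense R (complex_plane R) d.-1 s eps sB eps0).
Qed.
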